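(* Let $F\subset\mathbb{N}\times\mathbb{N}$ be a set that contains a sequence $(\tilde p_n,\tilde q_n)$, $n=1,2,\ldots$, such that $\tilde p_n\to+\infty$ and $\tilde q_n\to+\infty$. Let $\Omega\subset\mathbb{C}$ be an open set and let $\zeta\in\overline{\Omega}$ be fixed. Then there exists $f\in X^\infty(\Omega)$ such that, for every rational function $h$ and every compact set $K\subset\mathbb{C}\setminus\overline{\Omega}$, there exists a sequence $(p_n,q_n)\in F$, $n=1,2,\ldots$, such that $f\in\mathcal{D}_{p_n,q_n}(\zeta)$ for all $n$, $$\sup_{z\in K}\chi\big([f;p_n/q_n]_\zeta(z),h(z)\big)\to0\quad\text{as } n\to+\infty,$$ and for every compact set $L'\subset\overline{\Omega}$ there is $n(L')\in\mathbb{N}$ such that $f\in E_{p_n,q_n,\zeta}(K\cup L')$ for all $n\ge n(L')$, and also $$\sup_{z\in L'}\big|[f;p_n/q_n]_\zeta^{(\ell)}(z)-f^{(\ell)}(z)\big|\to0\quad\text{as } n\to+\infty,\ \text{for all } \ell\in\mathbb{N}.$$ Moreover, the set of all such functions $f\in X^\infty(\Omega)$ is dense and $G_\delta$ in $X^\infty(\Omega)$.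
   Context: $\mathbb{N}=\{0,1,2,\ldots\}$. Closures $\overline{\Omega}$ are taken in $\mathbb{C}$. Function spaces. For an open set $\Omega\subseteq\mathbb{C}$, $A^\infty(\Omega)$ is the set of holomorphic functions $f$ on $\Omega$ such that for every $\ell\in\{0,1,2,\ldots\}$ the derivative $f^{(\ell)}$ extends continuously to $\overline{\Omega}$ (the extension is still denoted $f^{(\ell)}$). It is a Fréchet space with the topology defined by the seminorms $\sup_{z\in \overline{\Omega},|z|\le n}|f^{(\ell)}(z)|$, $\ell\in\{0,1,2,\ldots\}$, $n\in\mathbb{N}$. $X^\infty(\Omega)$ is the closure in $A^\infty(\Omega)$ of the set of all rational functions with poles off $\overline{\Omega}$, with the subspace topology. Chordal metric. On $\mathbb{C}\cup\{\infty\}$, $\chi(a,b)=\frac{|a-b|}{\sqrt{1+|a|^2}\sqrt{1+|b|^2}}$ for $a,b\in\mathbb{C}$, $\chi(a,\infty)=\frac{1}{\sqrt{1+|a|^2}}$ for $a\in\mathbb{C}$, $\chi(\infty,\infty)=0$. Rational functions are regarded as taking values in $\mathbb{C}\cup\{\infty\}$. Padé approximants. For $f\in X^\infty(\Omega)$ and $\zeta\in\overline{\Omega}$ put $a_n=a_n(f,\zeta)=f^{(n)}(\zeta)/n!$ for $n\ge0$ and $a_n=0$ for $n<0$. Let $p,q$ be nonnegative integers. Write $f\in\mathcal{D}_{p,q}(\zeta)$ if $q=0$, or if $q\ge1$ and the $q\times q$ Hankel determinant $\det(a_{p-q+i+j-1})_{1\le i,j\le q}$ is nonzero. Let $S_k(f,\zeta)(z)=\sum_{\nu=0}^k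 a_\nu(z-\zeta)^\nu$ if $k\ge0$ and $S_k=0$ if $k<0$. Define (Jacobi formula) $A(f,\zeta)(z)$ and $B(f,\zeta)(z)$ as the determinants of the $(q+1)\times(q+1)$ matrices with first rows, respectively, $$\big((z-\zeta)^qS_{p-q}(f,\zeta)(z),\ (z-\zeta)^{q-1}S_{p-q+1}(f,\zeta)(z),\ \ldots,\ S_p(f,\zeta)(z)\big)\quad\text{and}\quad\big((z-\zeta)^q,\ (z-\zeta)^{q-1},\ \ldots,\ 1\big),$$ and, in both cases, with $(i+1)$-th row $(a_{p-q+i},a_{p-q+i+1},\ldots,a_{p+i})$ for $i=1,\ldots,q$. For $f\in\mathcal{D}_{p,q}(\zeta)$ the Padé approximant is $[f;p/q]_\zeta(z)=A(f,\zeta)(z)/B(f,\zeta)(z)$; it is the unique rational function $\phi=A/B$ with $\deg A\le p$, $\deg B\le q$, $B(\zeta)\ne0$, whose Taylor coefficients at $\zeta$ of orders $0,\ldots,p+q$ are $a_0,\ldots,a_{p+q}$. $[f;p/q]_\zeta^{(\ell)}$ is its $\ell$-th derivative in $z$. Write $f\in E_{p,q,\zeta}(K)$ if the polynomials $A(f,\zeta)$ and $B(f,\zeta)$ given by the Jacobi formula have no common zero in $K$. *)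

(* Defs.v *)
From HB Require Import structures.
From mathcomp Require Import all_boot all_order all_algebra.
From mathcomp Require Import generic_quotient fraction polydiv complex.
From mathcomp Require Import all_classical all_reals all_analysis.

Set Implicit Arguments.
Unset Strict Implicit.
Unset Printing Implicit Defensive.

Import Order.TTheory GRing.Theory Num.Theory.
Import numFieldNormedType.Exports.
Import ComplexField.Normc.

Local Open Scope classical_set_scope.
Local Open Scope ring_scope.

(* MathComp-Analysis equips an abstract numFieldType, but not R[i], with its
   norm topology; [derive1] on R[i] is then the complex derivative. *)
HB.instance Definition _ (R : realType) := NormedModule.copy R[i] R[i]^o.

(* Supremum of a nonnegative extended-real function; 0 is adjoined so that the
   supremum over the empty set is 0 and not -oo. *)
Definition sup_on (R : realType) (K : set R[i]) (u : R[i] -> \bar R) : \bar R :=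
  ereal_sup (0%E |` (u @` K)).

Section RationalFunctions.
Variable R : realType.
Local Notation C := R[i].

Definition ratfun := {fraction {poly C}}.

Definition rat_gcd (r : ratfun) : {poly C} := gcdp (frac (repr r)).1 (frac (repr r)).2.
Definition rat_num (r : ratfun) : {poly C} := (frac (repr r)).1 %/ rat_gcd r.
Definition rat_den (r : ratfun) : {poly C} := (frac (repr r)).2 %/ rat_gcd r.

(* Value in the Riemann sphere, [None] being the point at infinity. *)
Definition rat_eval (r : ratfun) (z : C) : option C :=
  if root (rat_den r) z then None
  else Some ((rat_num r).[z] / (rat_den r).[z]).

(* The l-th complex derivative of [r] at [z], infinite when [z] is a pole; off
   the poles it does not depend on the default value 0, the derivative being
   local. *)
Definition rat_deriv (r : ratfun) (l : nat) (z : C) : option C :=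
  if rat_eval r z is Some _
  then Some (derive1n l (fun w => odflt 0 (rat_eval r w)) z) else None.

Definition euclid (a : option C) (b : C) : \bar R :=
  if a is Some a' then (normc (a' - b))%:E else +oo%E.

Definition chordal (a b : option C) : R :=
  let s (c : C) := Num.sqrt (1 + normc c ^+ 2) in
  match a, b with
  | Some a', Some b' => normc (a' - b') / (s a' * s b')
  | Some c, None | None, Some c => (s c)^-1
  | None, None => 0
  end.

End RationalFunctions.

Section FunctionSpaces.
Variables (R : realType) (Omega : set R[i]).
Local Notation C := R[i].

(* Continuous extension to [closure Omega] of the l-th derivative of [f]. *)
Definition ext_deriv (f : C -> C) (l : nat) (z : C) : C :=
  lim (derive1n l f x @[x --> within Omega (nbhs z)]).

(* A function on [Omega] is encoded by its extension by 0, so that equality of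
   elements is equality of functions on [Omega]. *)
Record Ainf := MkAinf {
  Ainf_fun :> C -> C ;
  Ainf_holo : forall z, Omega z -> derivable Ainf_fun z 1 ;
  Ainf_ext : forall l, exists2 g : C -> C,
    {within closure Omega, continuous g} &
    forall z, Omega z -> g z = derive1n l Ainf_fun z ;
  Ainf_out : forall z, ~ Omega z -> Ainf_fun z = 0 }.

Definition seminorm (l n : nat) (f : C -> C) : \bar R :=
  sup_on (closure Omega `&` [set z | normc z <= n%:R])
    (fun z => (normc (ext_deriv f l z))%:E).

Definition Ainf_open (U : set Ainf) : Prop :=
  forall f, U f -> exists (N : nat) (e : R), 0 < e /\
    forall g : Ainf,
      (forall l n, (l <= N)%N -> (n <= N)%N ->
        (seminorm l n (fun z => g z - f z)%R < e%:E)%E) -> U g.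

Fact Ainf_openT : Ainf_open setT.
Proof. by move=> f _; exists 0%N, 1. Qed.

Fact Ainf_openI : setI_closed Ainf_open.
Proof.
move=> U V oU oV f [/oU [N [e [e0 Ue]]] /oV [M [d [d0 Vd]]]].
exists (maxn N M), (Num.min e d); split; first by rewrite lt_min e0 d0.
move=> g gf; split; [apply: Ue | apply: Vd] => l n lN nN.
- apply: (lt_le_trans (gf l n _ _)); rewrite ?(leq_trans lN) ?(leq_trans nN)//;
    by rewrite ?leq_maxl ?lee_fin ?ge_min ?lexx.
- apply: (lt_le_trans (gf l n _ _)); rewrite ?(leq_trans lN) ?(leq_trans nN)//;
    by rewrite ?leq_maxr ?lee_fin ?ge_min ?lexx ?orbT.
Qed.

Fact Ainf_open_bigU (I : Type) (U : I -> set Ainf) :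
  (forall i, Ainf_open (U i)) -> Ainf_open (\bigcup_i U i).
Proof.
move=> oU f [i _ /oU [N [e [e0 Ue]]]]; exists N, e; split => // g gf.
by exists i => //; exact: Ue.
Qed.

HB.instance Definition _ := gen_eqMixin Ainf.
HB.instance Definition _ := gen_choiceMixin Ainf.
HB.instance Definition _ :=
  isOpenTopological.Build Ainf Ainf_openT Ainf_openI Ainf_open_bigU.

Definition rational_Ainf : set Ainf := [set f | exists r : ratfun R,
  (forall z, closure Omega z -> rat_eval r z <> None) /\
  (forall z, Omega z -> rat_eval r z = Some (f z))].

(* [set_type] carries the subspace topology. *)
Definition Xinf := set_type (closure rational_Ainf).
HB.instance Definition _ := Topological.on Xinf.

Definition Xinf_fun (f : Xinf) : C -> C := Ainf_fun (val f).

End FunctionSpaces.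

Section Pade.
Variables (R : realType) (a : int -> R[i]) (zeta : R[i]) (p q : nat).
Local Notation C := R[i].

Definition hankel : 'M[C]_q :=
  \matrix_(i < q, j < q) a (p%:Z - q%:Z + i.+1%:Z + j.+1%:Z - 1).

Definition partial_sum (k : int) : {poly C} :=
  if k is Posz m
  then \sum_(nu < m.+1) a nu%:Z *: ('X - zeta%:P) ^+ nu else 0.

Definition jacobi_mx (row0 : nat -> {poly C}) : 'M[{poly C}]_q.+1 :=
  \matrix_(i < q.+1, j < q.+1)
    if val i == 0%N then row0 j
    else (a (p%:Z - q%:Z + i%:Z + j%:Z))%:P.

Definition jacobi_num : {poly C} :=
  \det (jacobi_mx (fun j => ('X - zeta%:P) ^+ (q - j)
                            * partial_sum (p%:Z - q%:Z + j%:Z))).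

Definition jacobi_den : {poly C} :=
  \det (jacobi_mx (fun j => ('X - zeta%:P) ^+ (q - j))).

Definition pade : ratfun R := tofrac jacobi_num / tofrac jacobi_den.

End Pade.

Section UniversalFunctions.
Variables (R : realType) (Omega : set R[i]) (zeta : R[i]).
Local Notation C := R[i].

Definition taylor_coef (f : C -> C) (n : int) : C :=
  if n is Posz k then ext_deriv Omega f k zeta / (k`!)%:R else 0.

Definition in_D (p q : nat) (f : C -> C) : Prop :=
  q = 0%N \/ \det (hankel (taylor_coef f) p q) != 0.

Definition in_E (p q : nat) (K : set C) (f : C -> C) : Prop :=
  ~ exists2 z, K z & root (jacobi_num (taylor_coef f) zeta p q) z
                     /\ root (jacobi_den (taylor_coef f) zeta p q) z.

Definition pade_approx (f : C -> C) (pq : nat * nat) : ratfun R :=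
  pade (taylor_coef f) zeta pq.1 pq.2.

Definition pade_universal (F : set (nat * nat)) (f : C -> C) : Prop :=
  forall (h : ratfun R) (K : set C),
  compact K -> K `<=` ~` closure Omega ->
  exists pq : nat -> nat * nat,
  [/\ forall n, F (pq n),
      forall n, in_D (pq n).1 (pq n).2 f,
      sup_on K (fun z => (chordal (rat_eval (pade_approx f (pq n)) z)
                                  (rat_eval h z))%:E)
        @[n --> \oo] --> 0%E
    & forall L : set C, compact L -> L `<=` closure Omega ->
      (exists nL : nat, forall n, (nL <= n)%N ->
         in_E (pq n).1 (pq n).2 (K `|` L) f) /\
      (forall l : nat,
         sup_on L (fun z => euclid (rat_deriv (pade_approx f (pq n)) l z)
                                   (ext_deriv Omega f l z))
           @[n --> \oo] --> 0%E)].

End UniversalFunctions.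

(* Main.v *)
(** By Baire's theorem it is enough to write the set of universal functions as a
    countable intersection of open dense sets.  The compact sets in the complement and in the
    closure [E] of Omega are exhausted by countably many, and in the chordal metric [h] may be
    taken with Gaussian-rational coefficients.  The coefficients of the Jacobi polynomials
    depend continuously on finitely many derivatives of [f] at zeta, hence openness.

    For density, let [f0] be rational with poles off [E] and let [K] be compact and disjoint
    from [E].  There is a rational [e], without poles on [K] and [E], which is near 1 on [K] and
    near 0 on [E].  Multiplying by factors [e(b) - e(z)] and [e(z) - e(b)] to cancel the poles [b]
    of [f0] in [K] and of [h] in [E], one gets a rational function near [f0] on a neighbourhood
    of the bounded part of [E], and near [h] on [K].  Adding [d * z^k], with [d] small and [k]
    large, brings the degree of its numerator [P] to exactly [p], and then it is its own [p/q]
    Pade approximant: the Jacobi polynomials are a nonzero constant times [P] and [Q].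

    The indicator [e] is a midpoint rule on a square grid for the Cauchy integral of 1 along
    the boundary of a neighbourhood of [K].  Cauchy's estimates, needed for completeness and for
    the control of derivatives, come from averages over the n-th roots of unity: for continuously
    complex differentiable [f], the derivative in [t] of the average of [f(z + t(w - z))(w - c)/(w - z)]
    over the points [w] of the circle is nearly a telescoping sum. *)

(* Let [E] be the closure of [Omega]. The sum (1 - e) * f0 + e * h fails at the poles of [f0] in [K]
   and of [h] in [E]. For a pole [b] of [f0] in [K], the factor e(b) - e(z) cancels it; the factor
   is near 1 for z in [E], and on [K] its quotient by z - b stays bounded, by Cauchy's estimate for
   e near b, so that the small factor 1 - e still wins. The roles are exchanged for [h]. As [E] may
   be unbounded while a seminorm sees only a bounded part, poles are excluded and e is kept small on
   a neighbourhood of all of [E], whereas closeness to [f0] holds on a bounded part. Working on a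
   neighbourhood is what gives the derivatives up to the boundary.

   The numerator must have degree exactly [p], since this makes the Hankel determinant nonzero; the
   denominator only has to have degree at most [q], so p and q may grow at unrelated rates.
   Homogeneous coordinates for the chordal distance treat the poles of [h] in [K] like other points.
   The continuity of the first derivative, on which the discrete Cauchy formula rests, comes from
   the extension property in [Ainf]. *)
Require Import Defs.
From mathcomp Require Import all_boot all_order all_algebra complex.
From mathcomp Require Import generic_quotient fraction polydiv.
From mathcomp Require Import all_classical all_reals all_analysis borel_hierarchy.
From mathcomp Require Import ring lra zify.

Set Implicit Arguments.
Unset Strict Implicit.
Unset Printing Implicit Defensive.

Import Order.TTheory GRing.Theory Num.Theory.
Import numFieldNormedType.Exports.
Import ComplexField.Normc.

Local Open Scope classical_set_scope.
Local Open Scope complex_scope.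
Local Open Scope ring_scope.
Arguments ComplexField.Normc.normc : simpl never.

(** * Complex differentiability *)

(* [lra] compares atoms up to conversion; abstracting norms first keeps it from
   unfolding limits and derivatives. *)
Ltac norm_lra :=
  repeat match goal with H : is_true _ |- _ => revert H end;
  repeat match goal with |- context [ComplexField.Normc.normc ?x] =>
    generalize (ComplexField.Normc.normc x); intro end;
  intros; lra.

Section NormC.
Variable R : realType.
Local Notation C := R[i].
Local Notation Re := (@complex.Re R).
Local Notation Im := (@complex.Im R).
Implicit Types (x y z w : C).

Lemma normr_normc z : `|z| = (normc z)%:C.
Proof. by []. Qed.

Lemma normc_ge0 z : 0 <= normc z.
Proof. by rewrite -lecR; exact: (normr_ge0 z). Qed.

Lemma normc_gt0 z : (0 < normc z) = (z != 0).
Proof. by rewrite -ltcR; exact: (normr_gt0 z). Qed.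

Lemma normc_eq0 z : (normc z == 0) = (z == 0).
Proof. by apply/eqP/eqP => [/eq0_normc//|->]; rewrite normc0. Qed.

Lemma normcR (r : R) : normc r%:C = `|r|.
Proof. by rewrite /normc /= expr0n/= addr0 sqrtr_sqr. Qed.

Lemma normc_i : normc ('i%C : C) = 1.
Proof. by rewrite /normc /= expr0n/= expr1n add0r sqrtr1. Qed.

Lemma normc_nat (n : nat) : normc (n%:R : C) = n%:R.
Proof.
have -> : (n%:R : C) = (n%:R : R)%:C by rewrite rmorph_nat.
by rewrite normcR normr_nat.
Qed.

Lemma normcD x y : normc (x + y) <= normc x + normc y.
Proof. exact: le_normcD. Qed.

Lemma normcB x y : normc (x - y) = normc (y - x).
Proof. by rewrite -normcN opprB. Qed.

Lemma normcB_le x y : normc (x - y) <= normc x + normc y.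
Proof. by rewrite (le_trans (normcD _ _))// normcN. Qed.

Lemma normc_le_add x y : normc y <= normc (y - x) + normc x.
Proof. by rewrite (le_trans _ (normcD _ _))// subrK. Qed.

Lemma normcBD z x y : normc (x - y) <= normc (x - z) + normc (z - y).
Proof. by rewrite (_ : x - y = (x - z) + (z - y)) ?normcD//; ring. Qed.

Lemma normc_leB x y : normc x - normc y <= normc (x - y).
Proof. by rewrite lerBlDr (le_trans _ (normcD _ _))// subrK. Qed.

Lemma normcX x n : normc (x ^+ n) = normc x ^+ n.
Proof. by elim: n => [|n IH]; rewrite ?normc1// !exprS normcM IH. Qed.

Lemma normc_sum (I : Type) (r : seq I) (P : pred I) (F : I -> C) :
  normc (\sum_(i <- r | P i) F i) <= \sum_(i <- r | P i) normc (F i).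
Proof.
elim/big_ind2 : _ => [|x a y b xa yb|//]; first by rewrite normc0.
by rewrite (le_trans (normcD _ _))// lerD.
Qed.

Lemma normc_Re z : `|Re z| <= normc z.
Proof. by rewrite -lecR (le_trans (normc_ge_Re _)). Qed.

Lemma normc_Im z : `|Im z| <= normc z.
Proof.
case: z => a b; rewrite /normc /= -sqrtr_sqr ler_sqrt ?addr_ge0 ?sqr_ge0//.
by rewrite lerDr sqr_ge0.
Qed.

Lemma normc_leReIm z : normc z <= `|Re z| + `|Im z|.
Proof.
rewrite [in X in X <= _](complexE z) (le_trans (normcD _ _))//.
by rewrite normcM normc_i mul1r !normcR.
Qed.

(** Balls of [R[i]] have radii in [R[i]]; positivity there forces a radius to be real, so real radii
    give the same neighbourhoods. *)
Lemma nbhs_normcP z (U : set C) :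
  nbhs z U <-> exists2 e : R, 0 < e & forall w, normc (w - z) < e -> U w.
Proof.
split=> [/nbhs_ballP[e /= e0 eU]|[e e0 eU]].
  have e_real : e = (Re e)%:C by rewrite RRe_real// gtr0_real.
  exists (Re e); first by rewrite -ltcR -e_real.
  move=> w we; apply: eU; rewrite /ball/= e_real normr_normc ltcR.
  by rewrite normcB.
apply/nbhs_ballP; exists e%:C; first by rewrite /= ltcR.
by move=> w; rewrite /ball/= normr_normc ltcR normcB => /eU.
Qed.

Lemma dnbhs_normcP z (P : set C) : (\forall w \near z^', P w) <->
  exists2 e : R, 0 < e & forall w, normc (w - z) < e -> w != z -> P w.
Proof. by split=> [/nbhs_normcP//|?]; apply/nbhs_normcP. Qed.

Lemma within_normcP (D : set C) z (P : set C) : (\forall w \near within D (nbhs z), P w) <->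
  exists2 e : R, 0 < e & forall w, normc (w - z) < e -> D w -> P w.
Proof. by split=> [/nbhs_normcP//|?]; apply/nbhs_normcP. Qed.

Lemma open_normcP (U : set C) :
  open U <-> forall z, U z -> exists2 e : R, 0 < e & forall w, normc (w - z) < e -> U w.
Proof.
rewrite openE; split=> H z /H; first by move/nbhs_normcP.
by move=> zU; apply/nbhs_normcP.
Qed.

Lemma closure_normcP (A : set C) z :
  closure A z <-> forall e : R, 0 < e -> exists2 w, A w & normc (w - z) < e.
Proof.
split=> [Az e e0|H U /nbhs_normcP[e e0 eU]].
  have /Az[w [Aw]] : nbhs z [set w | normc (w - z) < e].
    by apply/nbhs_normcP; exists e.
  by exists w.
by have [w Aw we] := H e e0; exists w; split => //; exact: eU.
Qed.

Lemma closed_normcP (A : set C) z :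
  closed A -> ~ A z -> exists2 e : R, 0 < e & forall w, A w -> e <= normc (w - z).
Proof.
move=> cA nAz; apply: contrapT => H; apply: nAz.
have /closure_id -> := cA.
apply/closure_normcP => e e0; apply: contrapT => H'; apply: H; exists e => // w Aw.
by rewrite leNgt; apply/negP => we; apply: H'; exists w.
Qed.

Lemma cvg_normcP (T : Type) (F : set_system T) (FF : Filter F) (f : T -> C) l :
  f @ F --> l <-> forall e : R, 0 < e -> \forall t \near F, normc (f t - l) < e.
Proof.
split=> [fl e e0|H].
  have /fl : nbhs l [set w | normc (w - l) < e] by apply/nbhs_normcP; exists e.
  by [].
by move=> U /nbhs_normcP[e e0 eU]; apply: filterS (H e e0) => t /eU.
Qed.

End NormC.

Section HasDerivative.
Variable R : realType.
Local Notation C := R[i].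
Implicit Types (x y z w d h : C) (f g : C -> C).

(** Little-o form of the complex derivative: with a product in place of the difference quotient the
    case [h = 0] is included, and real radii replace filters on [R[i]]. *)
Definition hasD f z d := forall e : R, 0 < e ->
  exists2 r : R, 0 < r & forall h, normc h < r ->
    normc (f (z + h) - f z - d * h) <= e * normc h.

Lemma hasDP f z d : hasD f z d <-> is_derive z (1 : C) f d.
Proof.
split=> [H|[/cvg_ex[/= l fl]]].
  have cv : h^-1 *: ((f \o shift z) (h *: (1 : C)) - f z) @[h --> 0^'] --> d.
    apply/cvg_normcP => e e0; apply/dnbhs_normcP.
    have e20 : 0 < e / 2 by lra.
    have [r r0 H'] := H _ e20.
    exists r => // h; rewrite subr0 => hr h0.
    rewrite /= [h *: 1]mulr1 [_ *: _]/(_ * _).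
    have -> : h^-1 * (f (h + z) - f z) - d = h^-1 * (f (z + h) - f z - d * h).
      by rewrite (addrC h) [RHS]mulrBr (mulrC d) mulKf.
    rewrite normcM normcV ltr_pdivrMl ?normc_gt0//.
    rewrite (le_lt_trans (H' _ hr))// mulrC ltr_pM2l ?normc_gt0//; lra.
  by apply: DeriveDef; [apply/cvg_ex; exists d|exact/cvg_lim].
move=> fd e e0; have ld : l = d by rewrite -fd; apply/esym/cvg_lim.
have := (cvg_normcP (dnbhs_filter 0) _ _).1 fl _ e0.
move=> /dnbhs_normcP[r r0 H].
exists r => // h hr; have [->|h0] := eqVneq h 0.
  by rewrite addr0 mulr0 !subrr normc0 mulr0.
have := H h; rewrite subr0 => /(_ hr h0).
rewrite [h *: 1]mulr1 [_ *: _]/(_ * _) ld.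
have -> : h^-1 * (f (h + z) - f z) - d = h^-1 * (f (z + h) - f z - d * h).
  by rewrite (addrC h) [RHS]mulrBr (mulrC d) mulKf.
by rewrite normcM normcV ltr_pdivrMl ?normc_gt0// => /ltW; rewrite (mulrC e).
Qed.

Lemma hasD_derivable f z d : hasD f z d -> derivable f z 1.
Proof. by move=> /hasDP[]. Qed.

Lemma hasD_derive1 f z d : hasD f z d -> derive1 f z = d.
Proof. by move=> /hasDP[_]; rewrite derive1E. Qed.

Lemma derivable_hasD f z : derivable f z 1 -> hasD f z (derive1 f z).
Proof. by move=> H; apply/hasDP; rewrite derive1E; exact: derivableP. Qed.

Lemma hasD_near f g z d (e : R) : 0 < e ->
  (forall w, normc (w - z) < e -> f w = g w) -> hasD f z d -> hasD g z d.
Proof.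
move=> e0 fg Hf a a0; have [r r0 H] := Hf a a0.
exists (Num.min r e); first by rewrite lt_min r0.
move=> h; rewrite lt_min => /andP[hr he].
rewrite -!fg ?H ?subrr ?normc0//.
by rewrite addrAC subrr add0r.
Qed.

Lemma derive1_near f g z (e : R) : 0 < e ->
  (forall w, normc (w - z) < e -> f w = g w) -> derive1 f z = derive1 g z.
Proof.
move=> e0 fg; rewrite !derive1E; apply: near_eq_derive.
by apply/nbhs_normcP; exists e.
Qed.

Lemma hasD_cst c z : hasD (fun=> c) z 0.
Proof. by move=> e e0; exists 1 => // h _; rewrite subrr mul0r subr0 normc0 mulr_ge0 ?normc_ge0 ?ltW. Qed.

Lemma hasDD f g z a b : hasD f z a -> hasD g z b -> hasD (fun w => f w + g w) z (a + b).
Proof. by move=> /hasDP H1 /hasDP H2; apply/hasDP; exact: is_deriveD. Qed.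

Lemma hasDB f g z a b : hasD f z a -> hasD g z b -> hasD (fun w => f w - g w) z (a - b).
Proof. by move=> /hasDP H1 /hasDP H2; apply/hasDP; exact: is_deriveB. Qed.

Lemma hasDM f g z a b : hasD f z a -> hasD g z b ->
  hasD (fun w => f w * g w) z (f z * b + g z * a).
Proof.
by move=> /hasDP H1 /hasDP H2; apply/hasDP; exact: is_deriveM.
Qed.

Lemma hasDZ f z a c : hasD f z a -> hasD (fun w => c * f w) z (c * a).
Proof.
by move=> H; have := hasDM (hasD_cst c z) H; rewrite mulr0 addr0.
Qed.

Lemma hasD_sum (I : Type) (r : seq I) (f : I -> C -> C) z (d : I -> C) :
  (forall i, hasD (f i) z (d i)) ->
  hasD (fun w => \sum_(i <- r) f i w) z (\sum_(i <- r) d i).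
Proof.
move=> H; elim: r => [|i r IH].
  rewrite big_nil (_ : (fun w => _) = fun=> 0); first exact: hasD_cst.
  by apply/funext => w; rewrite big_nil.
rewrite big_cons (_ : (fun w => _) = fun w => f i w + \sum_(j <- r) f j w).
  exact: hasDD.
by apply/funext => w; rewrite big_cons.
Qed.

Lemma hasD_horner (p : {poly C}) z : hasD (horner p) z p^`().[z].
Proof.
elim/poly_ind: p => [|p c IH].
  rewrite deriv0 horner0 (_ : horner 0 = fun=> 0); first exact: hasD_cst.
  by apply/funext => w; rewrite horner0.
have Hid : hasD id z 1 by apply/hasDP; exact: is_derive_id.
have := hasDD (hasDM IH Hid) (hasD_cst c z); congr hasD.
  by apply/funext => w; rewrite hornerMXaddC.
by rewrite derivD derivC derivM derivX !hornerE /= addrC mulrC.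
Qed.

Lemma hasDV f z a : f z != 0 -> hasD f z a -> hasD (fun w => (f w)^-1) z (- a / f z ^+ 2).
Proof.
move=> fz /hasDP [H1 H2]; apply/hasDP; apply: DeriveDef; first exact: derivableV.
rewrite deriveV// H2; transitivity ((- f z ^- 2) * a); first by [].
by rewrite mulrC mulrN mulNr.
Qed.

Lemma hasD_continuous f z d : hasD f z d ->
  forall e : R, 0 < e -> exists2 r : R, 0 < r & forall w, normc (w - z) < r -> normc (f w - f z) < e.
Proof.
move=> H e e0; have [r r0 Hr] := H 1 ltr01.
have k0 : 0 < 1 + normc d by rewrite (lt_le_trans ltr01)// lerDl normc_ge0.
exists (Num.min r (e / (1 + normc d))); first by rewrite lt_min r0 divr_gt0.
move=> w; rewrite lt_min => /andP[wr we].
have := Hr _ wr; rewrite (addrC z) subrK mul1r => wz.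
rewrite (le_lt_trans (_ : _ <= (1 + normc d) * normc (w - z)))//; last first.
  by rewrite mulrC -ltr_pdivlMr.
rewrite (_ : f w - f z = (f w - f z - d * (w - z)) + d * (w - z)); last by ring.
by rewrite (le_trans (normcD _ _))// mulrDl mul1r normcM lerD.
Qed.

End HasDerivative.

Section MeanValue.
Variable R : realType.
Local Notation C := R[i].
Local Notation Re := (@complex.Re R).
Implicit Types (x y z w d h : C) (f : C -> C) (g : R -> C).

Definition hasDR g (t : R) d := forall e : R, 0 < e ->
  exists2 r : R, 0 < r & forall k : R, `|k| < r ->
    normc (g (t + k) - g t - d * k%:C) <= e * `|k|.

Lemma hasDR_comp f z h (t : R) d : hasD f (z + t%:C * h) d ->
  hasDR (fun s => f (z + s%:C * h)) t (d * h).
Proof.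
move=> H e e0; have k0 : 0 < 1 + normc h by rewrite (lt_le_trans ltr01)// lerDl normc_ge0.
have [r r0 Hr] := H _ (divr_gt0 e0 k0).
exists (r / (1 + normc h)); first by rewrite divr_gt0.
move=> k; rewrite ltr_pdivlMr// => kr.
have kh : normc (k%:C * h) = `|k| * normc h by rewrite normcM normcR.
have kh1 : `|k| * normc h <= `|k| * (1 + normc h) by rewrite ler_wpM2l// lerDr.
have := Hr (k%:C * h); rewrite kh => /(_ (le_lt_trans kh1 kr)).
rewrite rmorphD /= mulrDl addrA -mulrA (mulrC h) => /le_trans; apply.
rewrite -mulrA ler_pM2l// mulrC ler_pdivrMr//.
Qed.

Lemma hasDR_sum (I : Type) (r : seq I) (g : I -> R -> C) t (d : I -> C) :
  (forall i, hasDR (g i) t (d i)) ->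
  hasDR (fun s => \sum_(i <- r) g i s) t (\sum_(i <- r) d i).
Proof.
move=> H; elim: r => [|i r IH] e e0.
  exists 1 => // k _; rewrite !big_nil mul0r !subr0 normc0 mulr_ge0// ltW//.
have e20 : 0 < e / 2 by lra.
have [r1 r10 H1] := H i _ e20; have [r2 r20 H2] := IH _ e20.
exists (Num.min r1 r2); first by rewrite lt_min r10.
move=> k; rewrite lt_min !big_cons => /andP[k1 k2].
have := lerD (H1 _ k1) (H2 _ k2); rewrite -mulrDl -splitr; apply: le_trans.
rewrite (le_trans _ (normcD _ _))// le_eqVlt; apply/orP; left; apply/eqP; congr normc; ring.
Qed.

Lemma hasDR_mul g t d c : hasDR g t d -> hasDR (fun s => g s * c) t (d * c).
Proof.
move=> H e e0; have k0 : 0 < 1 + normc c by rewrite (lt_le_trans ltr01)// lerDl normc_ge0.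
have [r r0 Hr] := H _ (divr_gt0 e0 k0).
exists r => // k kr.
rewrite (_ : _ - _ = (g (t + k) - g t - d * k%:C) * c); last by ring.
rewrite normcM (le_trans (ler_wpM2r (normc_ge0 _) (Hr _ kr)))//.
rewrite (_ : _ * _ = normc c / (1 + normc c) * (e * `|k|)); last by ring.
by rewrite ler_piMl ?mulr_ge0 ?(ltW e0)// ler_pdivrMr// mul1r lerDr.
Qed.

Lemma mean_value_le g (dg : R -> C) (M : R) :
  (forall t : R, 0 <= t <= 1 -> hasDR g t (dg t)) ->
  (forall t : R, 0 <= t <= 1 -> normc (dg t) <= M) ->
  normc (g 1 - g 0) <= M.
Proof.
move=> Hd HM; have M0 : 0 <= M by rewrite (le_trans (normc_ge0 _) (HM 0 _))// lexx ler01.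
have [->|v0] := eqVneq (g 1 - g 0) 0; first by rewrite normc0.
pose v := g 1 - g 0; pose u : C := (v^* / (normc v)%:C).
have nv : normc v != 0 by rewrite normc_eq0.
have nu : normc u = 1.
  have e1 : normc v^* = normc v.
    by have /= := normcJ v; rewrite !normr_normc => -[].
  by rewrite /u normcM normcV normcR ger0_norm ?normc_ge0// e1 divff.
have uv : u * v = (normc v)%:C.
  have := sqr_normc v; rewrite normr_normc => e1.
  rewrite /u mulrAC (mulrC v^*) -e1 expr2 -mulrA divff ?mulr1//.
  by apply: contra nv => /eqP [->].
have ReE (u0 a b c : C) (k : R) :
  Re (u0 * c) * k - (Re (u0 * a) - Re (u0 * b)) = Re (u0 * - (a - b - c * k%:C)).
  by case: u0 a b c => [? ?] [? ?] [? ?] [? ?] /=; ring.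
have ReB (u0 a b : C) : Re (u0 * a) - Re (u0 * b) = Re (u0 * (a - b)).
  by case: u0 a b => [? ?] [? ?] [? ?] /=; ring.
pose phi (t : R) : R := Re (u * g t).
have dphi (t : R) : 0 <= t <= 1 -> is_derive t (1 : R) phi (Re (u * dg t)).
  move=> t01; have cv : h^-1 *: ((phi \o shift t) (h *: (1 : R)) - phi t) @[h --> 0^'] --> Re (u * dg t).
    apply/cvgrPdist_le => e e0.
    have [r r0 H] := Hd t t01 e e0.
    apply/nbhs_ballP; exists r => //= h; rewrite /ball/= sub0r normrN => hr h0.
    have H' := H h hr; rewrite [h%:A]mulr1.
    rewrite -(@ler_pM2r _ `|h|) ?normr_gt0// (le_trans _ H')//.
    rewrite -normrM (_ : _ * h = Re (u * - (g (t + h) - g t - dg t * h%:C))).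
      by rewrite (le_trans (normc_Re _))// normcM nu mul1r normcN.
    have -> : h^-1 *: (phi (h + t) - phi t) = h^-1 * (phi (h + t) - phi t) by [].
    have key X : h^-1 * X * h = X by rewrite mulrC mulrA mulfV ?mul1r.
    rewrite mulrBl key /phi (addrC h).
    exact: ReE.
  apply: DeriveDef; last by exact/cvg_lim.
  by apply/cvg_ex; eexists; exact: cv.
have [c c01 Hc] : exists2 c, c \in `]0, 1[%R & phi 1 - phi 0 = Re (u * dg c) * (1 - 0).
  apply: MVT => //.
    move=> x; rewrite in_itv /= => /andP[x0 x1]; apply: dphi; rewrite !ltW//.
  apply: derivable_within_continuous => x; rewrite in_itv /= => x01.
  by have [] := dphi x x01.
rewrite -/v; have -> : normc v = phi 1 - phi 0.
  have -> : phi 1 - phi 0 = Re (u * v).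
    exact: ReB.
  by rewrite uv.
rewrite Hc subr0 mulr1 (le_trans (ler_norm _))// (le_trans (normc_Re _))//.
rewrite normcM nu mul1r; apply: HM.
by move: c01; rewrite in_itv /= => /andP[/ltW-> /ltW->].
Qed.

Lemma mean_value_segment f (df : C -> C) z h (M : R) :
  (forall t : R, 0 <= t <= 1 -> hasD f (z + t%:C * h) (df (z + t%:C * h))) ->
  (forall t : R, 0 <= t <= 1 -> normc (df (z + t%:C * h)) <= M) ->
  normc (f (z + h) - f z) <= M * normc h.
Proof.
move=> Hd HM.
have := @mean_value_le (fun t => f (z + t%:C * h)) (fun t => df (z + t%:C * h) * h) (M * normc h).
rewrite mul1r mul0r addr0; apply => t t01; first exact/hasDR_comp/Hd.
by rewrite normcM ler_wpM2r ?normc_ge0// HM.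
Qed.

End MeanValue.

(** * Uniform constants from compactness *)

Section Compactness.
Variable R : realType.
Local Notation C := R[i].
Local Notation Re := (@complex.Re R).
Local Notation Im := (@complex.Im R).
Implicit Types (x y z w d h : C) (f : C -> C) (K : set C).

(** One compactness argument for the uniform constants below: [eta] serves as a distance, as a
    modulus of continuity or, through [eta^-1], as a bound. The local hypothesis ranges over all
    small [eta], so that a common value can be taken. *)
Lemma compact_uniform K (P : R -> C -> Prop) : compact K ->
  (forall x, K x -> exists2 r : R, 0 < r & forall w (eta : R), normc (w - x) < r ->
     0 < eta < r -> K w -> P eta w) ->
  exists2 eta : R, 0 < eta & forall w, K w -> P eta w.
Proof.
move=> /compact_near_coveringP cK H.
have := @cK R (at_right 0) (fun eta w => K w -> P eta w) _.
have Hc : forall x, K x -> \forall x' \near x & i \near at_right (0 : R), K x' -> P i x'.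
  move=> x /H[r r0 Hr].
  exists ([set w | normc (w - x) < r], [set e : R | 0 < e < r]) => /=.
    split; first by apply/nbhs_normcP; exists r.
    by near=> e; apply/andP; split; near: e; [exact: nbhs_right_gt|exact: nbhs_right_lt].
  by move=> [w e] /= [wr er]; exact: Hr.
move=> /(_ _ Hc) HK.
have : \forall e \near at_right (0 : R), 0 < e /\ (forall w, K w -> K w -> P e w).
  by near=> e; split; near: e; [exact: nbhs_right_gt|exact: HK].
move=> /filter_ex[e [e0 He]]; exists e => // w Kw; exact: He.
Unshelve. all: by end_near. Qed.

Lemma compact_normc_bounded K : compact K -> exists2 M : R, 0 < M & forall w, K w -> normc w <= M.
Proof.
move=> cK; have [|e e0 He] := @compact_uniform K (fun e w => normc w <= e^-1) cK.
  move=> x Kx; have n0 : 0 < normc x + 1 by rewrite (lt_le_trans ltr01)// lerDr normc_ge0.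
  exists (Num.min 1 (normc x + 1)^-1); first by rewrite lt_min ltr01 invr_gt0.
  move=> w e; rewrite lt_min => /andP[w1 _] /andP[e0]; rewrite lt_min => /andP[_ e1] _.
  rewrite (@le_trans _ _ (normc x + 1))//; last first.
    by rewrite -[leLHS]invrK lef_pV2 ?posrE ?invr_gt0// ltW.
  rewrite -[w in leLHS](subrK x) (le_trans (normcD _ _))// addrC lerD2l ltW//.
by exists e^-1; rewrite ?invr_gt0.
Qed.

Lemma compact_dist_gt0 K (E : set C) : compact K -> closed E -> K `<=` ~` E ->
  exists2 r : R, 0 < r & forall w y, K w -> E y -> r <= normc (y - w).
Proof.
move=> cK cE KE.
have [|r r0 Hr] := @compact_uniform K (fun e w => forall y, E y -> e <= normc (y - w)) cK.
  move=> x Kx; have [e e0 He] := closed_normcP cE (KE _ Kx).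
  exists (e / 2); first lra.
  move=> w a wx /andP[a0 a1] Kw y Ey.
  have := He y Ey; have := normcBD w y x; lra.
by exists r => // w y Kw; exact: Hr.
Qed.

(** [K] is a closed subset of the continuous image of a compact square of [R * R]. *)
Lemma bounded_closed_compactC K (M : R) : closed K -> (forall w, K w -> normc w <= M) -> compact K.
Proof.
move=> clK KM.
pose g (p : R * R) : C := p.1 +i* p.2.
have gc : continuous g.
  move=> [a b]; apply/cvg_normcP => e e0.
  exists ([set x | `|a - x| < e / 2], [set y | `|b - y| < e / 2]) => /=.
    by split; apply/nbhs_ballP; exists (e / 2) => //=; lra.
  move=> [x y] [/= xe ye]; change (normc (g (x, y) - g (a, b)) < e); apply: (le_lt_trans (normc_leReIm _)); rewrite /=.
  by rewrite (distrC x) (distrC y) (splitr e) ltrD.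
have cS : compact (g @` (`[- M, M]%classic `*` `[- M, M]%classic)).
  apply: continuous_compact; first exact: continuous_subspaceT.
  by apply: compact_setX; exact: segment_compact.
apply: (subclosed_compact clK cS) => w Kw.
exists (Re w, Im w) => /=; last by case: w {Kw}.
rewrite !in_itv /= -!ler_norml.
by rewrite !(le_trans _ (KM _ Kw)) ?normc_Re ?normc_Im.
Qed.

End Compactness.

(** * Cauchy estimates *)

Section UnitCircle.
Variable R : realType.
Local Notation C := R[i].
Implicit Types (x y t : R).

Definition cis x : C := cos x +i* sin x.

Lemma cisD x y : cis (x + y) = cis x * cis y.
Proof. by rewrite /cis cosD sinD; congr (_ +i* _); ring. Qed.

Lemma cis0 : cis 0 = 1.
Proof. by rewrite /cis cos0 sin0. Qed.

Lemma cisMn x n : cis (x *+ n) = cis x ^+ n.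
Proof. by elim: n => [|n IH]; rewrite ?mulr0n ?cis0// mulrS cisD IH exprS. Qed.

Lemma normc_cis x : normc (cis x) = 1.
Proof. by rewrite /normc /= cos2Dsin2 sqrtr1. Qed.

(** By the half-angle formula the real part is [1 - 2 * sin (x / 2) ^+ 2], and [x / 2] lies strictly
    between 0 and [pi]. *)
Lemma cis_neq1 x : 0 < x < pi *+ 2 -> cis x != 1.
Proof.
move=> /andP[x0 x2]; apply/eqP => -[cx _].
have s0 : 0 < sin (x / 2).
  by apply: sin_gt0_pi; rewrite divr_gt0//= ltr_pdivrMr// mulr_natr.
have := cosD (x / 2) (x / 2); rewrite -splitr cx -!expr2 cos2sin2 => H.
have := exprn_gt0 2 s0; lra.
Qed.

Lemma cis_near1 (e : R) : 0 < e -> exists2 d : R, 0 < d &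
  forall x, `|x| < d -> normc (cis x - 1) < e.
Proof.
move=> e0; have e2 : 0 < e / 2 by lra.
have /cvgrPdist_lt/(_ _ e2)/nbhs_ballP[d1 /= d10 H1] := @continuous_cos R 0.
have /cvgrPdist_lt/(_ _ e2)/nbhs_ballP[d2 /= d20 H2] := @continuous_sin R 0.
exists (Num.min d1 d2); first by rewrite lt_min d10.
move=> x; rewrite lt_min => /andP[x1 x2].
have := H1 x; rewrite /ball/= sub0r normrN cos0 => /(_ x1) c1.
have := H2 x; rewrite /ball/= sub0r normrN sin0 => /(_ x2) c2.
apply: (le_lt_trans (@normc_leReIm R _)); rewrite /= oppr0 addr0 (splitr e) ltrD//.
  by rewrite distrC.
by rewrite -(normrN (sin x)) -sub0r.
Qed.

Definition omega (n : nat) : C := cis (pi *+ 2 / n%:R).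

Lemma omegaX n j : omega n ^+ j = cis (pi *+ 2 * j%:R / n%:R).
Proof. by rewrite /omega -cisMn -[_ / _ *+ j]mulr_natr mulrAC. Qed.

Lemma omega_exp n : (0 < n)%N -> omega n ^+ n = 1.
Proof.
move=> n0; rewrite omegaX mulfK ?pnatr_eq0 -?lt0n//.
by rewrite /cis cos2pi sin2pi.
Qed.

Lemma omega_neq1 n j : (0 < j < n)%N -> omega n ^+ j != 1.
Proof.
move=> /andP[j0 jn]; rewrite omegaX; apply: cis_neq1.
have n0 : (0 < n)%N by rewrite (leq_trans _ jn).
have p0 : 0 < pi *+ 2 :> R by rewrite mulrn_wgt0// pi_gt0.
by rewrite divr_gt0 ?mulr_gt0 ?ltr0n//= ltr_pdivrMr ?ltr0n// ltr_pM2l// ltr_nat.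
Qed.

Lemma normc_omega n j : normc (omega n ^+ j) = 1.
Proof. by rewrite omegaX normc_cis. Qed.

Lemma omega_neq0 n j : omega n ^+ j != 0.
Proof. by rewrite -normc_eq0 normc_omega oner_eq0. Qed.

Lemma omega_near1 (e : R) : 0 < e -> exists n0, forall n, (n0 <= n)%N -> normc (omega n - 1) < e.
Proof.
move=> /cis_near1[d d0 H].
exists (Num.truncn (pi *+ 2 / d)).+1 => n n0n; apply: H.
have n0 : (0 < n)%N by rewrite (leq_trans _ n0n).
have p0 : 0 < pi *+ 2 :> R by rewrite mulrn_wgt0// pi_gt0.
rewrite ger0_norm ?divr_ge0 ?ler0n ?(ltW p0)// ltr_pdivrMr ?ltr0n//.
rewrite mulrC -ltr_pdivrMr// (lt_le_trans (truncnS_gt _))// ler_nat//.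
Qed.

Lemma sum_omega n j : (0 < j < n)%N -> \sum_(k < n) (omega n ^+ j) ^+ k = 0.
Proof.
move=> jn; have := subrX1 (omega n ^+ j) n.
rewrite -exprM mulnC exprM omega_exp ?expr1n ?subrr; last first.
  by case/andP: jn => _; exact: leq_ltn_trans.
by move/esym/eqP; rewrite mulf_eq0 subr_eq0 (negPf (omega_neq1 jn)) => /eqP.
Qed.

(** Discrete Cauchy formula for the constant 1. Multiplication by [1 - x ^+ n] turns each term into
    a finite geometric sum in [x / omega n ^+ k], and summation over [k] kills all powers but the
    zeroth. *)
Lemma sum_omega_inv n (x : C) : (0 < n)%N -> normc x < 1 ->
  \sum_(k < n) (omega n ^+ k) / (omega n ^+ k - x) = n%:R / (1 - x ^+ n).
Proof.
move=> n0 x1.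
have xn1 : 1 - x ^+ n != 0.
  rewrite subr_eq0; apply/eqP => /(congr1 (@normc R)); rewrite normc1 normcX => /esym /eqP.
  by rewrite pexpr_eq1 ?normc_ge0// lt_eqF.
have xk k : omega n ^+ k - x != 0.
  rewrite subr_eq0; apply/eqP => /(congr1 (@normc R)); rewrite normc_omega => /esym/eqP.
  by rewrite lt_eqF.
apply: (canRL (mulfK xn1)); rewrite mulr_suml.
transitivity (\sum_(k < n) \sum_(j < n) x ^+ j * (omega n ^+ k) ^- j).
  apply: eq_bigr => k _; set o := omega n ^+ k; have o0 : o != 0 := omega_neq0 n k.
  have on : (x / o) ^+ n = x ^+ n.
    by rewrite expr_div_n -exprM mulnC exprM omega_exp// expr1n divr1.
  have := subrX1 (x / o) n; rewrite on => e1.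
  have -> : 1 - x ^+ n = (1 - x / o) * \sum_(i < n) (x / o) ^+ i.
    by rewrite -opprB e1 -mulNr opprB.
  rewrite mulrA (_ : o / (o - x) * (1 - x / o) = 1); last first.
    by have := xk k; rewrite -/o => xk'; field; rewrite o0.
  by rewrite mul1r; apply: eq_bigr => j _; rewrite expr_div_n.
rewrite exchange_big /=; case: n n0 {xn1 xk} => // n _.
rewrite big_ord_recl [X in _ + X]big1 => [|j _].
  rewrite addr0; under eq_bigr do rewrite expr0 mul1r expr0 invr1.
  by rewrite sumr_const card_ord.
rewrite -mulr_sumr; apply/eqP; rewrite mulf_eq0; apply/orP; right.
have jn : (0 < bump 0 j < n.+1)%N by rewrite /bump /= add1n ltnS ltn_ord.
(* On the unit circle inverses are conjugates, so the sum of the negative powers is the conjugate of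
   a vanishing sum. *)
have /(congr1 (fun z : C => z^*)) := sum_omega jn.
rewrite rmorph_sum /= rmorph0 => {2}<-; apply/eqP/eq_bigr => k _.
rewrite -!exprM mulnC; set a := (_ * _)%N.
have /(congr1 (fun r : R => (r%:C) ^+ 2)) := normc_omega n.+1 a.
rewrite -normr_normc sqr_normc rmorph1 expr1n => e1.
by apply: (mulfI (omega_neq0 n.+1 a)); rewrite e1 mulfV// omega_neq0.
Qed.

End UnitCircle.

Section Cauchy.
Variable R : realType.
Local Notation C := R[i].
Implicit Types (f df : C -> C) (c z : C) (rho : R).

Definition circ c rho n k : C := c + rho%:C * omega R n ^+ k.

(** The [n]-point Riemann sum of Cauchy's integral for the derivative of order [l]: on the circle dw
    = i (w - c) dtheta, which cancels the factor 2 pi i. *)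
Definition cauchy_sum f c rho n l z : C :=
  n%:R^-1 * \sum_(k < n) f (circ c rho n k) * (rho%:C * omega R n ^+ k) * (l`!)%:R
     / (circ c rho n k - z) ^+ l.+1.

Lemma circ_dist c rho n k : 0 <= rho -> normc (circ c rho n k - c) = rho.
Proof.
by move=> r0; rewrite /circ addrAC subrr add0r normcM normc_omega mulr1 normcR ger0_norm.
Qed.

Lemma circ_far c rho n k z : 0 <= rho -> normc (z - c) <= rho / 2 ->
  rho / 2 <= normc (circ c rho n k - z).
Proof.
move=> r0 zc; have := circ_dist c n k r0; have := normcBD z (circ c rho n k) c; lra.
Qed.

Lemma hasD_cauchy_sum f c rho n l z : 0 < rho -> normc (z - c) <= rho / 2 ->
  hasD (cauchy_sum f c rho n l) z (cauchy_sum f c rho n l.+1 z).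
Proof.
move=> r0 zc; apply: hasDZ; apply: hasD_sum => k.
have w0 : circ c rho n k - z != 0.
  by rewrite -normc_gt0 (lt_le_trans _ (circ_far n k (ltW r0) zc))// divr_gt0.
set w := circ c rho n k; set a := _ * _ * (l`!)%:R.
have -> : f w * (rho%:C * omega R n ^+ k) * (l.+1)`!%:R / (w - z) ^+ l.+2 =
   a * (- (l.+1%:R * (w - z) ^+ l * -1) / ((w - z) ^+ l.+1) ^+ 2).
  rewrite factS natrM /a; move: (l`!)%:R => F; rewrite !exprS expr0.
  by field; rewrite w0 /= expf_neq0.
apply: hasDZ; apply: hasDV; first by rewrite expf_neq0.
have -> : (fun w0 => (w - w0) ^+ l.+1) = (horner ((w%:P - 'X) ^+ l.+1)).
  by apply/funext => y; rewrite !hornerE.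
have -> : l.+1%:R * (w - z) ^+ l * -1 = ((w%:P - 'X) ^+ l.+1)^`().[z].
  rewrite deriv_exp derivB derivC derivX sub0r /= hornerMn mulN1r hornerN horner_exp.
  by rewrite hornerD hornerN hornerC hornerX mulrN1 mulr_natl mulNrn.
exact: hasD_horner.
Qed.

(** Points of the half disc keep distance [rho / 2] from the circle. The bound is independent of
    [n], so it survives the limit. *)
Lemma cauchy_sum_le f c rho n l z M : 0 < rho -> normc (z - c) <= rho / 2 ->
  (forall w, normc (w - c) <= rho -> normc (f w) <= M) ->
  normc (cauchy_sum f c rho n l z) <= M * rho * (l`!)%:R * (2 / rho) ^+ l.+1.
Proof.
move=> r0 zc HM; have M0 : 0 <= M.
  by apply: (le_trans (normc_ge0 (f c))); apply: HM; rewrite subrr normc0 ltW.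
set B := (X in _ <= X).
have B0 : 0 <= B.
  by rewrite /B !mulr_ge0 ?ler0n ?(ltW r0)// exprn_ge0// divr_ge0// ltW.
case: n => [|n]; first by rewrite /cauchy_sum invr0 mul0r normc0.
rewrite normcM normcV normc_nat ler_pdivrMl ?ltr0n//.
rewrite (le_trans (normc_sum _ _ _))//.
rewrite (_ : _ * B = \sum_(k < n.+1) B); last by rewrite sumr_const card_ord mulr_natl.
apply: ler_sum => k _.
rewrite !normcM normcV normc_omega normcX normc_nat mulr1 normcR gtr0_norm//.
rewrite /B; apply: ler_pM; rewrite ?mulr_ge0 ?normc_ge0 ?(ltW r0) ?ler0n ?invr_ge0 ?exprn_ge0 ?normc_ge0//.
  by rewrite !ler_wpM2r ?ler0n ?(ltW r0)// HM// circ_dist ?(ltW r0).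
rewrite -exprVn lerXn2r ?nnegrE ?invr_ge0 ?normc_ge0 ?divr_ge0 ?(ltW r0)//.
rewrite -[X in _ <= X]invf_div lef_pV2 ?posrE ?divr_gt0//; first exact: circ_far (ltW r0) zc.
by rewrite (lt_le_trans _ (circ_far _ _ (ltW r0) zc))// divr_gt0.
Qed.

Lemma disc_convex c rho (y h : C) (t : R) : 0 <= t <= 1 ->
  normc (y - c) <= rho -> normc (y + h - c) <= rho -> normc (y + t%:C * h - c) <= rho.
Proof.
move=> /andP[t0 t1] H1 H2.
rewrite (_ : _ - c = (1 - t)%:C * (y - c) + t%:C * (y + h - c)); last first.
  by rewrite rmorphB rmorph1; ring.
rewrite (le_trans (normcD _ _))// !normcM !normcR !ger0_norm ?subr_ge0//.
have -> : rho = (1 - t) * rho + t * rho by ring.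
by rewrite lerD// ler_wpM2l// subr_ge0.
Qed.

Section Formula.
Variables (f df : C -> C) (c : C) (rho : R).
Hypothesis rho0 : 0 < rho.
Hypothesis fD : forall w, normc (w - c) <= rho -> hasD f w (df w).
Hypothesis dfC : forall w, normc (w - c) <= rho -> forall e : R, 0 < e ->
  exists2 r : R, 0 < r & forall y, normc (y - c) <= rho -> normc (y - w) < r ->
    normc (df y - df w) < e.

Let disc := [set w : C | normc (w - c) <= rho].

Lemma compact_disc : compact disc.
Proof.
apply: (@bounded_closed_compactC _ _ (normc c + rho)).
  move=> z Hz; rewrite /disc /= leNgt; apply/negP => zr.
  have e0 : 0 < normc (z - c) - rho by rewrite subr_gt0.
  have [w wd wz] := (closure_normcP _ _).1 Hz _ e0.
  have wd' : normc (w - c) <= rho := wd.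
  have := normcBD w z c; rewrite (normcB z w); lra.
move=> w Hw; rewrite -[w](subrK c) addrC (le_trans (normcD _ _))// lerD2l //.
Qed.

(** Mean value inequality for [f w - df y * w], whose derivative [df w - df y] is small along the
    segment; compactness of the disc makes the radius uniform. *)
Lemma uniform_linear_approx (e : R) : 0 < e ->
  exists2 r : R, 0 < r & forall y y', disc y -> disc y' -> normc (y' - y) < r ->
    normc (f y' - f y - df y * (y' - y)) <= e * normc (y' - y).
Proof.
move=> e0; have e20 : 0 < e / 2 by lra.
have [|r r0 Hr] := @compact_uniform R disc (fun r w => forall y, disc y ->
   normc (y - w) < r -> normc (df y - df w) <= e) compact_disc.
  move=> x Dx; have [r r0 H] := dfC Dx e20.
  exists (r / 2); first lra.
  move=> w eta wx /andP[eta0 etar] Dw y Dy yw.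
  have wx' : normc (w - x) < r by lra.
  have yx' : normc (y - x) < r by have := normcBD w y x; lra.
  have := H _ Dy yx'; have := H _ Dw wx'.
  have := normcBD (df x) (df y) (df w); rewrite (normcB (df x)); lra.
exists r => // y y' Dy Dy' yy.
have Dt (t : R) : 0 <= t <= 1 -> disc (y + t%:C * (y' - y)).
  by move=> t01; apply: disc_convex => //; rewrite (addrC y) subrK.
have := @mean_value_segment R (fun w => f w - df y * w) (fun w => df w - df y) y (y' - y) e.
rewrite (addrC y) subrK => H.
rewrite (_ : _ - _ = f y' - df y * y' - (f y - df y * y)); last by ring.
apply: H => t t01.
  apply: hasDB; first exact/fD/Dt.
  rewrite -[X in hasD _ _ X]mulr1; apply: hasDZ.
  by apply/hasDP; exact: is_derive_id.
apply: Hr => //; first exact: Dt.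
rewrite addrAC subrr add0r normcM normcR ger0_norm; last by case/andP: t01.
by apply: le_lt_trans yy; rewrite ler_piMl ?normc_ge0//; case/andP: t01.
Qed.

(** [G] joins the sum for the constant [f z] at [t = 0], known exactly and responsible for the
    factor [1 - ((z - c) / rho%:C) ^+ n], to the Cauchy sum at [t = 1]; its derivative is at most
    [n%:R * e]. *)
Lemma cauchy_sum_approx (e : R) : 0 < e -> exists n0, forall n, (n0 <= n)%N ->
  forall z, normc (z - c) <= rho / 2 ->
  normc (cauchy_sum f c rho n 0 z - f z / (1 - ((z - c) / rho%:C) ^+ n)) <= e.
Proof.
move=> e0; have er0 : 0 < e / rho by rewrite divr_gt0.
have [r r0 Hr] := uniform_linear_approx er0.
have [n1 Hn1] := omega_near1 (divr_gt0 r0 rho0).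
have half : rho / 2 <= rho by rewrite ler_pdivrMr// ler_peMr ?(ltW rho0)// (ler_nat _ 1 2).
(* From [n = 2] on, [omega R n] differs from 1 and the roots of unity sum to 0. *)
exists (maxn n1 2) => n; rewrite geq_max => /andP[/Hn1 on n2] z zc.
have n0 : (0 < n)%N by apply: leq_trans n2.
have zc1 : normc (z - c) <= rho := le_trans zc half.
have nC : (n%:R : C) != 0 by rewrite pnatr_eq0 -lt0n.
have w0 k : circ c rho n k - z != 0.
  by rewrite -normc_gt0 (lt_le_trans _ (circ_far n k (ltW rho0) zc))// divr_gt0.
have rhoC : rho%:C != 0 by rewrite -normc_eq0 normcR normr_eq0 gt_eqF.
pose y (t : R) k := z + t%:C * (circ c rho n k - z).
pose G (t : R) := \sum_(k < n) f (y t k) * ((circ c rho n k - c) / (circ c rho n k - z)).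
pose dG (t : R) := \sum_(k < n) df (y t k) * (circ c rho n k - c).
have Dy t k : 0 <= t <= 1 -> disc (y t k).
  move=> t01; apply: disc_convex => //.
  by rewrite (addrC z) subrK circ_dist// ltW.
have HG (t : R) : 0 <= t <= 1 -> hasDR G t (dG t).
  move=> t01; apply: hasDR_sum => k.
  have -> : df (y t k) * (circ c rho n k - c) = df (y t k) * (circ c rho n k - z) *
     ((circ c rho n k - c) / (circ c rho n k - z)) by field; exact: w0.
  by apply: hasDR_mul; apply: hasDR_comp; apply: fD; apply: Dy.
have yS t k : y t k.+1 - y t k = t%:C * (omega R n - 1) * (circ c rho n k - c).
  by rewrite /y /circ exprS; ring.
have HdG (t : R) : 0 <= t <= 1 -> normc (dG t) <= n%:R * e.
  (* At [t = 0] the points [y t k] coincide and the sum is a multiple of the sum of the roots of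
     unity; otherwise one may divide by [t]. *)
  move=> t01; have [->|t0] := eqVneq t 0.
    have -> : dG 0 = df z * rho%:C * \sum_(k < n) (omega R n ^+ 1) ^+ k.
      rewrite mulr_sumr; apply: eq_bigr => k _.
      by rewrite /y mul0r addr0 /circ expr1 addrAC subrr add0r mulrA.
    by rewrite sum_omega// mulr0 normc0 mulr_ge0 ?ler0n ?ltW.
  have tp : 0 < t by rewrite lt_def t0; case/andP: t01.
  have o1 : 0 < normc (omega R n - 1).
    by rewrite normc_gt0 subr_eq0 -[omega R n]expr1 omega_neq1.
  (* Up to this scalar, [dG t] is the sum of the linearised increments of [f] around a closed
     polygon. The true increments sum to 0; what remains are the linearisation errors, each at most
     [e / rho] times the length of an edge. *)
  have E : t%:C * (omega R n - 1) * dG t =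
     - \sum_(k < n) (f (y t k.+1) - f (y t k) - df (y t k) * (y t k.+1 - y t k)).
    rewrite sumrB -(big_mkord xpredT (fun k => f (y t k.+1) - f (y t k))) telescope_sumr//.
    have -> : y t n = y t 0%N by rewrite /y /circ omega_exp// expr0.
    rewrite subrr sub0r opprK mulr_sumr; apply: eq_bigr => k _.
    by rewrite yS; ring.
  have nt : normc (t%:C * (omega R n - 1)) = t * normc (omega R n - 1).
    by rewrite normcM normcR gtr0_norm.
  have : normc (t%:C * (omega R n - 1)) * normc (dG t) <= normc (t%:C * (omega R n - 1)) * (n%:R * e).
    rewrite -normcM E normcN (le_trans (normc_sum _ _ _))//.
    rewrite (_ : _ * _ = \sum_(k < n) normc (t%:C * (omega R n - 1)) * e); last first.
      by rewrite sumr_const card_ord -mulr_natr; ring.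
    apply: ler_sum => k _.
    have ny : normc (y t k.+1 - y t k) = t * normc (omega R n - 1) * rho.
      by rewrite yS normcM nt circ_dist// ltW.
    rewrite (le_trans (Hr _ _ _ _ _))//; [exact: Dy|exact: Dy| |].
      rewrite ny; move: on; rewrite ltr_pdivlMr// => on; apply: le_lt_trans on.
      rewrite ler_wpM2r ?(ltW rho0)// ler_piMl ?normc_ge0//; by case/andP: t01.
    rewrite ny nt (_ : _ / _ * _ = t * normc (omega R n - 1) * e)//.
    by field; rewrite gt_eqF.
  by rewrite ler_pM2l// nt mulr_gt0.
have := mean_value_le HG HdG.
have x1 : normc ((z - c) / rho%:C) < 1.
  rewrite normcM normcV normcR gtr0_norm// ltr_pdivrMr// mul1r (le_lt_trans zc)//.
  by rewrite ltr_pdivrMr// ltr_pMr// (ltr_nat _ 1 2).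
have -> : G 0 = n%:R * (f z / (1 - ((z - c) / rho%:C) ^+ n)).
  have -> : G 0 = f z * \sum_(k < n) (omega R n ^+ k) / (omega R n ^+ k - (z - c) / rho%:C).
    rewrite mulr_sumr; apply: eq_bigr => k _; rewrite /y mul0r addr0.
    congr (_ * _); have := w0 k; rewrite /circ => wk.
    have e1 : c + rho%:C * omega R n ^+ k - c = rho%:C * omega R n ^+ k by ring.
    have e2 : c + rho%:C * omega R n ^+ k - z = rho%:C * (omega R n ^+ k - (z - c) / rho%:C) by field.
    rewrite e1 e2 invfM mulrACA mulfV// mul1r//.
  by rewrite sum_omega_inv// mulrCA.
have -> : G 1 = n%:R * cauchy_sum f c rho n 0 z.
  rewrite /cauchy_sum mulrA mulfV// mul1r; apply: eq_bigr => k _.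
  rewrite /y mul1r (addrC z) subrK mulr1 expr1 -mulrA; congr (_ * _).
  by rewrite /circ addrAC subrr add0r.
rewrite -mulrBr normcM normc_nat ler_pM2l ?ltr0n//.
Qed.

End Formula.
End Cauchy.

Section Sequences.
Variable R : realType.
Local Notation C := R[i].
Local Notation Re := (@complex.Re R).
Local Notation Im := (@complex.Im R).
Implicit Types (u v : nat -> C) (l : C).

Definition tends u l := forall e : R, 0 < e ->
  exists N, forall n, (N <= n)%N -> normc (u n - l) <= e.

Definition cauchyC u := forall e : R, 0 < e ->
  exists N, forall m n, (N <= m)%N -> (N <= n)%N -> normc (u m - u n) <= e.

Lemma complete_real (u : nat -> R) :
  (forall e : R, 0 < e -> exists N, forall m n, (N <= m)%N -> (N <= n)%N -> `|u m - u n| <= e) ->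
  exists a : R, forall e : R, 0 < e -> exists N, forall n, (N <= n)%N -> `|u n - a| <= e.
Proof.
move=> H; have cu : cauchy (u @ \oo).
  apply/cauchy_exP => e e0; have e2 : 0 < e / 2 by lra.
  have [N HN] := H _ e2; exists (u N); exists N => // n /= Nn.
  by rewrite /ball/=; have := HN _ _ (leqnn N) Nn; lra.
have /cvg_ex[l /= ul] : cvg (u @ \oo) by apply/cauchy_cvgP.
exists l => e e0; have /cvgrPdist_le/(_ _ e0)[N _ HN] := ul.
by exists N => n Nn; rewrite distrC; exact: HN.
Qed.

Lemma complete_complex u : cauchyC u -> exists l, tends u l.
Proof.
move=> H.
have [|a Ha] := @complete_real (fun n => Re (u n)).
  move=> e e0; have [N HN] := H _ e0; exists N => m n mN nN.
  by rewrite (le_trans _ (HN _ _ mN nN))// (le_trans _ (normc_Re _))//; case: (u m) (u n) => [? ?] [? ?].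
have [|b Hb] := @complete_real (fun n => Im (u n)).
  move=> e e0; have [N HN] := H _ e0; exists N => m n mN nN.
  by rewrite (le_trans _ (HN _ _ mN nN))// (le_trans _ (normc_Im _))//; case: (u m) (u n) => [? ?] [? ?].
exists (a +i* b) => e e0; have e2 : 0 < e / 2 by lra.
have [N HN] := Ha _ e2; have [N' HN'] := Hb _ e2.
exists (maxn N N') => n; rewrite geq_max => /andP[n1 n2].
have := HN _ n1; have := HN' _ n2; have := normc_leReIm (u n - (a +i* b)).
by case: (u n) => x y /=; lra.
Qed.

Lemma tends_le u l a (M : R) : tends u l -> (forall n, normc (u n - a) <= M) -> normc (l - a) <= M.
Proof.
move=> H HM; rewrite leNgt; apply/negP => Ml.
have e0 : 0 < (normc (l - a) - M) / 2 by lra.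
have [N HN] := H _ e0; have := HN _ (leqnn N); have := HM N.
have := normcBD (u N) l a; rewrite (normcB l (u N)); lra.
Qed.

Lemma tends_le_near u l a (M : R) N : tends u l ->
  (forall n, (N <= n)%N -> normc (u n - a) <= M) -> normc (l - a) <= M.
Proof.
move=> H HM; apply: (@tends_le (fun n => u (n + N)%N)) => [e e0|n].
  have [N' HN] := H _ e0; exists N' => n n0; apply: HN.
  by rewrite (leq_trans n0)// leq_addr.
by apply: HM; rewrite leq_addl.
Qed.

Lemma tends_unique u l l' : tends u l -> tends u l' -> l = l'.
Proof.
move=> H H'; apply/eqP; rewrite -subr_eq0 -normc_eq0 eq_le normc_ge0 andbT.
apply/ler_addgt0Pl => e e0; rewrite addr0; have [N HN] := H' _ e0.
exact: tends_le_near H HN.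
Qed.

Lemma tendsM_cst u l c : tends u l -> tends (fun n => c * u n) (c * l).
Proof.
move=> H e e0; have k0 : 0 < 1 + normc c by rewrite (lt_le_trans ltr01)// lerDl normc_ge0.
have [N HN] := H _ (divr_gt0 e0 k0); exists N => n nN.
rewrite -mulrBr normcM (le_trans (ler_wpM2l (normc_ge0 _) (HN _ nN)))//.
rewrite mulrCA ler_piMr ?(ltW e0)// ler_pdivrMr// mul1r lerDr//.
Qed.

Lemma tendsB u v l l' : tends u l -> tends v l' -> tends (fun n => u n - v n) (l - l').
Proof.
move=> H H' e e0; have e2 : 0 < e / 2 by lra.
have [N HN] := H _ e2; have [N' HN'] := H' _ e2.
exists (maxn N N') => n; rewrite geq_max => /andP[n1 n2].
rewrite (_ : _ - _ = (u n - l) - (v n - l')); last by ring.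
have := HN _ n1; have := HN' _ n2; have := normcD (u n - l) (- (v n - l')).
rewrite normcN; lra.
Qed.

End Sequences.

Section DerivativeOfLimit.
Variable R : realType.
Local Notation C := R[i].

(* A uniform second-order bound on the members of the sequence makes the
   derivatives at [a] converge, without any convergence assumed on them. *)
Lemma derivative_of_limit (u : nat -> C -> C) (v : nat -> C) (U : C -> C) (a : C) (r K : R) :
  0 < r -> 0 < K ->
  (forall n w, normc (w - a) < r ->
     normc (u n w - u n a - v n * (w - a)) <= K * normc (w - a) ^+ 2) ->
  (forall w, normc (w - a) < r -> tends (fun n => u n w) (U w)) ->
  exists2 d, tends v d & hasD U a d.
Proof.
move=> r0 K0 H HU.
have aa : normc (a - a) < r by rewrite subrr normc0.
have [d Hd] : exists d, tends v d.
  apply: complete_complex => e e0.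
  (* Difference quotients are compared at the single test point [a + t]: the two second-order terms
     cost at most [e * t / 4] each, the four values of the sequence [e * t / 8] each. *)
  pose t := Num.min (r / 2) (e / (4 * K)).
  have t0 : 0 < t by rewrite lt_min !divr_gt0//= mulr_gt0.
  have tr : t < r by rewrite /t gt_min; apply/orP; left; lra.
  have te : 4 * K * t <= e.
    by rewrite mulrC -ler_pdivlMr ?mulr_gt0// ge_min lexx orbT.
  have nt : normc (a + t%:C - a) = t by rewrite addrAC subrr add0r normcR gtr0_norm.
  have ht : normc (a + t%:C - a) < r by rewrite nt.
  have e1 : 0 < e * t / 8 by rewrite divr_gt0 ?mulr_gt0.
  have [N HN] := HU _ aa _ e1; have [N' HN'] := HU _ ht _ e1.
  exists (maxn N N') => m n; rewrite !geq_max => /andP[m1 m2] /andP[n1 n2].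
  rewrite -(ler_pM2r t0).
  have -> : normc (v m - v n) * t = normc ((v m - v n) * t%:C) by rewrite normcM normcR gtr0_norm.
  have := H m _ ht; have := H n _ ht; rewrite nt.
  have -> : a + t%:C - a = t%:C by ring.
  have := HN _ m1; have := HN _ n1; have := HN' _ m2; have := HN' _ n2.
  move: (a + _) => b.
  set x1 := u n b - U b; set x2 := u m b - U b; set x3 := u n a - U a; set x4 := u m a - U a.
  set y1 := _ - _ - v n * _; set y2 := _ - _ - v m * _ => h1 h2 h3 h4 h5 h6.
  have -> : (v m - v n) * t%:C = x2 - x1 - (x4 - x3) + (y1 - y2).
    by rewrite /x1 /x2 /x3 /x4 /y1 /y2; ring.
  have g1 := normcD (x2 - x1 - (x4 - x3)) (y1 - y2).
  have g2 := normcD (x2 - x1) (- (x4 - x3)); have g3 := normcD x2 (- x1).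
  have g4 := normcD x4 (- x3); have g5 := normcD y1 (- y2).
  rewrite !normcN in g1 g2 g3 g4 g5.
  have : K * t ^+ 2 <= e * t / 4.
    rewrite expr2 mulrA ler_pdivlMr// mulrC mulrA mulrA ler_pM2r//.
  lra.
exists d => //.
have key w : normc (w - a) < r -> normc (U w - U a - d * (w - a)) <= K * normc (w - a) ^+ 2.
  move=> wr; rewrite -[_ - d * _]subr0.
  apply: (@tends_le _ (fun n => u n w - u n a - v n * (w - a))) => [|n]; last first.
    by rewrite subr0; exact: H.
  apply: tendsB; first by apply: tendsB; exact: HU.
  rewrite (mulrC d) (_ : (fun n => _) = fun n => (w - a) * v n); first exact: tendsM_cst.
  by apply/funext => n; rewrite mulrC.
move=> e e0; exists (Num.min r (e / K)); first by rewrite lt_min r0 divr_gt0.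
move=> h; rewrite lt_min => /andP[hr he].
have := key (a + h); rewrite addrAC subrr add0r => /(_ hr) /le_trans; apply.
rewrite expr2 mulrA ler_wpM2r ?normc_ge0// mulrC -ler_pdivlMr//; exact: ltW.
Qed.

(** Two mean value inequalities: the first bounds [v - v a] on the segment, the second is applied to
    [u y - v a * y]. The factor one half of Taylor's formula is given up. *)
Lemma taylor2 (u v v2 : C -> C) (c a w : C) (rho B : R) :
  (forall y, normc (y - c) <= rho -> hasD u y (v y)) ->
  (forall y, normc (y - c) <= rho -> hasD v y (v2 y)) ->
  (forall y, normc (y - c) <= rho -> normc (v2 y) <= B) ->
  normc (a - c) <= rho -> normc (w - c) <= rho ->
  normc (u w - u a - v a * (w - a)) <= B * normc (w - a) ^+ 2.
Proof.
move=> Hu Hv HB Ha Hw.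
have B0 : 0 <= B := le_trans (normc_ge0 _) (HB _ Ha).
have Hs (t : R) : 0 <= t <= 1 -> normc (a + t%:C * (w - a) - c) <= rho.
  by move=> t01; apply: disc_convex => //; rewrite (addrC a) subrK.
have Hv1 (t : R) : 0 <= t <= 1 -> normc (v (a + t%:C * (w - a)) - v a) <= B * normc (w - a).
  move=> t01.
  apply: (@le_trans _ _ (B * normc (t%:C * (w - a)))).
    apply: (@mean_value_segment _ _ v2) => s s01; [apply: Hv|apply: HB];
      rewrite mulrA -rmorphM /=; apply: Hs; rewrite mulr_ge0 ?mulr_ile1//;
      by case/andP: s01 => // ? ?; case/andP: t01.
  rewrite normcM normcR ger0_norm; last by case/andP: t01.
  by rewrite ler_wpM2l// ler_piMl ?normc_ge0//; case/andP: t01.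
have := @mean_value_segment R (fun y => u y - v a * y) (fun y => v y - v a) a (w - a) (B * normc (w - a)).
rewrite (addrC a) subrK expr2 mulrA => H.
rewrite (_ : _ - _ = u w - v a * w - (u a - v a * a)); last by ring.
apply: H => t t01; last exact: Hv1.
apply: hasDB; first by apply: Hu; exact: Hs.
rewrite -[X in hasD _ _ X]mulr1; apply: hasDZ.
by apply/hasDP; exact: is_derive_id.
Qed.

End DerivativeOfLimit.

(** * Smoothness and Cauchy's estimates for continuously differentiable functions *)

Section Smooth.
Variable R : realType.
Local Notation C := R[i].
Variables (f df : C -> C) (c : C) (rho : R).
Hypothesis rho0 : 0 < rho.
Hypothesis fD : forall w, normc (w - c) <= rho -> hasD f w (df w).
Hypothesis dfC : forall w, normc (w - c) <= rho -> forall e : R, 0 < e ->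
  exists2 r : R, 0 < r & forall y, normc (y - c) <= rho -> normc (y - w) < r ->
    normc (df y - df w) < e.

Let S n l z := cauchy_sum f c rho n l z.

Lemma holo_bounded : exists2 M : R, 0 < M & forall w, normc (w - c) <= rho -> normc (f w) <= M.
Proof.
have [|r r0 Hr] := @compact_uniform R [set w | normc (w - c) <= rho]
   (fun r w => normc (f w) <= r^-1) (@compact_disc R c rho).
  move=> x Dx; have [d d0 Hd] := hasD_continuous (fD Dx) ltr01.
  have n0 : 0 < normc (f x) + 1 by rewrite (lt_le_trans ltr01)// lerDr normc_ge0.
  exists (Num.min d (normc (f x) + 1)^-1); first by rewrite lt_min d0 invr_gt0.
  move=> w e; rewrite lt_min => /andP[w1 _] /andP[e0]; rewrite lt_min => /andP[_ e1] _.
  rewrite (@le_trans _ _ (normc (f x) + 1))//; last first.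
    by rewrite -[leLHS]invrK lef_pV2 ?posrE ?invr_gt0// ltW.
  rewrite -[f w in leLHS](subrK (f x)) (le_trans (normcD _ _))// addrC lerD2l ltW// Hd//.
by exists r^-1; rewrite ?invr_gt0.
Qed.

Lemma cauchy_sum_tends z : normc (z - c) <= rho / 2 -> tends (fun n => S n 0 z) (f z).
Proof.
move=> zc e e0.
have e2 : 0 < e / 2 by lra.
have [n1 H1] := cauchy_sum_approx rho0 fD dfC e2.
pose x := (z - c) / rho%:C.
have nx : normc x <= 2^-1.
  by rewrite normcM normcV normcR gtr0_norm// ler_pdivrMr// mulrC.
(* The error is [f z * x ^+ n / (1 - x ^+ n)], where [x ^+ n] is at most [n^-1] and the denominator
   at least one half in norm; [n] beyond this threshold makes it at most [e / 2]. *)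
have k0 : 0 < 4 * (1 + normc (f z)) / e.
  by rewrite divr_gt0// mulr_gt0// (lt_le_trans ltr01)// lerDl normc_ge0.
exists (maxn n1 (Num.truncn (4 * (1 + normc (f z)) / e)).+1) => n.
rewrite geq_max => /andP[/H1 /(_ _ zc) Hn n2].
have xn : normc (x ^+ n) <= n%:R^-1 /\ normc (x ^+ n) <= 2^-1.
  have n0 : (0 < n)%N by apply: leq_trans n2.
  have g0 : normc (x ^+ n) <= 2^-1 ^+ n by rewrite normcX lerXn2r ?nnegrE ?normc_ge0.
  split; apply: (le_trans g0).
    by rewrite exprVn lef_pV2 ?posrE ?exprn_gt0 ?ltr0n// -natrX ler_nat ltnW// ltn_expl.
  by case: n n0 {n2 Hn g0} => // n _; rewrite exprS ler_piMr// exprn_ile1// invf_le1// (ler_nat _ 1 2).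
case: xn => xn1 xn2.
have g1 : 2^-1 <= normc (1 - x ^+ n).
  have := normc_leB 1 (x ^+ n); rewrite normc1; lra.
have d0 : 1 - x ^+ n != 0 by rewrite -normc_gt0; lra.
have e1 : normc (f z / (1 - x ^+ n) - f z) <= e / 2.
  have -> : f z / (1 - x ^+ n) - f z = f z * x ^+ n / (1 - x ^+ n) by field.
  rewrite normcM normcV ler_pdivrMr; last by rewrite (lt_le_trans _ g1).
  apply: (@le_trans _ _ (e / 4)); last first.
    rewrite (_ : e / 4 = e / 2 * 2^-1); last by field.
    by rewrite ler_pM2l.
  rewrite normcM.
  have : n%:R^-1 * (4 * (1 + normc (f z))) <= e.
    have n0 : 0 < n%:R :> R by rewrite ltr0n (leq_trans _ n2).
    rewrite ler_pdivrMl// -ler_pdivrMr// ltW// (lt_le_trans (truncnS_gt _))// ler_nat//.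
  have : normc (f z) * normc (x ^+ n) <= (1 + normc (f z)) * n%:R^-1.
    by apply: ler_pM; rewrite ?normc_ge0// lerDr.
  lra.
have := normcBD (f z / (1 - x ^+ n)) (S n 0 z) (f z).
rewrite -/(S n 0 z) in Hn; lra.
Qed.

(** Candidate for the derivative of order [l]: the limit of the Cauchy sums of that order, with a
    default value until the limit is known to exist. *)
Let F l z : C := if l is 0 then f z else xget 0 [set d | tends (fun n => S n l z) d].

(** Induction on the order. If the sums of order [k] converge, their second derivatives, the sums of
    order [k + 2], are bounded uniformly in [n]; [derivative_of_limit] then gives convergence at
    order [k + 1] and identifies the limit as a derivative. *)
Lemma holo_smooth_aux l z : normc (z - c) < rho / 2 ->
  tends (fun n => S n l z) (F l z) /\ hasD (F l) z (F l.+1 z).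
Proof.
have [M M0 HM] := holo_bounded.
have r20 : 0 < rho / 2 by rewrite divr_gt0.
have step k : (forall w, normc (w - c) < rho / 2 -> tends (fun n => S n k w) (F k w)) ->
    forall w, normc (w - c) < rho / 2 ->
    tends (fun n => S n k.+1 w) (F k.+1 w) /\ hasD (F k) w (F k.+1 w).
  move=> IH w wc.
  pose B := M * rho * (k.+2`!)%:R * (2 / rho) ^+ k.+3.
  have B0 : 0 < B + 1.
    have := ltW M0; have := ltW rho0 => g1 g2.
    rewrite ltr_wpDl// /B; apply: mulr_ge0; last by rewrite exprn_ge0// divr_ge0.
    by apply: mulr_ge0 => //; apply: mulr_ge0.
  have rr : 0 < rho / 2 - normc (w - c) by rewrite subr_gt0.
  have near y : normc (y - w) < rho / 2 - normc (w - c) -> normc (y - c) < rho / 2.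
    by move=> yw; have := normcBD w y c; lra.
  have [|y yw|d Hd HF] := @derivative_of_limit R (fun n => S n k) (fun n => S n k.+1 w) (F k) w
     (rho / 2 - normc (w - c)) (B + 1) rr B0.
  - move=> n y yw.
    apply: (@taylor2 _ _ (S n k.+1) (S n k.+2) c w y (rho / 2)); rewrite ?(ltW wc) ?(ltW (near _ yw))//.
    + by move=> x xc; exact: hasD_cauchy_sum.
    + by move=> x xc; exact: hasD_cauchy_sum.
    + move=> x xc; rewrite (@le_trans _ _ B)// ?lerDl//.
      exact: cauchy_sum_le.
  - by apply: IH; exact: near.
  suff <- : d = F k.+1 w by [].
  apply: (tends_unique Hd); rewrite /F.
  exact: (@xgetPex _ 0 [set d | tends (fun n => S n k.+1 w) d] (ex_intro _ d Hd)).
have all_tends k : forall w, normc (w - c) < rho / 2 -> tends (fun n => S n k w) (F k w).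
  elim: k => [|k IH] w wc; first exact/cauchy_sum_tends/ltW.
  exact: (step _ IH w wc).1.
move=> zc; split; first exact: all_tends.
exact: (step _ (all_tends l) z zc).2.
Qed.

Lemma holo_derive1nE l z : normc (z - c) < rho / 2 -> derive1n l f z = F l z.
Proof.
elim: l z => [//|l IH] z zc; rewrite derive1nS.
have [_ /hasD_derive1 <-] := holo_smooth_aux l zc.
apply: (@derive1_near _ _ _ _ (rho / 2 - normc (z - c))) => [|w wz].
  by rewrite subr_gt0.
by apply: IH; have := normcBD z w c; lra.
Qed.

Lemma holo_hasD l z : normc (z - c) < rho / 2 ->
  hasD (derive1n l f) z (derive1n l.+1 f z).
Proof.
move=> zc; rewrite holo_derive1nE//; have [_ H] := holo_smooth_aux l zc.
apply: hasD_near H; first by rewrite -(subr_gt0 (normc (z - c))) in zc; exact: zc.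
by move=> w wz; rewrite holo_derive1nE//; have := normcBD z w c; lra.
Qed.

Lemma cauchy_estimate l z M : normc (z - c) < rho / 2 ->
  (forall w, normc (w - c) <= rho -> normc (f w) <= M) ->
  normc (derive1n l f z) <= M * rho * (l`!)%:R * (2 / rho) ^+ l.+1.
Proof.
move=> zc HM; rewrite holo_derive1nE// -[F l z]subr0.
have [H _] := holo_smooth_aux l zc.
apply: (tends_le H) => n; rewrite subr0; apply: cauchy_sum_le => //; exact: ltW.
Qed.

End Smooth.

(** * Topology of the function spaces *)

Section ExtendedDerivatives.
Variables (R : realType) (Omega : set R[i]).
Hypothesis oOmega : open Omega.
Local Notation C := R[i].
Local Notation E := (closure Omega).
Local Notation ext := (ext_deriv Omega).
Local Notation der l f z := (derive1n l f z : C).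
Local Notation der1 f z := (derive1 f z : C).
Local Notation rational := (@rational_Ainf R Omega).
Implicit Types (f g : Ainf Omega) (z w : C).

Lemma open_disc z : Omega z -> exists2 r : R, 0 < r & forall w, normc (w - z) <= r -> Omega w.
Proof.
move=> /(open_normcP _).1 - /(_ oOmega) [r r0 H].
by exists (r / 2) => [|w wr]; [norm_lra|apply: H; norm_lra].
Qed.

Lemma ext_unique (F : C -> C) l z a : E z ->
  (forall e : R, 0 < e -> exists2 r : R, 0 < r & forall w, Omega w -> normc (w - z) < r ->
     normc (der l F w - a) < e) -> ext F l z = a.
Proof.
move=> Ez H; have PF := within_nbhs_proper Ez.
apply/cvg_lim; first exact: norm_hausdorff.
apply/cvg_normcP => e e0; apply/within_normcP; have [r r0 Hr] := H e e0.
by exists r => // w wr Ow; exact: Hr.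
Qed.

#[local] Opaque derive1 derive1n ext_deriv.

Lemma Ainf_ext_lim f l z : E z ->
  forall e : R, 0 < e -> exists2 r : R, 0 < r & forall w, Omega w -> normc (w - z) < r ->
     normc (der l f w - ext f l z) < e.
Proof.
move=> Ez; have [g gc gE] := Ainf_ext f l.
have H (e : R) : 0 < e -> exists2 r : R, 0 < r & forall w, Omega w -> normc (w - z) < r ->
     normc (der l f w - g z) < e.
  move=> e0.
  have /(_ _ Ez) gz := (subspace_continuousP E g).1 gc.
  have gz' := (cvg_normcP (within_filter _ (nbhs_filter _)) _ _).1 gz e e0.
  have [r r0 Hr] := (within_normcP _ _ _).1 gz'; exists r => // w Ow wz.
  by rewrite -gE//; apply: (Hr w wz); exact: subset_closure.
have -> := ext_unique Ez H.
exact: H.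
Qed.

Lemma Ainf_ext_continuous f l z : E z ->
  forall e : R, 0 < e -> exists2 r : R, 0 < r & forall w, E w -> normc (w - z) < r ->
     normc (ext f l w - ext f l z) <= e.
Proof.
move=> Ez e e0; have e2 : 0 < e / 2 by norm_lra.
have [r r0 Hr] := Ainf_ext_lim f l Ez e2; exists r => // w Ew wz.
have [r' r'0 Hr'] := Ainf_ext_lim f l Ew e2.
have m0 : 0 < Num.min r' (r - normc (w - z)) by rewrite lt_min r'0 subr_gt0.
have [y Oy] := (closure_normcP _ _).1 Ew _ m0; rewrite lt_min => /andP[y1 y2].
have := Hr' _ Oy y1; have yz : normc (y - z) < r by have := normcBD w y z; norm_lra.
have := Hr _ Oy yz; have := normcBD (der l f y) (ext f l w) (ext f l z).
have := normcB (ext f l w) (der l f y); norm_lra.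
Qed.

Lemma Ainf_derive1_continuous f z : Omega z ->
  forall e : R, 0 < e -> exists2 r : R, 0 < r & forall w, Omega w -> normc (w - z) < r ->
     normc (der1 f w - der1 f z) < e.
Proof.
move=> Oz e e0; have Ez : E z by exact: subset_closure.
have e2 : 0 < e / 2 by norm_lra.
have [r r0 Hr] := Ainf_ext_lim f 1 Ez e2; exists r => // w Ow wz.
have := Hr _ Ow wz; have := Hr z Oz; rewrite subrr normc0 => /(_ r0).
rewrite !derive1n1 => h1 h2.
have := normcBD (ext f 1 z) (der1 f w) (der1 f z).
have := normcB (ext f 1 z) (der1 f z); norm_lra.
Qed.

(** The continuity of the first derivative asked for by [holo_hasD] is provided by the continuous
    extension of order 1. *)
Lemma Ainf_hasD f l z : Omega z -> hasD (derive1n l f) z (derive1n l.+1 f z).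
Proof.
move=> Oz; have [r r0 Hr] := open_disc Oz.
apply: (@holo_hasD _ f (derive1 f) z r) => //.
- by move=> w /Hr Ow; apply: derivable_hasD; exact: Ainf_holo.
- move=> w /Hr Ow e e0; have [d d0 Hd] := Ainf_derive1_continuous f Ow e0.
  by exists d => // y /Hr Oy; exact: Hd.
- by rewrite subrr normc0 divr_gt0.
Qed.

Lemma Ainf_ext_Omega f l z : Omega z -> ext f l z = derive1n l f z.
Proof.
move=> Oz; apply: ext_unique; first exact: subset_closure.
move=> e e0; have [r r0 Hr] := hasD_continuous (Ainf_hasD f l Oz) e0.
by exists r => // w _; exact: Hr.
Qed.

Lemma derive1nB f g l z : Omega z ->
  derive1n l (fun z => g z - f z) z = der l g z - der l f z.
Proof.
elim: l z => [|l IH] z Oz; rewrite ?derive1n0// derive1nS.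
have [r r0 Hr] := open_disc Oz.
rewrite (@derive1_near _ _ (fun w => der l g w - der l f w) z r)//.
  by apply: hasD_derive1; apply: hasDB; exact: Ainf_hasD.
by move=> w wr; apply: IH; apply: Hr; exact: ltW.
Qed.

(** The seminorms are evaluated at [g z - f z], a bare function and not an element of [Ainf]. *)
Lemma extB f g l z : E z -> ext (fun z => g z - f z) l z = ext g l z - ext f l z.
Proof.
move=> Ez; apply: ext_unique => // e e0; have e2 : 0 < e / 2 by norm_lra.
have [r r0 Hr] := Ainf_ext_lim f l Ez e2; have [d d0 Hd] := Ainf_ext_lim g l Ez e2.
exists (Num.min r d); first by rewrite lt_min r0.
move=> w Ow; rewrite lt_min => /andP[wr wd].
rewrite derive1nB// (_ : _ - _ = (der l g w - ext g l z) - (der l f w - ext f l z)); last by ring.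
have := normcB_le (der l g w - ext g l z) (der l f w - ext f l z).
have := Hr _ Ow wr; have := Hd _ Ow wd; norm_lra.
Qed.

(** Weak pointwise inequalities in place of strict ones between extended suprema; they pass to
    limits, and halving [e] leads from one form to the other in [Ainf_open_near]. *)
Definition near_upto (N : nat) (e : R) (f g : C -> C) := forall l z, (l <= N)%N -> E z ->
  normc z <= N%:R -> normc (ext g l z - ext f l z) <= e.

Lemma near_uptoW N N' e e' (f g : C -> C) : (N' <= N)%N -> e <= e' ->
  near_upto N e f g -> near_upto N' e' f g.
Proof.
move=> NN ee H l z lN Ez zN; apply: le_trans ee; apply: H => //; first exact: leq_trans NN.
by rewrite (le_trans zN)// ler_nat.
Qed.

Lemma near_upto_trans N e e' (f g h : C -> C) :
  near_upto N e f g -> near_upto N e' g h -> near_upto N (e + e') f h.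
Proof.
move=> H H' l z lN Ez zN; rewrite (le_trans (normcBD (ext g l z) _ _))// addrC lerD//.
- exact: H.
- exact: H'.
Qed.

Lemma near_upto_sym N e (f g : C -> C) : near_upto N e f g -> near_upto N e g f.
Proof. by move=> H l z lN Ez zN; rewrite normcB; exact: H. Qed.

Lemma near_upto_refl N e (f : C -> C) : 0 <= e -> near_upto N e f f.
Proof. by move=> e0 l z _ _ _; rewrite subrr normc0. Qed.

Lemma sup_on_le (K : set C) (u : C -> R) (e : R) : 0 <= e ->
  (forall z, K z -> u z <= e) -> (sup_on K (fun z => (u z)%:E) <= e%:E)%E.
Proof.
move=> e0 H; apply: ge_ereal_sup => _ [->|[z Kz <-]]; first by rewrite lee_fin.
by rewrite lee_fin H.
Qed.

Lemma le_sup_on (K : set C) (u : C -> R) (e : R) :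
  (sup_on K (fun z => (u z)%:E) < e%:E)%E -> forall z, K z -> u z < e.
Proof.
move=> H z Kz; rewrite -lte_fin; apply: le_lt_trans H; apply: ereal_sup_ubound.
by right; exists z.
Qed.

Lemma near_upto_seminorm N (e e' : R) f g : 0 <= e -> e < e' -> near_upto N e f g ->
  forall l n, (l <= N)%N -> (n <= N)%N -> (seminorm Omega l n (fun z => g z - f z)%R < e'%:E)%E.
Proof.
move=> e0 ee H l n lN nN; apply: (@le_lt_trans _ _ e%:E); last by rewrite lte_fin.
apply: sup_on_le => // z [Ez zn]; rewrite extB//; apply: H => //.
by rewrite (le_trans zn)// ler_nat.
Qed.

Lemma seminorm_near_upto N e f g :
  (forall l n, (l <= N)%N -> (n <= N)%N -> (seminorm Omega l n (fun z => g z - f z)%R < e%:E)%E) ->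
  near_upto N e f g.
Proof.
move=> H l z lN Ez zN; rewrite -extB//.
exact/ltW/(le_sup_on (H l N lN (leqnn N))).
Qed.

Lemma Ainf_open_near (U : set (Ainf Omega)) : Ainf_open U <->
  forall f, U f -> exists N (e : R), 0 < e /\ forall g : Ainf Omega, near_upto N e f g -> U g.
Proof.
split=> H f /H [N [e [e0 He]]]; exists N.
  exists (e / 2); split=> [|g fg]; first norm_lra.
  by apply: He; apply: near_upto_seminorm fg; norm_lra.
by exists e; split=> // g fg; apply: He; exact: seminorm_near_upto.
Qed.

(** The intermediate [e'] leaves the slack [e - e'] on which openness rests. *)
Lemma ball_open f N e : open [set g : Ainf Omega | exists2 e', e' < e & near_upto N e' f g].
Proof.
apply/Ainf_open_near => g [e' ee fg]; exists N, ((e - e') / 2); split; first norm_lra.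
move=> h gh; exists (e' + (e - e') / 2); first norm_lra.
exact: near_upto_trans fg gh.
Qed.

Lemma closure_rationalP f : closure rational f <->
  forall N (e : R), 0 < e -> exists2 r : Ainf Omega, rational r & near_upto N e f r.
Proof.
split=> [H N e e0|H U].
  have [r [rr [e' /ltW ee fr]]] : rational `&` [set g : Ainf Omega | exists2 e', e' < e & near_upto N e' f g] !=set0.
    apply: H; apply: open_nbhs_nbhs; split; first exact: ball_open.
    by exists 0 => //; exact: near_upto_refl.
  by exists r => //; exact: near_uptoW fr.
rewrite nbhsE => -[V [oV Vf] VU].
have [N [e [e0 He]]] := (Ainf_open_near V).1 oV _ Vf.
have [r rr fr] := H N e e0; exists r; split => //; exact/VU/He.
Qed.

Lemma open_XinfP (S : set (Xinf Omega)) : open S <->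
  forall f : Xinf Omega, S f -> exists N (e : R), 0 < e /\ forall g : Xinf Omega, near_upto N e (Xinf_fun f) (Xinf_fun g) -> S g.
Proof.
split.
  move=> [V oV <-] f Vf; have [N [e [e0 He]]] := (Ainf_open_near V).1 oV _ Vf.
  by exists N, e; split => // g fg; exact: He.
(* An open set of the ambient space with trace [S]: the image of [S] is enlarged by the complement
   of the closed subspace, so that neighbours outside the subspace cause no trouble. *)
move=> H; exists ((val @` S) `|` ~` (closure rational)).
  apply/Ainf_open_near => g [[f Sf <-]|ng].
    have [N [e [e0 He]]] := H f Sf; exists N, e; split => // h fh.
    have [ch|] := pselect (closure rational h); last by right.
    left; exists (SigSub (mem_set ch)) => //; exact: He.
  have oc : open (~` closure rational) by apply: closed_openC; exact: closed_closure.
  have [N [e [e0 He]]] := (Ainf_open_near _).1 oc _ ng.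
  by exists N, e; split => // h /He; right.
apply/seteqP; split=> f /=; last by left; exists f.
move=> [[f' Sf' /val_inj <-//]|nc]; exfalso; apply: nc.
exact: (set_mem (valP f)).
Qed.

End ExtendedDerivatives.

(** * Completeness and Baire's theorem *)

Section Completeness.
Variables (R : realType) (Omega : set R[i]).
Hypothesis oOmega : open Omega.
Local Notation C := R[i].
Local Notation E := (closure Omega).
Local Notation ext := (ext_deriv Omega).
Local Notation der l f z := (derive1n l f z : C).
Local Notation near_upto := (near_upto Omega).
Local Notation rational := (@rational_Ainf R Omega).
Local Notation fn f := (Xinf_fun f).

#[local] Opaque derive1 derive1n ext_deriv.

Lemma le_natnorm (z : C) : normc z <= (Num.truncn (normc z)).+1%:R.
Proof. exact/ltW/truncnS_gt. Qed.

Lemma half_expn_small (e : R) : 0 < e -> exists k, forall n, (k <= n)%N -> 2^-1 ^+ n <= e.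
Proof.
move=> e0; exists (Num.truncn e^-1).+1 => n kn.
rewrite exprVn -[e]invrK lef_pV2 ?posrE ?exprn_gt0 ?invr_gt0// ltW//.
apply: (lt_le_trans (truncnS_gt _)); rewrite -natrX ler_nat.
by rewrite (leq_trans kn)// ltnW// ltn_expl.
Qed.

Section Limit.
Variable f : nat -> Xinf Omega.
Hypothesis f_cauchy : forall k j, (k <= j)%N -> near_upto k (2^-1 ^+ k) (fn (f k)) (fn (f j)).

(** From this index on, the neighbourhoods in [f_cauchy] see the derivative of order [l] at [z]. *)
Let bnd l (z : C) := maxn l (Num.truncn (normc z)).+1.

Lemma limit_near l z k j : E z -> (bnd l z <= k)%N -> (k <= j)%N ->
  normc (ext (fn (f j)) l z - ext (fn (f k)) l z) <= 2^-1 ^+ k.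
Proof.
move=> Ez; rewrite geq_max => /andP[lk zk] kj; apply: (f_cauchy kj) => //.
by rewrite (le_trans (le_natnorm z))// ler_nat.
Qed.

Lemma limit_exists l z : E z -> exists a, tends (fun k => ext (fn (f k)) l z) a.
Proof.
move=> Ez; apply: complete_complex => e e0.
have e2 : 0 < e / 2 by lra.
have [k Hk] := half_expn_small e2.
pose N := maxn k (bnd l z).
have Nk : 2^-1 ^+ N <= e / 2 by apply: Hk; exact: leq_maxl.
exists N => m n Nm Nn.
have := limit_near Ez (leq_maxr k (bnd l z)) Nm.
have := limit_near Ez (leq_maxr k (bnd l z)) Nn.
have := normcBD (ext (fn (f N)) l z) (ext (fn (f m)) l z) (ext (fn (f n)) l z).
have := normcB (ext (fn (f N)) l z) (ext (fn (f n)) l z).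
rewrite -/N; norm_lra.
Qed.

Let g l z : C := xget 0 [set a | tends (fun k => ext (fn (f k)) l z) a].

Let g_tends l z : E z -> tends (fun k => ext (fn (f k)) l z) (g l z).
Proof.
move=> Ez; have [a Ha] := limit_exists l Ez.
exact: (@xgetPex _ 0 [set a | tends (fun k => ext (fn (f k)) l z) a] (ex_intro _ a Ha)).
Qed.

Let g_near l z k : E z -> (bnd l z <= k)%N -> normc (g l z - ext (fn (f k)) l z) <= 2^-1 ^+ k.
Proof.
move=> Ez bk; apply: (tends_le_near (N := k) (g_tends l Ez)) => n; exact: limit_near.
Qed.

Let g_continuous l z : E z -> forall e : R, 0 < e -> exists2 r : R, 0 < r &
  forall w, E w -> normc (w - z) < r -> normc (g l w - g l z) < e.
Proof.
move=> Ez e e0; have e4 : 0 < e / 4 by lra.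
have [k Hk] := half_expn_small e4.
pose N := maxn k (maxn l (Num.truncn (normc z + 1)).+1).
have Nk : 2^-1 ^+ N <= e / 4 by apply: Hk; exact: leq_maxl.
have [r r0 Hr] := Ainf_ext_continuous (val (f N)) l Ez e4.
exists (Num.min r 1); first by rewrite lt_min r0 ltr01.
move=> w Ew; rewrite lt_min => /andP[wr w1].
have bN (x : C) : normc (x - z) <= 1 -> (bnd l x <= N)%N.
  move=> xz; rewrite /N /bnd geq_max !leq_max leqnn /= orbT /= ltnS; apply/orP; right; apply/orP; right.
  apply: le_truncn; rewrite -[x in leLHS](subrK z) (le_trans (normcD _ _))//.
  by rewrite addrC lerD2l.
have := g_near Ew (bN w (ltW w1)).
have := g_near Ez (bN z _); rewrite subrr normc0 => /(_ ler01).
have := Hr w Ew wr; rewrite -/(fn (f N)).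
have := normcBD (ext (fn (f N)) l w) (g l w) (g l z).
have := normcBD (ext (fn (f N)) l z) (ext (fn (f N)) l w) (g l z).
have := normcB (ext (fn (f N)) l z) (g l z).
norm_lra.
Qed.

Let g_hasD l z : Omega z -> hasD (g l) z (g l.+1 z).
Proof.
move=> Oz; have [d d0 Hd] := open_disc oOmega Oz.
pose N := maxn l.+2 (Num.truncn (normc z + 1)).+1.
have [d' d'0 Hd'] := hasD_continuous (Ainf_hasD oOmega (val (f N)) l.+2 Oz) ltr01.
pose r := Num.min d (Num.min (d' / 2) 1).
have r0 : 0 < r by rewrite !lt_min d0 ltr01 divr_gt0.
have rd w : normc (w - z) <= r -> [/\ Omega w, normc (w - z) < d' & normc (w - z) <= 1].
  rewrite !le_min => /and3P[w1 w2 w3]; split=> //; first exact: Hd.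
  by rewrite (le_lt_trans w2)// ltr_pdivrMr// ltr_pMr// (ltr_nat _ 1 2).
(* One unit pays for the variation of this derivative of [f N] near [z], the other for the distance
   [2^-1 ^+ N] from [f N] to later terms. The bound is thus uniform in [n], as [derivative_of_limit]
   requires. *)
pose B := normc (der l.+2 (fn (f N)) z) + 2.
have B0 : 0 < B by rewrite ltr_wpDl// normc_ge0.
have bN l' w : (l' <= l.+2)%N -> normc (w - z) <= 1 -> (bnd l' w <= N)%N.
  move=> ll xz; rewrite /N /bnd geq_max !leq_max ll /=; apply/orP; right; rewrite ltnS.
  apply: le_truncn; rewrite -[w in leLHS](subrK z) (le_trans (normcD _ _))//.
  by rewrite addrC lerD2l.
have HB n w : normc (w - z) <= r -> normc (der l.+2 (fn (f (n + N)%N)) w) <= B.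
  move=> /rd[Ow wd' w1].
  have h1 : normc (der l.+2 (fn (f (n + N)%N)) w - der l.+2 (fn (f N)) w) <= 2^-1 ^+ N.
    have := @limit_near l.+2 w N (n + N)%N (subset_closure Ow) (bN _ _ (leqnn _) w1) (leq_addl _ _).
    by rewrite !Ainf_ext_Omega.
  have h2 : normc (der l.+2 (fn (f N)) w - der l.+2 (fn (f N)) z) < 1 := Hd' w wd'.
  have h3 : 2^-1 ^+ N <= 1 :> R by rewrite exprn_ile1// invf_le1// (ler_nat _ 1 2).
  have h4 := normc_le_add (der l.+2 (fn (f N)) w) (der l.+2 (fn (f (n + N)%N)) w).
  have h5 := normc_le_add (der l.+2 (fn (f N)) z) (der l.+2 (fn (f N)) w).
  rewrite /B; norm_lra.
have Tz w : Omega w -> tends (fun n => der l (fn (f (n + N)%N)) w) (g l w).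
  move=> Ow e e0; have [M HM] := g_tends l (subset_closure Ow) e0.
  exists M => n nM; rewrite -Ainf_ext_Omega//; apply: HM; exact: leq_trans (leq_addr _ _).
have [||d1 Hd1 HD] := @derivative_of_limit R (fun n w => der l (fn (f (n + N)%N)) w)
   (fun n => der l.+1 (fn (f (n + N)%N)) z) (g l) z r B r0 B0.
- move=> n w wr.
  apply: (@taylor2 _ _ (derive1n l.+1 (fn (f (n + N)%N))) (derive1n l.+2 (fn (f (n + N)%N))) z z w r).
  + by move=> y /rd[Oy _ _]; exact: Ainf_hasD.
  + by move=> y /rd[Oy _ _]; exact: Ainf_hasD.
  + by move=> y; exact: HB.
  + by rewrite subrr normc0 ltW.
  + exact: ltW.
- by move=> w /ltW/rd[Ow _ _]; exact: Tz.
suff <- : d1 = g l.+1 z by [].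
apply: (tends_unique Hd1) => e e0.
have [M HM] := g_tends l.+1 (subset_closure Oz) e0.
exists M => n nM; rewrite -Ainf_ext_Omega//; apply: HM; exact: leq_trans (leq_addr _ _).
Qed.

Let G z : C := if `[< Omega z >] then g 0 z else 0.

Let G_derive1n l z : Omega z -> derive1n l G z = g l z.
Proof.
elim: l z => [|l IH] z Oz; first by rewrite derive1n0 /G asboolT.
rewrite derive1nS; have [r r0 Hr] := open_disc oOmega Oz.
rewrite -(hasD_derive1 (g_hasD l Oz)); apply: (derive1_near r0) => w wr.
by apply: IH; apply: Hr; exact: ltW.
Qed.

Let G_holo z : Omega z -> derivable G z 1.
Proof.
move=> Oz; apply: hasD_derivable (g 1 z) _; have [r r0 Hr] := open_disc oOmega Oz.
apply: (hasD_near r0) (g_hasD 0 Oz) => w /ltW/Hr Ow.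
by rewrite /G asboolT.
Qed.

Let G_ext l : exists2 h : C -> C, {within E, continuous h} & forall z, Omega z -> h z = derive1n l G z.
Proof.
exists (g l); last by move=> z Oz; rewrite G_derive1n.
apply/subspace_continuousP => z Ez; apply/cvg_normcP => e e0; apply/within_normcP.
by have [r r0 Hr] := g_continuous l Ez e0; exists r => // w wr Ew; exact: Hr.
Qed.

Let G_out z : ~ Omega z -> G z = 0.
Proof. by move=> nO; rewrite /G asboolF. Qed.

Let GA : Ainf Omega := MkAinf G_holo G_ext G_out.

Let ext_GA l z : E z -> ext GA l z = g l z.
Proof.
move=> Ez; apply: ext_unique => // e e0; have [r r0 Hr] := g_continuous l Ez e0.
exists r => // w Ow wr.
have -> : der l (Ainf_fun GA) w = g l w := G_derive1n l Ow.
exact: (Hr w (subset_closure Ow) wr).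
Qed.

Lemma Xinf_limit : exists h : Xinf Omega, forall l z, E z ->
  tends (fun k => ext (fn (f k)) l z) (ext (fn h) l z).
Proof.
have GX : GA \in closure rational.
  apply/mem_set/(closure_rationalP oOmega) => N e e0; have e2 : 0 < e / 2 by lra.
  have [k Hk] := half_expn_small e2.
  pose M := maxn k N.+1.
  have Mk : 2^-1 ^+ M <= e / 2 by apply: Hk; exact: leq_maxl.
  have [r rr Hr] := (closure_rationalP oOmega _).1 (set_mem (valP (f M))) N _ e2.
  exists r => //; rewrite (splitr e); apply: near_upto_trans Hr.
  apply: near_upto_sym => l z lN Ez zN; rewrite ext_GA//.
  apply: le_trans Mk; apply: g_near => //.
  rewrite /M /bnd geq_max !leq_max (leqW lN) orbT /= !ltnS; apply/orP; right.
  by rewrite -(@natrK R N) le_truncn.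
exists (SigSub GX) => l z Ez.
rewrite /Xinf_fun /= ext_GA//; exact: g_tends.
Qed.

End Limit.

(** Nested neighbourhoods with radii at most [2^-1 ^+ n] and orders at least [n]: the centres
    converge by [Xinf_limit], and the limit stays in every neighbourhood because [near_upto] is
    given by weak inequalities. *)
Lemma Xinf_Baire (G : nat -> set (Xinf Omega)) :
  (forall k, open (G k) /\ dense (G k)) -> dense (\bigcap_k G k).
Proof.
move=> HG O [f0 Of0] oO.
(* A state consists of a step number, a centre, an order and a radius. The relation is guarded by
   [0 < e] so that it is total, as dependent choice demands. *)
pose T := (nat * Xinf Omega * nat * R)%type.
pose step (x y : T) := let: (k, f, N, e) := x in let: (k', f', N', e') := y in
  0 < e -> [/\ k' = k.+1, (N < N')%N, 0 < e', e' <= e / 2 &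
    forall g : Xinf Omega, near_upto N' e' (fn f') (fn g) -> G k g /\ near_upto N e (fn f) (fn g)].
have total x : {y : T | step x y}.
  apply: cid; case: x => [[[k f] N] e].
  have [e0|ne] := ltP 0 e; last by exists (0%N, f, 0%N, 0) => /=; rewrite ltNge ne.
  have [oG dG] := HG k.
  pose U := [set g : Xinf Omega | exists2 e', e' < e & near_upto N e' (fn f) (fn g)].
  have oU : open U.
    apply/(open_XinfP oOmega) => g [e' ee fg]; exists N, ((e - e') / 2); split; first by lra.
    by move=> h gh; exists (e' + (e - e') / 2); [lra|exact: near_upto_trans fg gh].
  have [f' [[e' ee ff'] Gf']] : U `&` G k !=set0.
    by apply: dG => //; exists f; exists 0 => //; exact: near_upto_refl.
  have [N1 [e1 [e10 He1]]] := (open_XinfP oOmega (G k)).1 oG _ Gf'.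
  (* The three bounds keep the new neighbourhood inside [G k], inside the previous neighbourhood,
     and of at most half its radius. *)
  pose e2 := Num.min e1 (Num.min ((e - e') / 2) (e / 2)).
  have e20 : 0 < e2 by rewrite !lt_min e10 !divr_gt0// subr_gt0.
  exists (k.+1, f', maxn N1 N.+1, e2) => _ /=; split=> //.
  - by rewrite leq_max leqnn orbT.
  - by rewrite /e2 !ge_min lexx !orbT.
  - move=> g f'g; split.
      apply: He1; apply: near_uptoW f'g; first exact: leq_maxl.
      by rewrite /e2 ge_min lexx.
    have f'g' : near_upto N ((e - e') / 2) (fn f') (fn g).
      apply: near_uptoW f'g; first by rewrite leq_max leqnSn orbT.
      by rewrite /e2 !ge_min lexx orbT.
    apply: near_uptoW (near_upto_trans ff' f'g') => //; lra.
have [N0 [e0 [e00 He0]]] := (open_XinfP oOmega O).1 oO _ Of0.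
(* Starting with radius at most 1 yields the rate [2^-1 ^+ n] of [Xinf_limit]. *)
have [x [x0 xS]] := dependent_choice total (0%N, f0, N0, Num.min e0 1).
pose f n := (x n).1.1.2; pose NN n := (x n).1.2; pose ee n := (x n).2.
have inv n : [/\ (x n).1.1.1 = n, (n <= NN n)%N, 0 < ee n & ee n <= 2^-1 ^+ n].
  elim: n => [|n [k1 k2 k3 k4]].
    by rewrite /NN /ee x0 /= lt_min e00 ltr01 expr0 ge_min lexx orbT.
  move: (xS n) k1 k2 k3 k4; rewrite /step /NN /ee.
  case: (x n) => [[[k g] N] e]; case: (x n.+1) => [[[k' g'] N'] e'] /= H kn nN e_gt0 en.
  rewrite kn in H.
  have [-> NN' e'0 e'e _] := H e_gt0; split=> //; first exact: leq_ltn_trans NN'.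
  rewrite exprS mulrC (le_trans e'e)// ler_wpM2r// invr_ge0//.
have nest1 n (g : Xinf Omega) : near_upto (NN n.+1) (ee n.+1) (fn (f n.+1)) (fn g) ->
   G n g /\ near_upto (NN n) (ee n) (fn (f n)) (fn g).
  have [k1 _ k3 _] := inv n; move: (xS n) k1 k3; rewrite /step /NN /ee /f.
  case: (x n) => [[[k h] N] e]; case: (x n.+1) => [[[k' h'] N'] e'] /= H kn e_gt0.
  rewrite kn in H.
  by have [_ _ _ _ H'] := H e_gt0; exact: H'.
have nest k j (g : Xinf Omega) : (k <= j)%N -> near_upto (NN j) (ee j) (fn (f j)) (fn g) ->
   near_upto (NN k) (ee k) (fn (f k)) (fn g).
  move=> /subnK <-; elim: (j - k)%N => [//|d IH]; rewrite addSn => /nest1[_]; exact: IH.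
have near_f k j : (k <= j)%N -> near_upto (NN k) (ee k) (fn (f k)) (fn (f j)).
  move=> kj; apply: (nest k j) => //; apply: near_upto_refl.
  by have [_ _ /ltW] := inv j.
have [|h Hh] := @Xinf_limit f.
  move=> k j kj; have [_ h1 _ h2] := inv k.
  by apply: near_uptoW (near_f _ _ kj).
have near_h k : near_upto (NN k) (ee k) (fn (f k)) (fn h).
  move=> l z lN Ez zN; apply: (tends_le_near (N := k) (Hh l z Ez)) => n kn.
  exact: (near_f _ _ kn l z lN Ez zN).
exists h; split.
  apply: He0; have := near_h 0%N; rewrite /NN /ee /f x0 /=; apply: near_uptoW => //.
  by rewrite ge_min lexx.
by move=> k _; have [] := nest1 k h (near_h k.+1).
Qed.

End Completeness.

(** * Rational approximate indicators *)

Section Grid.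
Variable R : realType.
Local Notation C := R[i].
Variables (delta : R) (B : nat).
Hypothesis delta0 : 0 < delta.
Implicit Types (z w : C) (i j k : nat).

Definition gx i : R := delta * (i%:R - B%:R).
(** The centre of a grid cell; [hmid] and [vmid] are the midpoints of its lower and left edges. *)
Definition cell i j : C := gx i +i* gx j.
Definition hmid i j : C := gx i +i* (gx j - delta / 2).
Definition vmid i j : C := (gx i - delta / 2) +i* gx j.
(** Midpoint rule for the integral of 1/(w - z) along an edge; on vertical edges dw carries the
    factor 'i. *)
Definition hedge i j z : C := delta%:C / (hmid i j - z).
Definition vedge i j z : C := 'i%C * delta%:C / (vmid i j - z).

(* Midpoint sum for the contour integral of 1/(w - z) around a grid cell. *)
Definition cell_sum i j z : C := hedge i j z - hedge i j.+1 z + (vedge i.+1 j z - vedge i j z).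

Lemma gxS i : gx i.+1 = gx i + delta.
Proof. by rewrite /gx -natr1; ring. Qed.

Lemma gxD i k : gx (i + k) = gx i + delta * k%:R.
Proof. by rewrite /gx natrD; ring. Qed.

(** Each pair of opposite edges contributes [2 * I * x * d] over a quadratic denominator, with
    opposite signs. The terms [u ^+ 2] cancel, and the remainder has the size of
    [d * x ^+ 3 / u ^+ 4]. *)
Lemma cell_identity (u x I d : C) : I ^+ 2 = -1 ->
  u - x != 0 -> u + x != 0 -> u - I * x != 0 -> u + I * x != 0 ->
  d / (u - I * x) - d / (u + I * x) + (I * d / (u + x) - I * d / (u - x)) =
  - (4%:R * I * x ^+ 3 * d) / ((u - x) * (u + x) * ((u - I * x) * (u + I * x))).
Proof.
move=> I2 g1 g2 g3 g4.
have -> : d / (u - I * x) - d / (u + I * x) + (I * d / (u + x) - I * d / (u - x))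
   = d * (2%:R * I * x) * ((u ^+ 2 - x ^+ 2) - (u ^+ 2 - I ^+ 2 * x ^+ 2))
     / ((u - x) * (u + x) * ((u - I * x) * (u + I * x))).
  by field; rewrite g1 g2 g3 g4.
by rewrite I2; congr (_ / _); ring.
Qed.

Lemma cell_sumE i j z (x := (delta / 2)%:C : C) (u := cell i j - z) :
  delta / 2 < normc u ->
  cell_sum i j z = - (4%:R * 'i%C * x ^+ 3 * delta%:C) / (u ^+ 4 - x ^+ 4).
Proof.
move=> ux.
have I2 : ('i%C : C) ^+ 2 = -1 by exact: sqr_i.
have nx : normc x = delta / 2 by rewrite normcR ger0_norm// divr_ge0// ltW.
have nz (a : C) : normc a = delta / 2 -> u - a != 0.
  move=> na; rewrite subr_eq0; apply/eqP => e; move: ux; rewrite e na ltxx//.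
have n1 := nz x nx; have n2 := nz (- x); rewrite normcN opprK in n2; have {}n2 := n2 nx.
have n3 := nz ('i%C * x); rewrite normcM normc_i mul1r in n3; have {}n3 := n3 nx.
have n4 := nz (- ('i%C * x)); rewrite normcN normcM normc_i mul1r opprK in n4; have {}n4 := n4 nx.
have e1 : hmid i j - z = u - 'i%C * x.
  have -> : hmid i j = cell i j - 'i%C * x by rewrite /cell /hmid; apply/eqP; rewrite eq_complex /=; apply/andP; split; apply/eqP; ring.
  rewrite /u; ring.
have e2 : hmid i j.+1 - z = u + 'i%C * x.
  have -> : hmid i j.+1 = cell i j + 'i%C * x by rewrite /cell /hmid gxS; apply/eqP; rewrite eq_complex /=; apply/andP; split; apply/eqP; field.
  rewrite /u; ring.
have e3 : vmid i j - z = u - x.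
  have -> : vmid i j = cell i j - x by rewrite /cell /vmid; apply/eqP; rewrite eq_complex /=; apply/andP; split; apply/eqP; ring.
  rewrite /u; ring.
have e4 : vmid i.+1 j - z = u + x.
  have -> : vmid i.+1 j = cell i j + x by rewrite /cell /vmid gxS; apply/eqP; rewrite eq_complex /=; apply/andP; split; apply/eqP; field.
  rewrite /u; ring.
rewrite /cell_sum /hedge /vedge e1 e2 e3 e4.
have f4 : u ^+ 4 - x ^+ 4 = (u - x) * (u + x) * ((u - 'i%C * x) * (u + 'i%C * x)).
  have -> : (u - 'i%C * x) * (u + 'i%C * x) = u ^+ 2 - 'i%C ^+ 2 * x ^+ 2 by ring.
  by rewrite I2; ring.
by rewrite f4; apply: cell_identity.
Qed.

(** The rapid decay matters: the grid will have of the order of [M ^ 2] cells, and all the distant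
    ones together must still contribute little. *)
Lemma cell_sum_le (M : nat) i j z : (0 < M)%N -> M%:R * delta <= normc (cell i j - z) ->
  normc (cell_sum i j z) <= M%:R ^- 4.
Proof.
move=> M0 Mu; have M1 : 1 <= M%:R :> R by rewrite (ler_nat _ 1).
set u := cell i j - z in Mu *; set D : R := delta ^+ 4.
have D0 : 0 < D by rewrite exprn_gt0.
have Md : delta <= M%:R * delta by rewrite ler_peMl// ltW.
have ud : delta / 2 < normc u.
  by apply: (lt_le_trans _ (le_trans Md Mu)); rewrite ltr_pdivrMr// ltr_pMr// (ltr_nat _ 1 2).
have x4 : normc ((delta / 2)%:C ^+ 4) = D / 16.
  rewrite normcX normcR ger0_norm; last by rewrite divr_ge0// ltW.
  by rewrite expr_div_n -[in LHS]natrX.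
have M4 : 1 <= M%:R ^+ 4 :> R by rewrite exprn_ege1.
have u4 : M%:R ^+ 4 * D <= normc u ^+ 4.
  by rewrite -exprMn lerXn2r ?nnegrE ?normc_ge0// mulr_ge0// ltW.
have lower : M%:R ^+ 4 * D / 2 <= normc (u ^+ 4 - (delta / 2)%:C ^+ 4).
  have := normc_leB (u ^+ 4) ((delta / 2)%:C ^+ 4); rewrite x4 normcX.
  have : D <= M%:R ^+ 4 * D by rewrite ler_peMl// ltW.
  move: u4; move: (normc u ^+ 4) (normc (u ^+ 4 - _)) (M%:R ^+ 4 * D) => a b c; lra.
have num : normc (- (4%:R * 'i%C * (delta / 2)%:C ^+ 3 * delta%:C)) = D / 2.
  rewrite normcN !normcM normc_i normc_nat !normcR !ger0_norm ?divr_ge0 ?(ltW delta0)//.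
  by rewrite /D; field.
rewrite cell_sumE// normcM normcV num.
have Mp : 0 < M%:R ^+ 4 * D / 2 by rewrite !mulr_gt0 ?exprn_gt0 ?ltr0n.
rewrite ler_pdivrMr; last exact: lt_le_trans Mp lower.
rewrite -[X in X <= _](_ : M%:R ^- 4 * (M%:R ^+ 4 * D / 2) = D / 2); last first.
  by field; rewrite pnatr_eq0 -lt0n.
by rewrite ler_wpM2l// invr_ge0 exprn_ge0.
Qed.

Lemma cell_sum_block i1 i2 j1 j2 z : (i1 <= i2)%N -> (j1 <= j2)%N ->
  \sum_(i1 <= i < i2) \sum_(j1 <= j < j2) cell_sum i j z =
  \sum_(i1 <= i < i2) (hedge i j1 z - hedge i j2 z) +
  \sum_(j1 <= j < j2) (vedge i2 j z - vedge i1 j z).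
Proof.
move=> ii jj; rewrite /cell_sum.
under eq_bigr do rewrite big_split /=.
rewrite big_split /=; congr (_ + _).
  apply: eq_bigr => i _; have /= T := telescope_sumr (fun j => hedge i j z) jj.
  rewrite -[RHS]opprB -T -sumrN.
  by apply: eq_bigr => j _; rewrite opprB.
rewrite exchange_big /=; apply: eq_bigr => j _; exact: (telescope_sumr (fun i => vedge i j z) ii).
Qed.

Lemma summation_by_parts (V : comNzRingType) n (a b : nat -> V) : a 0%N = 0 -> a n = 0 ->
  \sum_(0 <= j < n) a j * (b j - b j.+1) = \sum_(0 <= j < n) (a j.+1 - a j) * b j.+1.
Proof.
move=> a0 an; apply/eqP; rewrite -subr_eq0 -sumrB.
rewrite (eq_bigr (fun j => - (a j.+1 * b j.+1 - a j * b j))); last by move=> j _; ring.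
by rewrite sumrN (telescope_sumr (fun j => a j * b j))// a0 an !mul0r subrr oppr0.
Qed.

(** Discrete Stokes formula: the weight of an edge becomes the jump of [psi] across it, so that only
    edges between cells of different weight produce poles. *)
Lemma grid_parts n (psi : nat -> nat -> C) z :
  (forall k, psi k 0%N = 0) -> (forall k, psi k n = 0) ->
  (forall k, psi 0%N k = 0) -> (forall k, psi n k = 0) ->
  \sum_(0 <= i < n) \sum_(0 <= j < n) psi i j * cell_sum i j z =
  \sum_(0 <= i < n) \sum_(0 <= j < n)
    ((psi i j.+1 - psi i j) * hedge i j.+1 z - (psi i.+1 j - psi i j) * vedge i.+1 j z).
Proof.
move=> p1 p2 p3 p4; rewrite /cell_sum.
under eq_bigr do (under eq_bigr do rewrite mulrDr; rewrite big_split /=).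
under [RHS]eq_bigr do rewrite big_split /=.
rewrite !big_split /=; congr (_ + _).
  by apply: eq_bigr => i _; rewrite summation_by_parts.
rewrite exchange_big [RHS]exchange_big /=; apply: eq_bigr => j _.
rewrite sumrN -(summation_by_parts (fun i => vedge i j z) (p3 j) (p4 j)) -sumrN.
by apply: eq_bigr => i _; ring.
Qed.

End Grid.

(** * Square blocks of cells: the discrete winding number *)

Section Block.
Variable R : realType.
Local Notation C := R[i].
Local Notation Re := (@complex.Re R).
Local Notation Im := (@complex.Im R).
Variables (delta : R) (B : nat).
Hypothesis delta0 : 0 < delta.
Variables (M i1 j1 : nat).
Hypothesis M4 : (4 <= M)%N.
Local Notation cell := (cell delta B).
Local Notation hmid := (hmid delta B).
Local Notation vmid := (vmid delta B).
Local Notation hedge := (hedge delta B).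
Local Notation vedge := (vedge delta B).
Local Notation cell_sum := (cell_sum delta B).

(** In units of the mesh, the block of [L] by [L] cells is the square of half side [m] around
    [s0]. *)
Let m : R := M%:R + 2^-1.
Let L := M.*2.+1.
Let s0 : C := cell (i1 + M) (j1 + M).

(* The cell sums over a square block telescope to the boundary, so that they sum to
   ['i * block_const] at the central cell, whatever the mesh. *)
Definition block_const : R := \sum_(0 <= k < L) 4 * m / ((k%:R - M%:R) ^+ 2 + m ^+ 2).

Definition block_sum z : C :=
  \sum_(i1 <= i < i1 + L) \sum_(j1 <= j < j1 + L) cell_sum i j z.

Let m0 : 0 < m. Proof. by rewrite /m ltr_wpDl. Qed.

(** [block_const] is a Riemann sum for 2 pi, so ['i * block_const] stands for 2 pi i; dividing by it
    only takes a lower bound. Each of the [L = 2 * m] terms is at least [2 / m]. *)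
Lemma block_const_ge : 4 <= block_const.
Proof.
have -> : 4 = \sum_(0 <= k < L) 2 / m :> R.
  rewrite big_const_nat subn0 iter_addr addr0 -[RHS]mulr_natr /L.
  have -> : (M.*2.+1)%:R = 2 * m :> R by rewrite /m -natr1 -muln2 natrM; field.
  by field; rewrite gt_eqF.
rewrite /block_const !big_mkord; apply: ler_sum => k _.
have t2 : (k%:R - M%:R) ^+ 2 <= m ^+ 2.
  rewrite -subr_ge0 subr_sqr.
  have : k%:R <= 2 * M%:R :> R by rewrite -natrM ler_nat mul2n -ltnS ltn_ord.
  have : 0 <= k%:R :> R by [].
  by move=> h1 h2; rewrite mulr_ge0// /m; lra.
have p : 0 < (k%:R - M%:R) ^+ 2 + m ^+ 2 by rewrite ltr_wpDl ?sqr_ge0// exprn_gt0.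
rewrite ler_pdivrMr// mulrAC ler_pdivlMr//.
rewrite (_ : 4 * m * m = 2 * (m ^+ 2 + m ^+ 2)); last by ring.
by rewrite ler_pM2l// lerD2r.
Qed.

Lemma block_sumE z : block_sum z = \sum_(0 <= k < L)
  (hedge (k + i1) j1 z - hedge (k + i1) (j1 + L) z
   + (vedge (i1 + L) (k + j1) z - vedge i1 (k + j1) z)).
Proof.
rewrite /block_sum cell_sum_block ?leq_addr// [RHS]big_split /=; congr (_ + _).
- by rewrite -{1}[i1]add0n big_addn addKn.
- by rewrite -{1}[j1]add0n big_addn addKn.
Qed.

Let t k : R := k%:R - M%:R.

Lemma hmid_low k : hmid (k + i1) j1 - s0 = delta%:C * ((t k)%:C - 'i%C * m%:C).
Proof.
rewrite /s0 /cell /hmid /t /m (addnC k) !gxD; apply/eqP; rewrite eq_complex /=.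
by apply/andP; split; apply/eqP; field.
Qed.

Lemma hmid_high k : hmid (k + i1) (j1 + L) - s0 = delta%:C * ((t k)%:C + 'i%C * m%:C).
Proof.
rewrite /s0 /cell /hmid /t /m /L (addnC k) !gxD -natr1 -mul2n natrM.
by apply/eqP; rewrite eq_complex /=; apply/andP; split; apply/eqP; field.
Qed.

Lemma vmid_right k : vmid (i1 + L) (k + j1) - s0 = delta%:C * (m%:C + 'i%C * (t k)%:C).
Proof.
rewrite /s0 /cell /vmid /t /m /L (addnC k) !gxD -natr1 -mul2n natrM.
by apply/eqP; rewrite eq_complex /=; apply/andP; split; apply/eqP; field.
Qed.

Lemma vmid_left k : vmid i1 (k + j1) - s0 = delta%:C * (- m%:C + 'i%C * (t k)%:C).
Proof.
rewrite /s0 /cell /vmid /t /m (addnC k) !gxD.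
by apply/eqP; rewrite eq_complex /=; apply/andP; split; apply/eqP; field.
Qed.

Let dC : delta%:C != 0. Proof. by rewrite -normc_eq0 normcR normr_eq0 gt_eqF. Qed.

Lemma block_sum_center : block_sum s0 = 'i%C * block_const%:C.
Proof.
rewrite block_sumE /block_const rmorph_sum mulr_sumr; apply: eq_bigr => k _.
rewrite /hedge /vedge hmid_low hmid_high vmid_right vmid_left.
have p : (t k) ^+ 2 + m ^+ 2 != 0 by rewrite gt_eqF// ltr_wpDl ?sqr_ge0// exprn_gt0.
have pC : (t k)%:C ^+ 2 + m%:C ^+ 2 != 0.
  by rewrite -!rmorphXn -rmorphD -normc_eq0 normcR normr_eq0.
have push (x y : R) : (4 * y / (x ^+ 2 + y ^+ 2))%:C =
    4%:R * y%:C / (x%:C ^+ 2 + y%:C ^+ 2) :> C.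
  by rewrite rmorphM fmorphV rmorphD !rmorphXn rmorphM rmorph_nat.
rewrite [X in _ = _ * X](push (t k) m).
have I2 : ('i%C : C) ^+ 2 = -1 by exact: sqr_i.
move: ('i%C : C) (t k)%:C m%:C delta%:C dC pC I2 => I x y d d0 q I2.
have f1 : (x - I * y) * (x + I * y) = x ^+ 2 + y ^+ 2.
  by transitivity (x ^+ 2 - I ^+ 2 * y ^+ 2); [ring|rewrite I2; ring].
have f2 : (y + I * x) * (- y + I * x) = - (x ^+ 2 + y ^+ 2).
  by transitivity (I ^+ 2 * x ^+ 2 - y ^+ 2); [ring|rewrite I2; ring].
have [n1 n2] : x - I * y != 0 /\ x + I * y != 0.
  by apply/andP; rewrite -negb_or -mulf_eq0 f1.
have [n3 n4] : y + I * x != 0 /\ - y + I * x != 0.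
  by apply/andP; rewrite -negb_or -mulf_eq0 f2 oppr_eq0.
have e1 : d / (d * (x - I * y)) - d / (d * (x + I * y)) = 2%:R * I * y / (x ^+ 2 + y ^+ 2).
  by rewrite -f1; field; rewrite n1 n2 d0.
have e2 : I * d / (d * (y + I * x)) - I * d / (d * (- y + I * x)) = 2%:R * I * y / (x ^+ 2 + y ^+ 2).
  rewrite -[x ^+ 2 + y ^+ 2]opprK -f2; field; rewrite n3 n4 d0; by [].
by rewrite e1 e2; ring.
Qed.

(** As [M] is at least 4, a displacement by [2 * delta] leaves at least half of the lower bound
    [delta * M] for the distance to [w]. *)
Lemma edge_close (w z d : C) : normc d = delta -> normc (z - s0) <= 2 * delta ->
  delta * m <= normc (w - s0) -> normc (d / (w - z) - d / (w - s0)) <= 4 / M%:R ^+ 2.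
Proof.
move=> nd zs ws; have M0 : 4 <= M%:R :> R by rewrite (ler_nat _ 4).
have wsM : delta * M%:R <= normc (w - s0).
  by rewrite (le_trans _ ws)// ler_pM2l// /m lerDl.
have wz : delta * M%:R / 2 <= normc (w - z).
  have := normcBD z w s0; have : delta * 4 <= delta * M%:R by rewrite ler_pM2l.
  move: zs wsM; move: (normc (w - z)) (normc _) (normc _) (_ * M%:R) => a b c e; lra.
have p1 : 0 < normc (w - s0) by rewrite (lt_le_trans _ wsM)// mulr_gt0//; lra.
have p2 : 0 < normc (w - z) by rewrite (lt_le_trans _ wz)// divr_gt0// mulr_gt0//; lra.
have -> : d / (w - z) - d / (w - s0) = d * (z - s0) / ((w - z) * (w - s0)).
  by rewrite normc_gt0 in p1; rewrite normc_gt0 in p2; field; rewrite p1 p2.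
rewrite normcM normcV normcM nd normcM ler_pdivrMr ?mulr_gt0//.
apply: (@le_trans _ _ (4 / M%:R ^+ 2 * (delta * M%:R / 2 * (delta * M%:R)))).
  rewrite (_ : 4 / M%:R ^+ 2 * (delta * M%:R / 2 * (delta * M%:R)) = delta * (2 * delta)); last first.
    by field; rewrite gt_eqF//; lra.
  by rewrite ler_pM2l.
rewrite ler_wpM2l ?divr_ge0 ?exprn_ge0//.
by rewrite ler_pM// ?divr_ge0 ?mulr_ge0 ?(ltW delta0).
Qed.

Lemma block_sum_near z : normc (z - s0) <= 2 * delta ->
  normc (block_sum z - 'i%C * block_const%:C) <= 48 / M%:R.
Proof.
move=> zs; rewrite -block_sum_center !block_sumE -sumrB.
have M0 : 4 <= M%:R :> R by rewrite (ler_nat _ 4).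
rewrite (le_trans (normc_sum _ _ _))//.
(* Each of the [2 * M + 1] indices carries four edges, each changed by at most [4 / M%:R ^+ 2]. *)
apply: (@le_trans _ _ (\sum_(0 <= k < L) 16 / M%:R ^+ 2)); last first.
  rewrite big_const_nat subn0 iter_addr addr0 -[X in X <= _]mulr_natr.
  have -> : L%:R = 2 * M%:R + 1 :> R by rewrite /L -natr1 -mul2n natrM.
  rewrite mulrAC ler_pdivrMr ?exprn_gt0//; last lra.
  rewrite (_ : 48 / M%:R * M%:R ^+ 2 = 48 * M%:R); last by field; rewrite gt_eqF//; lra.
  lra.
apply: ler_sum => k _.
have nI : normc ('i%C * delta%:C : C) = delta by rewrite normcM normc_i mul1r normcR gtr0_norm.
have nd : normc (delta%:C : C) = delta by rewrite normcR gtr0_norm.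
have far (x : C) : m <= normc x -> delta * m <= normc (delta%:C * x).
  by move=> mx; rewrite normcM nd ler_pM2l.
have I1 (a b : R) : Im (a%:C + 'i%C * b%:C) = b by rewrite /=; ring.
have R1 (a b : R) : Re (a%:C + 'i%C * b%:C) = a by rewrite /=; ring.
have a1 : m <= normc ((t k)%:C - 'i%C * m%:C).
  rewrite (le_trans _ (normc_Im _))// (_ : Im _ = - m); last by rewrite /=; ring.
  by rewrite normrN ler_norm.
have a2 : m <= normc ((t k)%:C + 'i%C * m%:C).
  by rewrite (le_trans _ (normc_Im _))// I1 ler_norm.
have a3 : m <= normc (m%:C + 'i%C * (t k)%:C).
  by rewrite (le_trans _ (normc_Re _))// R1 ler_norm.
have a4 : m <= normc (- m%:C + 'i%C * (t k)%:C).
  rewrite (le_trans _ (normc_Re _))// (_ : Re _ = - m); last by rewrite /=; ring.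
  by rewrite normrN ler_norm.
have := @edge_close (hmid (k + i1) j1) z delta%:C nd zs; rewrite hmid_low => /(_ (far _ a1)).
have := @edge_close (hmid (k + i1) (j1 + L)) z delta%:C nd zs; rewrite hmid_high => /(_ (far _ a2)).
have := @edge_close (vmid (i1 + L) (k + j1)) z ('i%C * delta%:C) nI zs; rewrite vmid_right => /(_ (far _ a3)).
have := @edge_close (vmid i1 (k + j1)) z ('i%C * delta%:C) nI zs; rewrite vmid_left => /(_ (far _ a4)).
rewrite -hmid_low -hmid_high -vmid_right -vmid_left.
rewrite -/(vedge i1 (k + j1) z) -/(vedge i1 (k + j1) s0) -/(vedge (i1 + L) (k + j1) z) -/(vedge (i1 + L) (k + j1) s0).
rewrite -/(hedge (k + i1) j1 z) -/(hedge (k + i1) j1 s0) -/(hedge (k + i1) (j1 + L) z) -/(hedge (k + i1) (j1 + L) s0).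
move: (vedge i1 (k + j1) z) (vedge i1 (k + j1) s0) (vedge (i1 + L) (k + j1) z) (vedge (i1 + L) (k + j1) s0) => v1 v2 v3 v4.
move: (hedge (k + i1) j1 z) (hedge (k + i1) j1 s0) (hedge (k + i1) (j1 + L) z) (hedge (k + i1) (j1 + L) s0) => h1 h2 h3 h4.
move=> g1 g2 g3 g4.
rewrite (_ : _ - _ = (h1 - h2) - (h3 - h4) + ((v3 - v4) - (v1 - v2))); last by ring.
rewrite (_ : 16 / M%:R ^+ 2 = (4 / M%:R ^+ 2 + 4 / M%:R ^+ 2) + (4 / M%:R ^+ 2 + 4 / M%:R ^+ 2)); last by ring.
rewrite (le_trans (normcD _ _))//; apply: lerD.
  exact: le_trans (normcB_le _ _) (lerD g4 g3).
exact: le_trans (normcB_le _ _) (lerD g2 g1).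
Qed.

End Block.

Section RationalOn.
Variable R : realType.
Local Notation C := R[i].
Implicit Types (S : set C) (f g : C -> C).

Definition rational_on S f := exists U W : {poly C},
  forall z, S z -> W.[z] != 0 /\ f z = U.[z] / W.[z].

Lemma rational_onD S f g : rational_on S f -> rational_on S g ->
  rational_on S (fun z => f z + g z).
Proof.
move=> [U [W H]] [U' [W' H']]; exists (U * W' + U' * W), (W * W') => z Sz.
have [w0 ->] := H z Sz; have [w'0 ->] := H' z Sz.
rewrite !hornerD !hornerM mulf_neq0//; split=> //.
by field; rewrite w0 w'0.
Qed.

Lemma rational_onM S f g : rational_on S f -> rational_on S g ->
  rational_on S (fun z => f z * g z).
Proof.
move=> [U [W H]] [U' [W' H']]; exists (U * U'), (W * W') => z Sz.
have [w0 ->] := H z Sz; have [w'0 ->] := H' z Sz.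
rewrite !hornerM mulf_neq0//; split=> //.
by field; rewrite w0 w'0.
Qed.

Lemma rational_on_cst S (a : C) : rational_on S (fun=> a).
Proof. by exists a%:P, 1 => z _; rewrite !hornerE oner_neq0 divr1. Qed.

Lemma rational_on_sum S (I : Type) (r : seq I) (f : I -> C -> C) :
  (forall i, rational_on S (f i)) -> rational_on S (fun z => \sum_(i <- r) f i z).
Proof.
move=> H; elim: r => [|i r IH].
  by under eq_fun do rewrite big_nil; exact: rational_on_cst.
by under eq_fun do rewrite big_cons; exact: rational_onD.
Qed.

Lemma rational_on_pole S (a w : C) : a = 0 \/ ~ S w -> rational_on S (fun z => a / (w - z)).
Proof.
move=> [->|nS]; first by under eq_fun do rewrite mul0r; exact: rational_on_cst.
exists a%:P, (w%:P - 'X) => z Sz; rewrite !hornerE; split=> //.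
by rewrite subr_eq0; apply/eqP => wz; apply: nS; rewrite wz.
Qed.

End RationalOn.

(** * The approximate indicator of a compact set *)

Section Indicator.
Variable R : realType.
Local Notation C := R[i].
Local Notation Re := (@complex.Re R).
Local Notation Im := (@complex.Im R).

Lemma big_nat_sub (V : nmodType) (F : nat -> V) i1 i2 n : (i1 <= i2)%N -> (i2 <= n)%N ->
  \sum_(0 <= i < n) (if (i1 <= i < i2)%N then F i else 0) = \sum_(i1 <= i < i2) F i.
Proof.
move=> h1 h2; rewrite (big_cat_nat _ (leq_trans h1 h2))//= big_nat big1 ?add0r; last first.
  by move=> i /andP[_ ii]; rewrite leqNgt ii.
rewrite (big_cat_nat h1 h2)/= [X in _ + X]big_nat [X in _ + X]big1 ?addr0; last first.
  by move=> i /andP[ii _]; rewrite ltnNge ii andbF.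
by apply: eq_big_nat => i ->.
Qed.

Variables (K E : set C) (R0 rho : R) (A M : nat).
Hypothesis rho0 : 0 < rho.
Hypothesis KR : forall z, K z -> normc z <= R0.
Hypothesis KE : forall z y, K z -> E y -> 3 * rho <= normc (y - z).
Hypothesis Alarge : 2 * (R0 + rho) / rho + 3 <= A%:R.
Hypothesis M4 : (4 <= M)%N.

(** With [2 * (M + 1) * delta = rho], the block around a point of [K] fits into the margin [rho];
    and [B * delta = A * rho / 2] is independent of [M], so the grid covers a fixed square while [M]
    grows. *)
Let delta : R := rho / (2 * (M%:R + 1)).
Let B := (A * M.+1)%N.
Let n := B.*2.
Let L := M.*2.+1.
Local Notation cell := (cell delta B).
Local Notation hmid := (hmid delta B).
Local Notation vmid := (vmid delta B).
Local Notation gx := (gx delta B).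
Local Notation cell_sum := (cell_sum delta B).

Let delta0 : 0 < delta. Proof. by rewrite divr_gt0// mulr_gt0// ltr_wpDl. Qed.

Let rho_delta : rho = 2 * (M%:R + 1) * delta.
Proof. by rewrite /delta mulrC divfK// gt_eqF// mulr_gt0// ltr_wpDl. Qed.

Let B_large : R0 + rho < B%:R * delta.
Proof.
have : (2 * (R0 + rho) / rho + 3) * rho <= A%:R * rho by rewrite ler_pM2r.
rewrite mulrDl divfK ?gt_eqF// => h.
have -> : B%:R * delta = A%:R * rho / 2.
  by rewrite /B natrM -[M.+1%:R]natr1 rho_delta; field.
rewrite ltr_pdivlMr// mulrC; apply: lt_le_trans h; rewrite ltrDl mulr_gt0//.
Qed.

(** The margin [rho] puts a whole block around each point of [K] into the mask, while by [KE] masked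
    centres stay at distance [2 * rho] from [E]. *)
Definition mask i j : bool := `[< exists2 z, K z & normc (cell i j - z) <= rho >].
Let psi i j : C := (mask i j)%:R.

Lemma mask_bound i j : mask i j -> `|gx i| < B%:R * delta /\ `|gx j| < B%:R * delta.
Proof.
move=> /asboolP[z Kz cz].
have h : normc (cell i j) < B%:R * delta.
  have := normcD (cell i j - z) z; rewrite subrK => h1.
  by rewrite (le_lt_trans h1)// (le_lt_trans _ B_large)// addrC lerD// KR.
by split; apply: le_lt_trans h; [have := normc_Re (cell i j)|have := normc_Im (cell i j)].
Qed.

Lemma mask_border k : [/\ mask k 0 = false, mask k n = false, mask 0 k = false & mask n k = false].
Proof.
have g0 : `|gx 0| = B%:R * delta.
  by rewrite /gx sub0r mulrN normrN mulrC ger0_norm// mulr_ge0// ltW.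
have gn : `|gx n| = B%:R * delta.
  rewrite /gx /n -mul2n natrM (_ : delta * _ = B%:R * delta); last by ring.
  by rewrite ger0_norm// mulr_ge0// ltW.
by split; apply/negP => /mask_bound[]; rewrite ?g0 ?gn ltxx.
Qed.

Definition raw z : C := \sum_(0 <= i < n) \sum_(0 <= j < n) psi i j * cell_sum i j z.

Lemma rational_on_raw : rational_on (K `|` E) raw.
Proof.
have dr : delta / 2 <= rho.
  rewrite [leRHS]rho_delta [leLHS]mulrC ler_pM2r//.
  have : 0 <= M%:R :> R by []. 
  lra.
(* The midpoint [w] of an edge is within [delta / 2] of both adjacent centres. If it were in [K],
   both cells would be masked; if in [E], neither. So an edge with a nonzero jump has its pole off
   both sets. *)
have key i j i' j' (w : C) : normc (cell i j - w) <= delta / 2 -> normc (cell i' j' - w) <= delta / 2 ->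
    psi i' j' - psi i j = 0 \/ ~ (K `|` E) w.
  move=> c1 c2; rewrite /psi; have [->|mm] := eqVneq (mask i' j') (mask i j).
    by left; rewrite subrr.
  right=> -[Kw|Ew].
    have m1 : mask i j by apply/asboolP; exists w => //; apply: le_trans c1 dr.
    have m2 : mask i' j' by apply/asboolP; exists w => //; apply: le_trans c2 dr.
    by move: mm; rewrite m1 m2.
  have abs a b : mask a b -> normc (cell a b - w) <= delta / 2 -> False.
    move=> /asboolP[y Ky cy]; rewrite normcB => cw.
    have h := le_trans (KE Ky Ew) (le_trans (normcBD (cell a b) w y) (lerD cw cy)).
    by move: rho0 dr h; lra.
  by case m1: (mask i j) mm; case m2: (mask i' j') => // _; [exact: (abs i j)|exact: (abs i' j')].
pose F i j z : C := ((psi i j.+1 - psi i j) * delta%:C / (hmid i j.+1 - z) + - (psi i.+1 j - psi i j) * ('i%C * delta%:C) / (vmid i.+1 j - z)).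
have -> : raw = fun z => \sum_(0 <= i < n) \sum_(0 <= j < n) F i j z.
  apply/funext => z; have P k : [/\ psi k 0 = 0, psi k n = 0, psi 0 k = 0 & psi n k = 0].
    by rewrite /psi; case: (mask_border k) => -> -> -> ->.
  rewrite /raw grid_parts; try by move=> k; case: (P k).
  by apply: eq_bigr => i _; apply: eq_bigr => j _; rewrite /F /hedge /vedge; ring.
have half (x : C) : x = (delta / 2)%:C \/ x = - (delta / 2)%:C \/ x = 'i%C * (delta / 2)%:C \/ x = - ('i%C * (delta / 2)%:C) ->
    normc x <= delta / 2.
  have nd : normc (delta / 2)%:C = delta / 2 by rewrite normcR ger0_norm// divr_ge0// ltW.
  by move=> [->|[->|[->|->]]]; rewrite ?normcN ?normcM ?normc_i ?mul1r nd.
apply: (@rational_on_sum _ _ _ _ (fun i z => \sum_(0 <= j < n) F i j z)) => i.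
apply: (@rational_on_sum _ _ _ _ (F i)) => j; apply: rational_onD; apply: rational_on_pole.
- have [||->|] := @key i j i j.+1 (hmid i j.+1); [| |by left; rewrite mul0r|by right].
  + by apply: half; right; right; right; rewrite /cell /hmid gxS; apply/eqP; rewrite eq_complex /=; apply/andP; split; apply/eqP; field.
  + by apply: half; right; right; left; rewrite /cell /hmid; apply/eqP; rewrite eq_complex /=; apply/andP; split; apply/eqP; field.
- have [||->|] := @key i j i.+1 j (vmid i.+1 j); [| |by left; rewrite oppr0 mul0r|by right].
  + by apply: half; right; left; rewrite /cell /vmid gxS; apply/eqP; rewrite eq_complex /=; apply/andP; split; apply/eqP; field.
  + by apply: half; left; rewrite /cell /vmid; apply/eqP; rewrite eq_complex /=; apply/andP; split; apply/eqP; field.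
Qed.

Let M0 : (0 < M)%N. Proof. exact: leq_trans M4. Qed.

(** There are [4 * A ^ 2 * (M + 1) ^ 2] cells, each contributing at most [M%:R ^- 4]. *)
Lemma far_sum (chi : nat -> nat -> C) z :
  (forall i j, chi i j = 0 \/ normc (chi i j) <= 1 /\ M%:R * delta <= normc (cell i j - z)) ->
  normc (\sum_(0 <= i < n) \sum_(0 <= j < n) chi i j * cell_sum i j z) <= 16 * A%:R ^+ 2 / M%:R.
Proof.
move=> H; have MM : 4 <= M%:R :> R by rewrite (ler_nat _ 4).
have Mp : 0 < M%:R :> R by lra.
apply: (@le_trans _ _ (\sum_(0 <= i < n) \sum_(0 <= j < n) M%:R ^- 4)).
  rewrite (le_trans (normc_sum _ _ _))//; apply: ler_sum => i _.
  rewrite (le_trans (normc_sum _ _ _))//; apply: ler_sum => j _.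
  have [->|[c1 c2]] := H i j; first by rewrite mul0r normc0 invr_ge0 exprn_ge0.
  rewrite normcM -[leRHS]mul1r; apply: ler_pM; rewrite ?normc_ge0//.
  exact: cell_sum_le.
rewrite !big_const_nat !subn0 !iter_addr !addr0 -mulrnA -[X in X <= _]mulr_natr natrM.
have -> : n%:R = 2 * (A%:R * (M%:R + 1)) :> R by rewrite /n /B -mul2n !natrM natr1.
rewrite ler_pdivrMl ?exprn_gt0//.
rewrite (_ : M%:R ^+ 4 * (16 * A%:R ^+ 2 / M%:R) = (16 * A%:R ^+ 2) * (M%:R ^+ 2 * M%:R)); last by field; rewrite gt_eqF.
rewrite (_ : 2 * _ * _ = (16 * A%:R ^+ 2) * ((M%:R + 1) ^+ 2 / 4)); last by field.
rewrite ler_wpM2l ?mulr_ge0 ?exprn_ge0// ler_pdivrMr//.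
have : (M%:R + 1) ^+ 2 <= 4 * M%:R ^+ 2 :> R.
  have -> : 4 * M%:R ^+ 2 = (2 * M%:R) ^+ 2 :> R by ring.
  rewrite lerXn2r ?nnegrE ?mulr_ge0 ?addr_ge0//; lra.
move=> /le_trans; apply; rewrite mulrC ler_pM2r//.
by rewrite ler_peMr ?exprn_ge0//; lra.
Qed.

Lemma raw_far z : E z -> normc (raw z) <= 16 * A%:R ^+ 2 / M%:R.
Proof.
move=> Ez; apply: far_sum => i j; rewrite /psi; case m1: (mask i j); last by left.
right; rewrite normc1 lexx; split=> //; move: m1 => /asboolP[y Ky cy].
rewrite normcB.
have h := le_trans (KE Ky Ez) (le_trans (normcBD (cell i j) z y) (lerD (lexx _) cy)).
have : M%:R * delta <= rho.
  rewrite rho_delta ler_wpM2r ?(ltW delta0)//; have : 0 <= M%:R :> R by []. 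
  lra.
by move: rho0 h; lra.
Qed.

(** [i1] starts a block of [L] indices whose middle one gives the last grid value not above [x]; the
    block stays in the grid because the latter exceeds [R0] by [rho]. *)
Lemma grid_index (x : R) : `|x| <= R0 -> exists i1 : nat,
  [/\ (i1 + L <= n)%N, gx (i1 + M) <= x & x < gx (i1 + M) + delta].
Proof.
move=> /ler_normlP[x1 x2].
have hx : R0 + 2 * (M%:R + 1) * delta <= B%:R * delta.
  by rewrite -rho_delta ltW.
pose y := x / delta + B%:R.
have yx : x = delta * (y - B%:R) by rewrite /y addrK mulrC divfK// gt_eqF.
have yd : y * delta = x + B%:R * delta by rewrite /y mulrDl divfK// gt_eqF.
have y1 : 2 * (M%:R + 1) <= y.
  rewrite -(ler_pM2r delta0) yd; move: hx x1 x2; lra.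
have y2 : y <= 2 * B%:R - 2 * (M%:R + 1).
  rewrite -(ler_pM2r delta0) yd; move: hx x1 x2; lra.
have y0 : 0 <= y by rewrite (le_trans _ y1)// mulr_ge0// addr_ge0.
have /andP[t1 t2] := truncn_itv y0.
set k := Num.truncn y in t1 t2.
have Mk : (M <= k)%N.
  rewrite -(ler_nat R); rewrite -natr1 in t2.
  have : 0 <= M%:R :> R by []. 
  lra.
exists (k - M)%N; rewrite subnK//; split.
- have : (k + M.+1 <= n)%N.
    rewrite -(ler_nat R) /n -mul2n natrD natrM -natr1.
    have : 0 <= M%:R :> R by []. 
    lra.
  by rewrite /L -addnn -addnS addnA subnK.
- by rewrite /gx [leRHS]yx ler_pM2l// lerD2r.
- rewrite /gx {1}yx -ltrBlDl -mulrBr -[ltRHS]mulr1 ltr_pM2l//.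
  rewrite -natr1 in t2; lra.
Qed.

Lemma gx_le i j : (i <= j)%N -> gx i <= gx j.
Proof. by move=> ij; rewrite /gx ler_pM2l// lerD2r ler_nat. Qed.

(** The block around [z] is entirely masked and gives nearly ['i * block_const]; all other cells are
    at distance at least [M * delta] and fall under [far_sum]. *)
Lemma raw_near z : K z ->
  normc (raw z - 'i%C * (block_const R M)%:C) <= 48 / M%:R + 16 * A%:R ^+ 2 / M%:R.
Proof.
move=> Kz.
have [i1 [i1n i1a i1b]] := grid_index (le_trans (normc_Re z) (KR Kz)).
have [j1 [j1n j1a j1b]] := grid_index (le_trans (normc_Im z) (KR Kz)).
pose inb i j := ((i1 <= i < i1 + L) && (j1 <= j < j1 + L))%N.
have blockE : block_sum delta B M i1 j1 z = \sum_(0 <= i < n) \sum_(0 <= j < n) (inb i j)%:R * cell_sum i j z.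
  rewrite /block_sum -(big_nat_sub _ (leq_addr _ _) i1n); apply: eq_bigr => i _.
  rewrite /inb; case: (i1 <= i < i1 + L)%N; last by rewrite big1// => j _; rewrite mul0r.
  rewrite -(big_nat_sub _ (leq_addr _ _) j1n); apply: eq_bigr => j _ /=.
  by case: (j1 <= j < j1 + L)%N; rewrite ?mul1r ?mul0r.
have RI (a b : R) : Re (a +i* b - z) = a - Re z /\ Im (a +i* b - z) = b - Im z by case: z {Kz i1a i1b j1a j1b blockE}.
have -> : raw z - 'i%C * (block_const R M)%:C =
   \sum_(0 <= i < n) \sum_(0 <= j < n) (psi i j - (inb i j)%:R) * cell_sum i j z
   + (block_sum delta B M i1 j1 z - 'i%C * (block_const R M)%:C).
  rewrite blockE addrA; congr (_ - _); rewrite -big_split /=; apply: eq_bigr => i _.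
  by rewrite -big_split /=; apply: eq_bigr => j _; rewrite mulrBl subrK.
rewrite (le_trans (normcD _ _))// addrC lerD//.
  apply: block_sum_near => //.
  rewrite normcB (le_trans (normc_leReIm _))// /cell (RI _ _).1 (RI _ _).2.
  have : `|gx (i1 + M) - Re z| <= delta by apply/ler_normlP; split; lra.
  have : `|gx (j1 + M) - Im z| <= delta by apply/ler_normlP; split; lra.
  lra.
apply: far_sum => i j; rewrite /psi.
have gL k : gx (k + L) = gx (k + M) + delta * (M%:R + 1).
  by rewrite !gxD /L -natr1 -mul2n natrM; ring.
have gL' k : gx k = gx (k + M) - delta * M%:R by rewrite !gxD; ring.
case ib: (inb i j).
  left; rewrite (_ : mask i j = true) ?subrr//; apply/asboolP; exists z => //.
  move/andP: ib => [/andP[a1 a2] /andP[b1 b2]].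
  rewrite (le_trans (normc_leReIm _))// /cell (RI _ _).1 (RI _ _).2 rho_delta.
  have g k l (x : R) : (l <= k < l + L)%N -> gx (l + M) <= x -> x < gx (l + M) + delta ->
     `|gx k - x| <= (M%:R + 1) * delta.
    move=> /andP[h1 h2] h3 h4; have := gx_le h1; rewrite gL'.
    have : gx k <= gx (l + M) + delta * M%:R.
      have : gx k.+1 <= gx (l + L) by exact: gx_le.
      rewrite gL gxS; lra.
    move=> h5 h6; apply/ler_normlP; split; lra.
  have := g i i1 (Re z); rewrite a1 a2 => /(_ erefl i1a i1b).
  have := g j j1 (Im z); rewrite b1 b2 => /(_ erefl j1a j1b).
  lra.
right; rewrite subr0; split; first by case: (mask i j); rewrite ?normc1 ?normc0.
have out k l (x : R) : ~~ (l <= k < l + L)%N -> gx (l + M) <= x -> x < gx (l + M) + delta ->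
     M%:R * delta <= `|gx k - x|.
  rewrite negb_and -ltnNge -leqNgt => /orP[h|h] h3 h4.
    have : gx k.+1 <= gx l by exact: gx_le.
    rewrite gxS (gL' l) => h5; rewrite ler_normr; apply/orP; right; lra.
  have := gx_le h; rewrite gL => h5; rewrite ler_normr; apply/orP; left; lra.
move/negbT: ib; rewrite negb_and => /orP[h|h].
  by rewrite (le_trans _ (normc_Re _))// /cell (RI _ _).1; exact: (out i i1).
by rewrite (le_trans _ (normc_Im _))// /cell (RI _ _).2; exact: (out j j1).
Qed.

End Indicator.

Lemma rational_indicator (R : realType) (K E : set R[i]) (e : R) :
  compact K -> closed E -> K `<=` ~` E -> 0 < e ->
  exists f : R[i] -> R[i], [/\ rational_on (K `|` E) f,
    forall z, K z -> normc (f z - 1) <= e & forall z, E z -> normc (f z) <= e].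
Proof.
move=> cK cE KE e0.
have [R0 _ KR] := compact_normc_bounded cK.
have [r r0 Hr] := compact_dist_gt0 cK cE KE.
pose rho := r / 3; have rho0 : 0 < rho by rewrite divr_gt0.
have KE' z y : K z -> E y -> 3 * rho <= normc (y - z).
  by move=> Kz Ey; rewrite /rho mulrC divfK// Hr.
pose A := (Num.truncn (2 * (R0 + rho) / rho)).+4.
have HA : 2 * (R0 + rho) / rho + 3 <= A%:R.
  rewrite /A -addn4 (natrD _ _ 4); have := truncnS_gt (2 * (R0 + rho) / rho); rewrite -natr1; lra.
(* A quarter of the constant [48 + 16 * A%:R ^+ 2] of [raw_near], since the division by
   [block_const] gains a factor 4. *)
pose B : R := 12 + 4 * A%:R ^+ 2.
have B0 : 0 < B by rewrite ltr_pwDl// mulr_ge0// exprn_ge0.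
pose M := maxn 4 (Num.truncn (B / e)).+1.
have M4 : (4 <= M)%N by exact: leq_maxl.
have MB : B / M%:R <= e.
  have Mp : 0 < M%:R :> R by rewrite ltr0n (leq_trans _ M4).
  rewrite ler_pdivrMr// mulrC -ler_pdivrMr// ltW// (lt_le_trans (truncnS_gt _))// ler_nat leq_maxr//.
have c4 := block_const_ge R M; set c := block_const R M in c4.
have c0 : 0 < c by apply: lt_le_trans c4.
have nc : normc ('i%C * c%:C : R[i]) = c by rewrite normcM normc_i mul1r normcR gtr0_norm.
have Ic : 'i%C * c%:C != 0 :> R[i] by rewrite -normc_eq0 nc gt_eqF.
have bound a : a <= 48 / M%:R + 16 * A%:R ^+ 2 / M%:R -> a / c <= e.
  move=> ha; apply: le_trans MB.
  have h4 : 48 / M%:R + 16 * A%:R ^+ 2 / M%:R = 4 * (B / M%:R) by rewrite /B; ring.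
  rewrite ler_pdivrMr// (le_trans ha)// h4 mulrC ler_wpM2l// divr_ge0// ltW//.
exists (fun z => raw K rho A M z / ('i%C * c%:C)); split.
- apply: rational_onM; first exact: (rational_on_raw M rho0 KR KE' HA).
  exact: rational_on_cst.
- move=> z Kz; have := raw_near rho0 KR HA M4 Kz; rewrite -/c => /bound.
  by rewrite -[X in _ / X]nc -normcV -normcM mulrBl divff.
- move=> z Ez; rewrite normcM normcV nc; apply: bound.
  rewrite (le_trans (raw_far A rho0 KE' M4 Ez))// lerDr divr_ge0//.
Qed.

(** * Points of the Riemann sphere and quotients of polynomials *)

Section RationalFunctions.
Variable R : realType.
Local Notation C := R[i].
Implicit Types (A B P Q N : {poly C}) (r : ratfun R) (z w : C).

Lemma ratfun_frac r : r * tofrac (frac (repr r)).2 = tofrac (frac (repr r)).1.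
Proof.
apply/eqP; rewrite -{1}[r]reprK; set x := repr r.
rewrite !piE /FracField.equivf /FracField.mulf /=.
rewrite !numden_Ratio ?mulf_neq0 ?oner_eq0 ?denom_ratioP//.
by rewrite !mulr1 mulrC.
Qed.

Lemma rat_numdenP r : [/\ rat_den r != 0, coprimep (rat_num r) (rat_den r) &
  r * tofrac (rat_den r) = tofrac (rat_num r)].
Proof.
have d0 := denom_ratioP (repr r).
have g0 : rat_gcd r != 0 by rewrite gcdp_eq0 negb_and d0 orbT.
have nE : rat_num r * rat_gcd r = (frac (repr r)).1 by rewrite divpK ?dvdp_gcdl.
have dE : rat_den r * rat_gcd r = (frac (repr r)).2 by rewrite divpK ?dvdp_gcdr.
split.
- by apply: contraNneq d0 => e; rewrite -dE e mul0r.
- by rewrite /rat_num /rat_den /rat_gcd coprimep_div_gcd// d0 orbT.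
- have := ratfun_frac r; rewrite -nE -dE !rmorphM mulrA /=.
  by apply: mulIf; rewrite tofrac_eq0.
Qed.

Lemma rat_frac A B (r := tofrac A / tofrac B : ratfun R) : B != 0 ->
  rat_num r * B = A * rat_den r.
Proof.
move=> B0; have [_ _ e] := rat_numdenP r.
apply/eqP; rewrite -tofrac_eq !rmorphM /= -e /r.
by rewrite mulrAC divfK// tofrac_eq0.
Qed.

Definition sphere_point (a b : C) : option C := if b == 0 then None else Some (a / b).

Lemma rat_evalE r z :
  rat_eval r z = sphere_point (rat_num r).[z] (rat_den r).[z].
Proof. by []. Qed.

(** [rat_eval] uses the reduced fraction; cross-multiplication carries the value over to any
    fraction without common zero at [z], such as the Jacobi quotient on a set where [in_E] holds. *)
Lemma rat_eval_frac A B z : B != 0 -> (A.[z] != 0) || (B.[z] != 0) ->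
  rat_eval (tofrac A / tofrac B) z = sphere_point A.[z] B.[z].
Proof.
move=> B0 AB; have := rat_frac A B0; have := rat_numdenP (tofrac A / tofrac B).
set r := _ / _ => -[d0 cop _] /(congr1 (horner^~ z)); rewrite !hornerM => e.
rewrite rat_evalE /sphere_point.
have [dz|dz] := eqVneq (rat_den r).[z] 0.
  have nz : (rat_num r).[z] != 0 by rewrite coprimep_sym in cop; exact: (coprimep_root cop (introT rootP dz)).
  move/eqP: e; rewrite dz mulr0 mulf_eq0 (negPf nz) /= => /eqP ->.
  by rewrite eqxx.
have [Bz|Bz] := eqVneq B.[z] 0.
  move/eqP: e; rewrite Bz mulr0 eq_sym mulf_eq0 (negPf dz) orbF => /eqP Az.
  by rewrite Az Bz eqxx in AB.
by congr Some; apply/eqP; rewrite eqr_div// e.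
Qed.

Lemma rat_num_den_neq0 r z : ((rat_num r).[z] != 0) || ((rat_den r).[z] != 0).
Proof.
have [_ cop _] := rat_numdenP r.
have [dz|_] := eqVneq (rat_den r).[z] 0; last by rewrite orbT.
rewrite orbF; rewrite coprimep_sym in cop; exact: (coprimep_root cop (introT rootP dz)).
Qed.

Definition hnorm (a b : C) : R := Num.sqrt (normc a ^+ 2 + normc b ^+ 2).

Lemma hnorm_ge0 a b : 0 <= hnorm a b. Proof. exact: sqrtr_ge0. Qed.

Lemma hnorm_sqr a b : hnorm a b ^+ 2 = normc a ^+ 2 + normc b ^+ 2.
Proof. by rewrite sqr_sqrtr// addr_ge0 ?sqr_ge0. Qed.

Lemma hnorm_gel a b : normc a <= hnorm a b.
Proof.
rewrite -[leLHS]ger0_norm ?normc_ge0// -sqrtr_sqr ler_sqrt ?lerDl ?addr_ge0 ?sqr_ge0//.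
Qed.

Lemma hnorm_ger a b : normc b <= hnorm a b.
Proof.
rewrite -[leLHS]ger0_norm ?normc_ge0// -sqrtr_sqr ler_sqrt ?lerDr ?addr_ge0 ?sqr_ge0//.
Qed.

Lemma hnorm_gt0 a b : (a != 0) || (b != 0) -> 0 < hnorm a b.
Proof.
case/orP=> h; apply: lt_le_trans; [|exact: hnorm_gel| |exact: hnorm_ger]; by rewrite normc_gt0.
Qed.

Lemma hnorm_le a b : hnorm a b <= normc a + normc b.
Proof.
rewrite -[leRHS]ger0_norm ?addr_ge0 ?normc_ge0// -sqrtr_sqr ler_sqrt ?sqr_ge0//.
by rewrite sqrrD addrAC lerDl mulrn_wge0// mulr_ge0 ?normc_ge0.
Qed.

(* The chordal distance of [a / b] and [p / q] in homogeneous coordinates. *)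
Definition hchord (a b p q : C) : R := normc (a * q - p * b) / (hnorm a b * hnorm p q).

Lemma chordal_sphere_point a b p q : (a != 0) || (b != 0) -> (p != 0) || (q != 0) ->
  chordal (sphere_point a b) (sphere_point p q) = hchord a b p q.
Proof.
have key (x y : C) : y != 0 -> Num.sqrt (1 + normc (x / y) ^+ 2) = hnorm x y / normc y.
  move=> y0; have ny : 0 < normc y by rewrite normc_gt0.
  rewrite -[RHS]ger0_norm ?divr_ge0 ?hnorm_ge0 ?(ltW ny)// -sqrtr_sqr expr_div_n hnorm_sqr.
  by congr Num.sqrt; rewrite normcM normcV; field; rewrite gt_eqF.
have inf (x : C) : hnorm x 0 = normc x.
  by rewrite /hnorm normc0 expr0n/= addr0 sqrtr_sqr ger0_norm ?normc_ge0.
have nn (x y : C) : (x != 0) || (y != 0) -> hnorm x y != 0 by move=> h; rewrite gt_eqF ?hnorm_gt0.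
move=> /[dup] /nn ab0 ab /[dup] /nn pq0 pq; rewrite /sphere_point /hchord.
have [b0|b0] := eqVneq b 0; have [q0|q0] := eqVneq q 0.
- by rewrite b0 q0 !mulr0 subrr normc0 mul0r.
- rewrite b0 eqxx orbF in ab; rewrite /= key// b0 mulr0 subr0 normcM inf invf_div.
  by field; rewrite pq0 normc_eq0 ab.
- rewrite q0 eqxx orbF in pq; rewrite /= key// q0 mulr0 sub0r normcN normcM inf invf_div.
  by field; rewrite ab0 normc_eq0 pq.
- rewrite /= !key// (_ : a / b - p / q = (a * q - p * b) / (b * q)); last by field; rewrite b0 q0.
  rewrite normcM normcV normcM.
  by field; rewrite ab0 pq0 !normc_eq0 b0 q0.
Qed.

(** For the vectors x = (a, b), y = (p, q), z = (c, d) one has det(x, y) |z|^2 = det(x, z) <y, z> +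
    det(z, y) <x, z>; the inner products are bounded by Cauchy-Schwarz. *)
Lemma hchord_triangle a b c d p q : (c != 0) || (d != 0) -> (a != 0) || (b != 0) -> (p != 0) || (q != 0) ->
  hchord a b p q <= hchord a b c d + hchord c d p q.
Proof.
move=> /hnorm_gt0 cd /hnorm_gt0 ab /hnorm_gt0 pq; rewrite /hchord.
have CS (x y u v : C) : normc (x * u^* + y * v^*) <= hnorm x y * hnorm u v.
  have nC (t : C) : normc t^* = normc t by have := normcJ t; rewrite !normr_normc => -[].
  rewrite (le_trans (normcD _ _))// !normcM !nC.
  rewrite -[leLHS]ger0_norm ?addr_ge0 ?mulr_ge0 ?normc_ge0// -sqrtr_sqr /hnorm -sqrtrM ?addr_ge0 ?sqr_ge0//.
  rewrite ler_sqrt ?mulr_ge0 ?addr_ge0 ?sqr_ge0// -subr_ge0.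
  set X := normc x; set Y := normc y; set U := normc u; set V := normc v.
  have -> : (X ^+ 2 + Y ^+ 2) * (U ^+ 2 + V ^+ 2) - (X * U + Y * V) ^+ 2 = (X * V - Y * U) ^+ 2 by ring.
  exact: sqr_ge0.
have nn : c * c^* + d * d^* = (hnorm c d ^+ 2)%:C.
  by rewrite hnorm_sqr rmorphD !rmorphXn /= -!normr_normc !sqr_normc.
have id : (a * q - p * b) * (hnorm c d ^+ 2)%:C = (a * d - c * b) * (p * c^* + q * d^*) + (c * q - p * d) * (a * c^* + b * d^*).
  by rewrite -nn; ring.
have := congr1 (@normc R) id; rewrite normcM normcR ger0_norm ?sqr_ge0// => e.
have : normc (a * q - p * b) * hnorm c d ^+ 2 <= normc (a * d - c * b) * (hnorm p q * hnorm c d) + normc (c * q - p * d) * (hnorm a b * hnorm c d).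
  rewrite e (le_trans (normcD _ _))// !normcM lerD// ler_wpM2l ?normc_ge0//.
clear e id; move: (normc (a * q - p * b)) (normc (a * d - c * b)) (normc (c * q - p * d)) => n1 n2 n3 H.
have -> : n1 / (hnorm a b * hnorm p q) = n1 * hnorm c d ^+ 2 / (hnorm a b * hnorm p q * hnorm c d ^+ 2).
  by field; rewrite !gt_eqF.
rewrite ler_pdivrMr ?mulr_gt0 ?exprn_gt0//; apply: (le_trans H).
rewrite le_eqVlt; apply/orP; left; apply/eqP; field; by rewrite !gt_eqF.
Qed.

(** The determinant of two vectors equals that of the first with their difference, so the norm of
    the first cancels and only the second remains in the denominator. *)
Lemma hchord_sub a b a' b' : (a != 0) || (b != 0) -> (a' != 0) || (b' != 0) ->
  hchord a b a' b' <= (normc (a' - a) + normc (b' - b)) / hnorm a' b'.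
Proof.
move=> /hnorm_gt0 ab /hnorm_gt0 ab'; rewrite /hchord invfM mulrA ler_pM2r ?invr_gt0//.
rewrite ler_pdivrMr// (_ : a * b' - a' * b = a * (b' - b) - (a' - a) * b); last by ring.
rewrite (le_trans (normcB_le _ _))// !normcM mulrDl addrC lerD//.
  by rewrite ler_wpM2l ?normc_ge0// hnorm_ger.
by rewrite mulrC ler_wpM2l ?normc_ge0// hnorm_gel.
Qed.

(* The l-th derivative of [A / B] is [quot_derivn A B l / B ^+ l.+1]. *)
Fixpoint quot_derivn A B l : {poly C} :=
  if l is k.+1 then (quot_derivn A B k)^`() * B - k.+1%:R *: (quot_derivn A B k * B^`()) else A.

Lemma hasD_div_exp N N1 B l z : N1 = N^`() * B - l.+1%:R *: (N * B^`()) -> B.[z] != 0 ->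
  hasD (fun w => N.[w] / B.[w] ^+ l.+1) z (N1.[z] / B.[z] ^+ l.+2).
Proof.
move=> /(congr1 (horner^~ z)); rewrite hornerD hornerN hornerZ !hornerM => e1 Bz.
have Bl : B.[z] ^+ l.+1 != 0 by rewrite expf_neq0.
have HB : hasD (fun w => B.[w] ^+ l.+1) z (B ^+ l.+1)^`().[z].
  by under eq_fun do rewrite -horner_exp; exact: hasD_horner.
have e2 : (B ^+ l.+1)^`().[z] = l.+1%:R * (B^`().[z] * B.[z] ^+ l).
  by rewrite deriv_exp hornerMn hornerM horner_exp mulr_natl.
have H := hasDM (hasD_horner N z) (@hasDV R (fun w => B.[w] ^+ l.+1) z _ Bl HB).
have bl0 : B.[z] ^+ l != 0 by rewrite expf_neq0.
suff <- : N.[z] * (- (B ^+ l.+1)^`().[z] / (B.[z] ^+ l.+1) ^+ 2) + (B.[z] ^+ l.+1)^-1 * N^`().[z] =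
  N1.[z] / B.[z] ^+ l.+2 by [].
rewrite e1 e2 !exprS expr0.
move: (B.[z] ^+ l) bl0 (l.+1%:R : C) (N.[z]) (N^`().[z]) (B^`().[z]) (B.[z]) Bz => b b0 n x y t B0 Bz.
by field; rewrite expf_neq0.
Qed.

Lemma hasD_quot A B l z : B.[z] != 0 ->
  hasD (fun w => (quot_derivn A B l).[w] / B.[w] ^+ l.+1) z
       ((quot_derivn A B l.+1).[z] / B.[z] ^+ l.+2).
Proof. exact: hasD_div_exp. Qed.

Lemma derive1n_quot A B (f : C -> C) l z (e : R) : 0 < e ->
  (forall w, normc (w - z) < e -> B.[w] != 0 /\ f w = A.[w] / B.[w]) ->
  derive1n l f z = (quot_derivn A B l).[z] / B.[z] ^+ l.+1.
Proof.
elim: l z e => [|l IH] z e e0 H.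
  by rewrite derive1n0 (H z _).2 ?subrr ?normc0// expr1.
have zz : normc (z - z) < e by rewrite subrr normc0.
have Bz := (H z zz).1; rewrite derive1nS.
transitivity (derive1 (fun w => (quot_derivn A B l).[w] / B.[w] ^+ l.+1) z); last first.
  exact: hasD_derive1 (hasD_quot A l Bz).
apply: (derive1_near e0) => w we; apply: (IH w (e - normc (w - z))); first by rewrite subr_gt0.
by move=> y yw; apply: H; have := normcBD w y z; norm_lra.
Qed.

End RationalFunctions.

(** * Jacobi polynomials of a rational function *)

Section PadeAlgebra.
Variable R : realType.
Local Notation C := R[i].

Lemma dvdXnP (F : fieldType) (T : {poly F}) k : reflect (forall n, (n < k)%N -> T`_n = 0) ('X^k %| T).
Proof.
apply: (iffP idP) => [/dvdpP[U ->] n nk|H]; first by rewrite coefMXn nk.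
rewrite -(poly_take_drop k T) (_ : take_poly k T = 0) ?add0r ?dvdp_mull//.
by apply/polyP => n; rewrite coef_take_poly coef0; case: ltnP => // /H.
Qed.

Lemma dvdXn_eq0 (F : fieldType) (T : {poly F}) k : 'X^k %| T -> (size T <= k)%N -> T = 0.
Proof.
move=> /dvdXnP H sT; apply/polyP => n; rewrite coef0.
by have [/H//|kn] := ltnP n k; rewrite nth_default// (leq_trans sT).
Qed.

Variables (a : int -> C) (p q : nat).
Hypothesis a_neg : forall n, a (Negz n) = 0.
Variable S : {poly C}.
Hypothesis S_coef : forall n, (n <= p + q)%N -> S`_n = a n.

(* Truncated subtraction on indices is harmless because [a] vanishes at negative integers. *)
Lemma coef_shiftS n k : (n <= p + q)%N -> ('X^k * S)`_n = a (n%:Z - k%:Z).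
Proof.
move=> npq; rewrite coefXnM; case: ltnP => nk.
  by have -> : (n%:Z - k%:Z) = Negz (k - n).-1 by lia.
rewrite S_coef; last by rewrite (leq_trans (leq_subr _ _)).
by congr a; lia.
Qed.

(** Below the first row this is the scalar part of both Jacobi matrices, which therefore share the
    constant cofactors [minor0]. *)
Definition hankel_ext : 'M[C]_q.+1 := \matrix_(i, j) a (p%:Z - q%:Z + i%:Z + j%:Z).
Definition minor0 (j : 'I_q.+1) : C := cofactor hankel_ext ord0 j.

Lemma det_jacobi_mx (r : nat -> {poly C}) :
  \det (jacobi_mx a p q r) = \sum_(j < q.+1) minor0 j *: r j.
Proof.
rewrite (expand_det_row _ ord0); apply: eq_bigr => j _.
rewrite mxE /= mulrC -mul_polyC; congr (_ * _).
rewrite /minor0 /cofactor rmorphM rmorphXn rmorphN1 /=; congr (_ * _).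
rewrite -det_map_mx; congr (\det _); apply/matrixP => i k.
by rewrite !mxE /=.
Qed.

(** Cofactors of the first row paired with another row: an off-diagonal entry of the product with
    the adjugate. *)
Lemma minor0_row (i : 'I_q.+1) : i != ord0 ->
  \sum_(j < q.+1) minor0 j * a (p%:Z - q%:Z + i%:Z + j%:Z) = 0.
Proof.
move=> i0; have /matrixP/(_ i ord0) := mul_mx_adj hankel_ext.
rewrite !mxE (negPf i0) mulr0n => H; rewrite -[RHS]H; apply: eq_bigr => j _.
by rewrite !mxE mulrC.
Qed.

(** The expansion point is first 0, where orders of vanishing are read off coefficients;
    [shift_jacobi] later moves the result to [zeta]. *)
Let zeta0 : C := 0.
Let A := jacobi_num a zeta0 p q.
Let B := jacobi_den a zeta0 p q.

Lemma subX0 : ('X - zeta0%:P) = 'X :> {poly C}. Proof. by rewrite subr0. Qed.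

Lemma partial_sum0_coef (k : int) n : (partial_sum a zeta0 k)`_n = if (n%:Z <= k)%R then a n else 0.
Proof.
case: k => m /=; last by rewrite coef0.
rewrite subX0 coef_sum.
have [nm|nm] := ltnP n m.+1.
  rewrite (bigD1 (Ordinal nm)) //= coefZ coefXn eqxx mulr1 big1 ?addr0.
    by rewrite lez_nat -ltnS nm.
  move=> i /eqP ni; rewrite coefZ coefXn; case: eqP => [e|]; last by rewrite mulr0.
  by case: ni; apply: val_inj.
rewrite lez_nat leqNgt nm /= big1// => i _; rewrite coefZ coefXn.
by rewrite gtn_eqF ?mulr0// (leq_trans (ltn_ord i)).
Qed.

Lemma jacobi_den0E : B = \sum_(j < q.+1) minor0 j *: 'X^(q - j).
Proof. by rewrite /B /jacobi_den subX0 det_jacobi_mx. Qed.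

Lemma jacobi_num0E : A = \sum_(j < q.+1) minor0 j *: ('X^(q - j) * partial_sum a zeta0 (p%:Z - q%:Z + j%:Z)).
Proof. by rewrite /A /jacobi_num subX0 det_jacobi_mx. Qed.

Lemma size_jacobi_den0 : (size B <= q.+1)%N.
Proof.
rewrite jacobi_den0E; apply: (leq_trans (size_sum _ _ _)); apply/bigmax_leqP => j _.
by rewrite (leq_trans (size_scale_leq _ _))// size_polyXn ltnS leq_subr.
Qed.

Lemma jacobi_num0_coef n : A`_n = if (n <= p)%N then \sum_(j < q.+1) minor0 j * a (n%:Z - (q - j)%N%:Z) else 0.
Proof.
rewrite jacobi_num0E coef_sum.
have key (j : 'I_q.+1) : (minor0 j *: ('X^(q - j) * partial_sum a zeta0 (p%:Z - q%:Z + j%:Z)))`_n =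
   if (n <= p)%N then minor0 j * a (n%:Z - (q - j)%N%:Z) else 0.
  have jq : (j <= q)%N by rewrite -ltnS ltn_ord.
  rewrite coefZ coefXnM partial_sum0_coef; case: ltnP => nk.
    have -> : (n%:Z - (q - j)%N%:Z) = Negz ((q - j) - n).-1 by lia.
    by rewrite a_neg mulr0 if_same.
  have -> : ((n - (q - j))%N%:Z <= p%:Z - q%:Z + j%:Z)%R = (n <= p)%N by lia.
  case: ifP => _; rewrite ?mulr0//.
  by congr (_ * a _); lia.
under eq_bigr do rewrite key.
by case: ifP => // _; rewrite big1.
Qed.

Lemma size_jacobi_num0 : (size A <= p.+1)%N.
Proof. by apply/leq_sizeP => n pn; rewrite jacobi_num0_coef leqNgt pn. Qed.

(** Up to order [p] the coefficients of [B * S] are those of [A]; those of order [p + 1] to [p + q]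
    are expansions along the wrong row [n - p] and vanish by [minor0_row]. *)
Lemma jacobi_approx : 'X^((p + q).+1) %| B * S - A.
Proof.
apply/dvdXnP => n; rewrite ltnS => npq; rewrite coefB jacobi_num0_coef.
have -> : (B * S)`_n = \sum_(j < q.+1) minor0 j * a (n%:Z - (q - j)%N%:Z).
  rewrite jacobi_den0E mulr_suml coef_sum; apply: eq_bigr => j _.
  by rewrite -scalerAl coefZ coef_shiftS.
case: leqP => np; first by rewrite subrr.
have iq : (n - p < q.+1)%N by lia.
rewrite subr0 -[RHS](@minor0_row (Ordinal iq)); last by rewrite -val_eqE /=; lia.
apply: eq_bigr => j _; have jq : (j <= q)%N by rewrite -ltnS ltn_ord.
by congr (_ * a _) => /=; lia.
Qed.

Lemma jacobi_den0_eval : B.[0] = (-1) ^+ q * \det (hankel a p q).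
Proof.
rewrite horner_coef0 jacobi_den0E coef_sum (bigD1 ord_max)//= subnn coefZ coefXn eqxx mulr1.
rewrite big1 ?addr0; last first.
  move=> j jm; rewrite coefZ coefXn; have : (j < q)%N.
    by rewrite ltn_neqAle -ltnS ltn_ord andbT; apply: contra jm => /eqP e; apply/eqP/val_inj.
  by case: (q - j)%N (subn_gt0 j q) => [|k _ _]; [move=> <-|rewrite mulr0].
rewrite /minor0 /cofactor add0n; congr (_ * \det _); apply/matrixP => i j.
rewrite !mxE; congr a; rewrite /= /bump leq0n.
have -> : (q <= j)%N = false by apply/negbTE; rewrite -ltnNge.
lia.
Qed.

Variables P Q : {poly C}.
Hypothesis sP : size P = p.+1.
Hypothesis sQ : (size Q <= q.+1)%N.
Hypothesis Q0 : Q.[0] != 0.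
Hypothesis cPQ : coprimep P Q.
Hypothesis QS : 'X^((p + q).+1) %| Q * S - P.

(** A left kernel vector [v] gives a polynomial [b] of degree below [q] with [b * S = al] modulo
    ['X^(p + q)] and [al] of degree below [p]. Comparison with [Q * S = P] yields [b * P = Q * al]
    exactly, by degrees. Then [P], of degree exactly [p], divides [al], so [al], [b] and [v]
    vanish. *)
Lemma hankel_neq0 : \det (hankel a p q) != 0.
Proof.
apply/negP => /det0P[v v0 vH].
have q0 : (0 < q)%N by case: (q) v v0 vH => // v; rewrite thinmx0 eqxx.
pose b : {poly C} := \sum_(i < q) v ord0 i *: 'X^(q.-1 - i).
have bS n : (n <= p + q)%N -> (b * S)`_n = \sum_(i < q) v ord0 i * a (n%:Z - (q.-1 - i)%N%:Z).
  move=> npq; rewrite /b mulr_suml coef_sum; apply: eq_bigr => i _.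
  by rewrite -scalerAl coefZ coef_shiftS.
have sb : (size b <= q)%N.
  apply: (leq_trans (size_sum _ _ _)); apply/bigmax_leqP => j _.
  rewrite (leq_trans (size_scale_leq _ _))// size_polyXn; have := ltn_ord j; lia.
pose al := take_poly p (b * S).
have dal : 'X^(p + q) %| b * S - al.
  apply/dvdXnP => n npq; rewrite coefB coef_take_poly; case: ltnP => np; first by rewrite subrr.
  rewrite subr0 bS ?(ltnW npq)//.
  have jq : (n - p < q)%N by lia.
  have /matrixP/(_ ord0 (Ordinal jq)) := vH; rewrite !mxE => H; rewrite -[RHS]H; apply: eq_bigr => i _.
  by rewrite !mxE /=; congr (_ * a _); have := ltn_ord i; lia.
have E : b * P = Q * al.
  apply/eqP; rewrite -subr_eq0; apply/eqP/(@dvdXn_eq0 _ _ (p + q)).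
    have -> : b * P - Q * al = Q * (b * S - al) - b * (Q * S - P) by ring.
    rewrite dvdp_sub ?dvdp_mull//; apply: dvdp_trans QS.
    by rewrite dvdp_exp2l.
  rewrite (leq_trans (size_polyD _ _))// size_polyN geq_max.
  have s1 := size_polyMleq b P; have s2 := size_polyMleq Q al.
  have s3 : (size al <= p)%N by rewrite size_take_poly.
  rewrite sP in s1; apply/andP; split; [apply: (leq_trans s1)|apply: (leq_trans s2)]; move: sb s3 sQ; lia.
have al0 : al = 0.
  apply/eqP; apply: contraT => aln0.
  have Pal : P %| al by rewrite -(Gauss_dvdpr _ cPQ) -E dvdp_mull.
  have := dvdp_leq aln0 Pal; rewrite sP.
  have s3 : (size al <= p)%N by rewrite size_take_poly.
  by rewrite leqNgt ltnS s3.
have b0 : b = 0.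
  move/eqP: E; rewrite al0 mulr0 mulf_eq0 => /orP[/eqP//|/eqP P0].
  by move: sP; rewrite P0 size_poly0.
move/negP: v0; apply; apply/eqP/rowP => i; rewrite mxE.
have := congr1 (fun t : {poly C} => t`_(q.-1 - i)) b0; rewrite /b coef_sum coef0.
rewrite (bigD1 i)//= coefZ coefXn eqxx mulr1 big1 ?addr0// => j ji.
rewrite coefZ coefXn; case: eqP => [e|]; rewrite ?mulr0//.
case/eqP: ji; apply: val_inj; move: (ltn_ord i) (ltn_ord j) e => /=; lia.
Qed.

(** [B * P = A * Q] because a power of 'X beyond its degree divides the difference. Coprimality
    gives [A = U * P], and as [P] already has the maximal degree, [U] is constant. *)
Lemma jacobi0_exact : exists2 k : C, k != 0 & A = k *: P /\ B = k *: Q.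
Proof.
have P0 : P != 0 by rewrite -size_poly_eq0 sP.
have E : B * P = A * Q.
  apply/eqP; rewrite -subr_eq0; apply/eqP/(@dvdXn_eq0 _ _ (p + q).+1).
    have -> : B * P - A * Q = Q * (B * S - A) - B * (Q * S - P) by ring.
    by rewrite dvdp_sub ?dvdp_mull// jacobi_approx.
  rewrite (leq_trans (size_polyD _ _))// size_polyN geq_max.
  have s1 := size_polyMleq B P; have s2 := size_polyMleq A Q.
  have := size_jacobi_num0; have := size_jacobi_den0; rewrite sP in s1 => h1 h2.
  by apply/andP; split; [apply: (leq_trans s1)|apply: (leq_trans s2)]; move: h1 h2 sQ; lia.
have B0 : B != 0.
  apply/eqP => e; have := jacobi_den0_eval; rewrite e horner0 => /esym/eqP.
  by rewrite mulf_eq0 signr_eq0 (negPf hankel_neq0).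
have /dvdpP[U AU] : P %| A by rewrite -(Gauss_dvdpl _ cPQ) -E dvdp_mull.
have BU : B = U * Q.
  by apply: (mulIf P0); rewrite E AU; ring.
have U0 : U != 0 by apply: contraNneq B0 => e; rewrite BU e mul0r.
have sU : size U = 1%N.
  have := size_jacobi_num0; rewrite AU size_mul// sP.
  have : (0 < size U)%N by rewrite size_poly_gt0.
  by move: (size U) => s; lia.
move/eqP: sU => /size_poly1P[k k0 Uk].
by exists k => //; rewrite AU BU Uk !mul_polyC.
Qed.

End PadeAlgebra.

Section PadeShift.
Variable R : realType.
Local Notation C := R[i].
Implicit Types (P Q S A B : {poly C}) (zeta : C).

Lemma derive1n_horner S n : derive1n n (horner S) = horner S^`(n).
Proof.
elim: n => [//|n IH]; rewrite derive1nS IH derivnS; apply/funext => z.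
exact: hasD_derive1 (hasD_horner _ _).
Qed.

Lemma quot_derivnB A A' B l : quot_derivn (A - A') B l = quot_derivn A B l - quot_derivn A' B l.
Proof.
elim: l => [//|l IH] /=; rewrite IH derivB !mulrBl scalerBr; ring.
Qed.

(** Each differentiation costs one order of vanishing at [zeta]. *)
Lemma quot_derivn_dvd A B zeta M l : ('X - zeta%:P) ^+ (M + l) %| A ->
  ('X - zeta%:P) ^+ M %| quot_derivn A B l.
Proof.
elim: l M => [|l IH] M; first by rewrite addn0.
rewrite addnS -addSn => /IH /dvdpP[U HU] /=; rewrite HU.
rewrite dvdp_sub//.
  rewrite derivM deriv_exp derivXsubC mul1r /= mulrDl dvdp_add//.
    by rewrite exprS; apply/dvdpP; exists (U^`() * ('X - zeta%:P) * B); ring.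
  by apply/dvdpP; exists (U * B *+ M.+1); rewrite mulrnAr; ring.
rewrite dvdpZr ?pnatr_eq0// exprS.
by apply/dvdpP; exists (U * ('X - zeta%:P) * B^`()); ring.
Qed.

(** An algebraic identity obtained analytically: [Q * S / Q] and [S] agree near [zeta], hence so do
    their derivatives there. *)
Lemma quot_derivn_mul S Q zeta n : Q.[zeta] != 0 ->
  (quot_derivn (Q * S) Q n).[zeta] / Q.[zeta] ^+ n.+1 = S^`(n).[zeta].
Proof.
move=> Q0; rewrite -derive1n_horner.
have n0 : 0 < normc Q.[zeta] by rewrite normc_gt0.
have [r r0 Hr] := hasD_continuous (hasD_horner Q zeta) n0.
apply/esym/(@derive1n_quot _ _ _ _ n zeta r) => // w wr.
have Qw : Q.[w] != 0.
  apply/eqP => e; have := Hr w wr; rewrite e sub0r normcN ltxx//.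
by split=> //; rewrite hornerM mulrAC mulfV ?mul1r.
Qed.

Lemma coef_comp_shift S zeta n :
  (S \Po ('X + zeta%:P))`_n = S^`(n).[zeta] / (n`!)%:R.
Proof.
have fn : (n`!)%:R != 0 :> C by rewrite pnatr_eq0 -lt0n fact_gt0.
apply: (canRL (mulfK fn)); rewrite mulr_natr.
have -> : S^`(n).[zeta] = (S \Po ('X + zeta%:P))^`(n).[0].
  elim: n {fn} S => [|n IH] S.
    by rewrite !derivn0 horner_comp !hornerE.
  by rewrite !derivSn IH deriv_comp derivD derivX derivC addr0 mulr1.
by rewrite horner_coef0 coef_derivn addn0 ffactnn.
Qed.

(** [S = U * P], where [U] inverts [Q] modulo [('X - zeta%:P) ^+ M] by Bezout: a polynomial
    substitute for the Taylor series of [P / Q]. *)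
Lemma taylor_quot P Q zeta M : Q.[zeta] != 0 -> exists S,
  ('X - zeta%:P) ^+ M %| Q * S - P /\
  forall n, (n < M)%N -> (S \Po ('X + zeta%:P))`_n =
     (quot_derivn P Q n).[zeta] / Q.[zeta] ^+ n.+1 / (n`!)%:R.
Proof.
move=> Q0; have cop : coprimep Q (('X - zeta%:P) ^+ M).
  by rewrite coprimep_expr// coprimep_XsubC /root.
have [[U V] /= UV] := Bezout_eq1_coprimepP _ _ cop.
have dv : ('X - zeta%:P) ^+ M %| Q * (U * P) - P.
  apply/dvdpP; exists (- P * V).
  rewrite -[X in _ - X]mul1r -UV; ring.
exists (U * P); split=> // n nM; rewrite coef_comp_shift -(quot_derivn_mul _ _ Q0).
congr (_ / _ / _).
have : ('X - zeta%:P) ^+ 1 %| quot_derivn (Q * (U * P) - P) Q n.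
  by apply: quot_derivn_dvd; apply: dvdp_trans dv; rewrite dvdp_exp2l.
rewrite expr1 dvdp_XsubCl quot_derivnB => /rootP; rewrite hornerD hornerN => /eqP.
by rewrite subr_eq0 => /eqP.
Qed.

(** Substitution of ['X + zeta%:P] is a ring morphism and commutes with determinants. *)
Lemma shift_jacobi (a : int -> C) zeta p q :
  jacobi_num a zeta p q \Po ('X + zeta%:P) = jacobi_num a 0 p q /\
  jacobi_den a zeta p q \Po ('X + zeta%:P) = jacobi_den a 0 p q.
Proof.
have X0 : ('X - zeta%:P) \Po ('X + zeta%:P) = 'X - 0%:P.
  by rewrite comp_polyB comp_polyX comp_polyC addrK subr0.
have psE k : partial_sum a zeta k \Po ('X + zeta%:P) = partial_sum a 0 k.
  case: k => m /=; last by rewrite comp_poly0.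
  rewrite raddf_sum; apply: eq_bigr => i _.
  by rewrite /= comp_polyZ rmorphXn /= X0.
split; rewrite -[LHS]/(comp_poly _ _) -det_map_mx /jacobi_num /jacobi_den.
all: congr (\det _); apply/matrixP => i j; rewrite !mxE; case: ifP => _.
- by rewrite rmorphM rmorphXn /= X0 psE.
- by rewrite /= comp_polyC.
- by rewrite rmorphXn /= X0.
- by rewrite /= comp_polyC.
Qed.

Lemma comp_shiftK zeta (T : {poly C}) : (T \Po ('X + zeta%:P)) \Po ('X - zeta%:P) = T.
Proof. by rewrite -comp_polyA comp_polyD comp_polyX comp_polyC subrK comp_polyXr. Qed.

Lemma pade_exact (a : int -> C) p q zeta P Q :
  (forall n, a (Negz n) = 0) -> size P = p.+1 -> (size Q <= q.+1)%N ->
  Q.[zeta] != 0 -> coprimep P Q ->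
  (forall n : nat, a n = (quot_derivn P Q n).[zeta] / Q.[zeta] ^+ n.+1 / (n`!)%:R) ->
  \det (hankel a p q) != 0 /\ exists2 k : C, k != 0 &
    jacobi_num a zeta p q = k *: P /\ jacobi_den a zeta p q = k *: Q.
Proof.
move=> aneg sP sQ Q0 cop aE.
have [S [dS HS]] := taylor_quot P (p + q).+1 Q0.
pose sh (T : {poly C}) := T \Po ('X + zeta%:P).
have sz T : size (sh T) = size T by rewrite size_comp_poly2// size_XaddC.
have S1 n : (n <= p + q)%N -> (sh S)`_n = a n by move=> npq; rewrite /sh HS// aE.
have P1 : size (sh P) = p.+1 by rewrite sz.
have Q1 : (size (sh Q) <= q.+1)%N by rewrite sz.
have Q2 : (sh Q).[0] != 0 by rewrite horner_comp !hornerE.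
have cop1 : coprimep (sh P) (sh Q) by exact: coprimep_comp_poly.
have dS1 : 'X^((p + q).+1) %| sh Q * sh S - sh P.
  have /dvdpP[T HT] := dS; apply/dvdpP; exists (sh T).
  rewrite /sh -rmorphM -rmorphB HT rmorphM rmorphXn /=.
  by rewrite comp_polyB comp_polyX comp_polyC addrK.
split; first exact: (hankel_neq0 aneg S1 P1 Q1 Q2 cop1 dS1).
have [k k0 [nE dE]] := jacobi0_exact aneg S1 P1 Q1 Q2 cop1 dS1.
exists k => //; have [n1 d1] := shift_jacobi a zeta p q.
split; rewrite -[LHS](comp_shiftK zeta) ?n1 ?d1 ?nE ?dE /sh comp_polyZ comp_shiftK//.
Qed.

Lemma jacobi_den_eval (a : int -> C) zeta p q : (forall n, a (Negz n) = 0) ->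
  (jacobi_den a zeta p q).[zeta] = (-1) ^+ q * \det (hankel a p q).
Proof.
move=> aneg; rewrite -(@jacobi_den0_eval _ a p q).
have [_ <-] := shift_jacobi a zeta p q.
by rewrite horner_comp !hornerE.
Qed.

End PadeShift.

(** * Simultaneous rational approximation *)

Section QuotientElements.
Variables (R : realType) (Omega : set R[i]).
Hypothesis oOmega : open Omega.
Local Notation C := R[i].
Local Notation E := (closure Omega).
Local Notation ext := (ext_deriv Omega).
Local Notation rational := (@rational_Ainf R Omega).
Implicit Types (P Q : {poly C}) (z w : C).

Lemma horner_neq0_near Q z : Q.[z] != 0 ->
  exists2 r : R, 0 < r & forall w, normc (w - z) < r -> Q.[w] != 0.
Proof.
move=> Qz; have n0 : 0 < normc Q.[z] by rewrite normc_gt0.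
have [r r0 Hr] := hasD_continuous (hasD_horner Q z) n0.
exists r => // w wr; apply/eqP => e; have := Hr w wr.
by rewrite e sub0r normcN ltxx.
Qed.

Lemma derive1n_quot_Omega P Q (F : C -> C) : (forall z, E z -> Q.[z] != 0) ->
  (forall z, Omega z -> F z = P.[z] / Q.[z]) ->
  forall l z, Omega z -> derive1n l F z = (quot_derivn P Q l).[z] / Q.[z] ^+ l.+1.
Proof.
move=> Q0 FE l z Oz; have [r r0 Hr] := open_disc oOmega Oz.
apply: (derive1n_quot l r0) => w /ltW/Hr Ow.
by split; [apply/Q0/subset_closure|exact: FE].
Qed.

Lemma ext_quot P Q (F : C -> C) : (forall z, E z -> Q.[z] != 0) ->
  (forall z, Omega z -> F z = P.[z] / Q.[z]) ->
  forall l z, E z -> ext F l z = (quot_derivn P Q l).[z] / Q.[z] ^+ l.+1.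
Proof.
move=> Q0 FE l z Ez; apply: ext_unique => // e e0.
have [r r0 Hr] := hasD_continuous (hasD_quot P l (Q0 z Ez)) e0.
exists r => // w Ow wr.
have -> : (derive1n l F w : C) = (quot_derivn P Q l).[w] / Q.[w] ^+ l.+1 :=
  derive1n_quot_Omega Q0 FE l Ow.
exact: Hr.
Qed.

Lemma Ainf_of_quot P Q : Q != 0 -> (forall z, E z -> Q.[z] != 0) ->
  exists2 f : Ainf Omega, rational f & forall z, Omega z -> f z = P.[z] / Q.[z].
Proof.
move=> Qn0 Q0; pose F z : C := if `[< Omega z >] then P.[z] / Q.[z] else 0.
have FE z : Omega z -> F z = P.[z] / Q.[z] by move=> Oz; rewrite /F asboolT.
have F1 z : Omega z -> derivable F z 1.
  move=> Oz; have [r r0 Hr] := open_disc oOmega Oz.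
  have H := hasD_quot P 0 (Q0 z (subset_closure Oz)).
  apply: hasD_derivable (hasD_near r0 _ H) => w /ltW/Hr Ow.
  by rewrite FE// expr1.
have F2 l : exists2 g : C -> C, {within E, continuous g} & forall z, Omega z -> g z = derive1n l F z.
  exists (fun z => (quot_derivn P Q l).[z] / Q.[z] ^+ l.+1); last first.
    by move=> z Oz; rewrite (derive1n_quot_Omega Q0 FE).
  apply/subspace_continuousP => z Ez; apply/cvg_normcP => e e0; apply/within_normcP.
  have [r r0 Hr] := hasD_continuous (hasD_quot P l (Q0 z Ez)) e0.
  by exists r => // w wr _; exact: Hr.
have F3 z : ~ Omega z -> F z = 0 by move=> nO; rewrite /F asboolF.
exists (MkAinf F1 F2 F3); last exact: FE.
exists (tofrac P / tofrac Q); split=> z zE.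
  by rewrite rat_eval_frac ?Q0 ?orbT// /sphere_point (negPf (Q0 z zE)).
have Qz := Q0 z (subset_closure zE).
by rewrite rat_eval_frac ?Qz ?orbT// /sphere_point (negPf Qz) /= FE.
Qed.

Lemma rational_quot (f : Ainf Omega) : rational f -> exists P Q : {poly C},
  [/\ Q != 0, forall z, E z -> Q.[z] != 0 & forall z, Omega z -> f z = P.[z] / Q.[z]].
Proof.
move=> [r [r1 r2]]; exists (rat_num r), (rat_den r); have [d0 _ _] := rat_numdenP r.
have E0 z : E z -> (rat_den r).[z] != 0.
  by move=> /r1; rewrite rat_evalE /sphere_point; case: eqP.
split=> // z Oz; have := r2 z Oz; rewrite rat_evalE /sphere_point.
by rewrite (negPf (E0 z (subset_closure Oz))) => -[].
Qed.

Lemma Xinf_of_rational (f : Ainf Omega) : rational f -> exists h : Xinf Omega, val h = f.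
Proof.
by move=> rf; have cf : f \in closure rational; [exact/mem_set/subset_closure|exists (SigSub cf)].
Qed.

(** Cauchy's estimate for the difference. The disc need not lie in [Omega], so [z] may be a boundary
    point. *)
Lemma quot_diff_estimate P Q P0 Q0 z (eta e : R) l : 0 < eta ->
  (forall w, normc (w - z) <= eta -> [/\ Q.[w] != 0, Q0.[w] != 0 &
     normc (P.[w] / Q.[w] - P0.[w] / Q0.[w]) <= e]) ->
  normc ((quot_derivn P Q l).[z] / Q.[z] ^+ l.+1 - (quot_derivn P0 Q0 l).[z] / Q0.[z] ^+ l.+1)
    <= e * eta * (l`!)%:R * (2 / eta) ^+ l.+1.
Proof.
move=> eta0 H.
pose D k w : C := (quot_derivn P Q k).[w] / Q.[w] ^+ k.+1 - (quot_derivn P0 Q0 k).[w] / Q0.[w] ^+ k.+1.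
have HD k w : normc (w - z) <= eta -> hasD (D k) w (D k.+1 w).
  by move=> /H[q1 q2 _]; apply: hasDB; exact: hasD_quot.
have DE k w : normc (w - z) < eta -> derive1n k (D 0) w = D k w.
  elim: k w => [//|k IH] w wz; rewrite derive1nS.
  rewrite -(hasD_derive1 (HD k w (ltW wz))).
  apply: (@derive1_near _ _ _ _ (eta - normc (w - z))); first by rewrite subr_gt0.
  by move=> y yw; apply: IH; have := normcBD w y z; norm_lra.
have zz : normc (z - z) < eta / 2 by rewrite subrr normc0 divr_gt0.
have zz' : normc (z - z) < eta by rewrite subrr normc0.
rewrite -/(D l z) -(DE l z zz').
apply: (@cauchy_estimate R (D 0) (D 1) z eta) => //.
- exact: HD.
- move=> w wz e' e'0; have [r r0 Hr] := hasD_continuous (HD 1 w wz) e'0.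
  by exists r => // y _; exact: Hr.
- by move=> w /H[_ _]; rewrite /D !expr1.
Qed.

End QuotientElements.

(** * Roots in a set and removal of poles *)

Section PolynomialRoots.
Variable R : realType.
Local Notation C := R[i].
Implicit Types (P Q U W : {poly C}) (S : set C) (z w b : C).

Lemma split_roots Q S : Q != 0 -> exists Qa (s : seq C),
  [/\ Q = Qa * \prod_(b <- s) ('X - b%:P), forall b, b \in s -> S b /\ root Q b &
      forall z, S z -> Qa.[z] != 0].
Proof.
move=> Q0; have [r Qr] := closed_field_poly_normal Q.
pose inS (b : C) := `[< S b >].
exists (lead_coef Q *: \prod_(b <- r | ~~ inS b) ('X - b%:P)), [seq b <- r | inS b]; split.
- by rewrite big_filter [in LHS]Qr -scalerAl mulrC (bigID inS).
- move=> b; rewrite mem_filter => /andP[/asboolP Sb br]; split=> //.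
  by rewrite Qr rootZ ?lead_coef_eq0// root_prod_XsubC.
- move=> z Sz; rewrite hornerZ mulf_neq0 ?lead_coef_eq0// horner_prod.
  rewrite prodf_seq_neq0; apply/allP => b br; apply/implyP => nb.
  rewrite !hornerE subr_eq0; apply: contraNneq nb => <-; exact/asboolP.
Qed.

(** [S] may be unbounded: the uniform distance comes from the finiteness of the set of roots. *)
Lemma root_free_near Q S : Q != 0 -> closed S -> (forall z, S z -> Q.[z] != 0) ->
  exists2 t : R, 0 < t & forall z y, S y -> normc (z - y) <= t -> Q.[z] != 0.
Proof.
move=> Q0 cS SQ; have [r Qr] := closed_field_poly_normal Q.
have : forall b, b \in r -> ~ S b.
  move=> b br /SQ; rewrite Qr hornerZ mulf_eq0 negb_or => /andP[_] /negP; apply.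
  by rewrite -rootE root_prod_XsubC.
suff H : (forall b, b \in r -> ~ S b) -> exists2 t : R, 0 < t &
    forall z y, S y -> normc (z - y) <= t -> z \notin r.
  move=> /H[t t0 Ht]; exists t => // z y Sy zy.
  rewrite Qr hornerZ mulf_neq0 ?lead_coef_eq0// -rootE root_prod_XsubC.
  exact: Ht zy.
elim: r {Qr} => [|b r IH] H; first by exists 1.
have [|t t0 Ht] := IH; first by move=> c cr; apply: H; rewrite inE cr orbT.
have [d d0 Hd] := closed_normcP cS (H b (mem_head _ _)).
exists (Num.min t (d / 2)); first by rewrite lt_min t0 divr_gt0.
move=> z y Sy; rewrite le_min => /andP[zt zd]; rewrite inE negb_or (Ht z y)// andbT.
apply/eqP => e; have := Hd y Sy; rewrite -e normcB; lra.
Qed.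

Lemma quot_bounded P Q S : compact S -> (forall z, S z -> Q.[z] != 0) ->
  exists2 M : R, 0 < M & forall z, S z -> normc (P.[z] / Q.[z]) <= M.
Proof.
move=> cS SQ; have [|e e0 He] := @compact_uniform R S (fun e z => normc (P.[z] / Q.[z]) <= e^-1) cS.
  move=> x Sx; have HD := hasD_quot P 0 (SQ x Sx).
  pose f w := (quot_derivn P Q 0).[w] / Q.[w] ^+ 1.
  have [r r0 Hr] := @hasD_continuous R f x _ HD 1 ltr01.
  pose a := normc (f x) + 1.
  have a0 : 0 < a by rewrite ltr_wpDl ?normc_ge0.
  exists (Num.min r a^-1); first by rewrite lt_min r0 invr_gt0.
  move=> w e; rewrite lt_min => /andP[w1 _] /andP[e0]; rewrite lt_min => /andP[_ e1] _.
  apply: (@le_trans _ _ a); last by rewrite -[leLHS]invrK lef_pV2 ?posrE ?invr_gt0// ltW.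
  have -> : P.[w] / Q.[w] = f w by rewrite /f expr1.
  have := normc_le_add (f x) (f w); have := Hr w w1; rewrite /a; norm_lra.
by exists e^-1; rewrite ?invr_gt0.
Qed.

(** The tolerance depends only on the number of factors, so it can be fixed before the indicator
    from which the factors are built. *)
Lemma prod_near1 (m : nat) (e : R) : 0 < e -> exists2 d : R, 0 < d &
  forall s : seq C, (size s <= m)%N -> (forall x, x \in s -> normc (x - 1) <= d) ->
    normc (\prod_(x <- s) x - 1) <= e.
Proof.
elim: m e => [|m IH] e e0.
  by exists 1 => // -[|//] _ _; rewrite big_nil subrr normc0 ltW.
have e'0 : 0 < Num.min (e / 2) 1 by rewrite lt_min ltr01 divr_gt0.
have [d d0 Hd] := IH _ e'0.
exists (Num.min d (e / 4)); first by rewrite lt_min d0 divr_gt0.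
move=> [|x s] ss Hs; first by rewrite big_nil subrr normc0 ltW.
have Hx : normc (x - 1) <= e / 4.
  by apply: (le_trans (Hs x (mem_head _ _))); rewrite ge_min lexx orbT.
have Hr : normc (\prod_(y <- s) y - 1) <= Num.min (e / 2) 1.
  apply: Hd => // y ys; have yxs : y \in x :: s by rewrite inE ys orbT.
  by apply: (le_trans (Hs y yxs)); rewrite ge_min lexx.
move: Hr; rewrite le_min => /andP[h1 h2]; rewrite big_cons.
set p := \prod_(y <- s) y in h1 h2 *.
have np : normc p <= 2 by have := normc_le_add 1 p; rewrite normc1; lra.
rewrite (_ : x * p - 1 = (x - 1) * p + (p - 1)); last by ring.
have := normcD ((x - 1) * p) (p - 1); rewrite normcM.
have : normc (x - 1) * normc p <= e / 4 * 2 by apply: ler_pM; rewrite ?normc_ge0.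
move: (normc (x - 1) * normc p) (normc (_ + _)) (normc (p - 1)) h1 => a b c; lra.
Qed.

(* [U_b / W] is the difference quotient [(e z - e b) / (z - b)] of [e = U / W], as a
   rational function without a pole at [b]. *)
Lemma diff_quot_poly U W b : W.[b] != 0 -> exists Ub : {poly C},
  U - (U.[b] / W.[b]) *: W = ('X - b%:P) * Ub.
Proof.
move=> Wb; have : root (U - (U.[b] / W.[b]) *: W) b.
  by rewrite /root hornerD hornerN hornerZ divfK// subrr.
by rewrite -dvdp_XsubCl => /dvdpP[Ub ->]; exists Ub; rewrite mulrC.
Qed.

(** At distance at least [eta] from [b], a numerator of size at most [2 * d] is divided by at least
    [eta]. Closer, Cauchy's estimate on the disc of radius [2 * eta] bounds the derivative of
    [U / W] by [2 * d / eta], and the mean value inequality applies; at [b] the quotient is this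
    derivative. *)
Lemma diff_quot_le U W Ub b z (c : C) (eta d : R) : 0 < eta ->
  U - (U.[b] / W.[b]) *: W = ('X - b%:P) * Ub ->
  (forall w, normc (w - b) <= 2 * eta -> W.[w] != 0 /\ normc (U.[w] / W.[w] - c) <= d) ->
  W.[z] != 0 -> normc (U.[z] / W.[z] - c) <= d ->
  normc (Ub.[z] / W.[z]) <= 4 * d / eta.
Proof.
move=> eta0 UbE H Wz Hz.
have bb : normc (b - b) <= 2 * eta by rewrite subrr normc0 mulr_ge0 ?ltW.
have [Wb Hb] := H b bb.
have d0 : 0 <= d := le_trans (normc_ge0 _) Hb.
have key w : W.[w] != 0 -> U.[w] / W.[w] - U.[b] / W.[b] = (w - b) * (Ub.[w] / W.[w]).
  move=> Ww; have := congr1 (horner^~ w) UbE; rewrite /= hornerM hornerD hornerN hornerZ hornerXsubC => e1.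
  by rewrite [RHS]mulrA -e1; field; rewrite Ww Wb.
pose f w : C := U.[w] / W.[w] - c.
pose df w : C := (quot_derivn U W 1).[w] / W.[w] ^+ 2.
have fD w : normc (w - b) <= 2 * eta -> hasD f w (df w).
  move=> /H[Ww _]; have := hasDB (hasD_quot U 0 Ww) (hasD_cst c w); rewrite subr0.
  by congr hasD; apply/funext => y; rewrite expr1.
have eta20 : 0 < 2 * eta by rewrite mulr_gt0.
have dfb w : normc (w - b) < eta -> normc (df w) <= 2 * d / eta.
  move=> wb; have wb2 : normc (w - b) <= 2 * eta by lra.
  have dfC y : normc (y - b) <= 2 * eta -> forall e : R, 0 < e ->
    exists2 r : R, 0 < r & forall x, normc (x - b) <= 2 * eta -> normc (x - y) < r ->
      normc (df x - df y) < e.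
    move=> /H[Wy _] e e0; have [r r0 Hr] := @hasD_continuous R df y _ (hasD_quot U 1 Wy) e e0.
    by exists r => // x _; exact: Hr.
  have wb' : normc (w - b) < 2 * eta / 2 by rewrite (mulrC 2 eta) mulfK.
  have := @cauchy_estimate R f df b (2 * eta) eta20 fD dfC 1 w d wb' (fun y yb => (H y yb).2).
  have -> : (derive1n 1 f w : C) = df w by rewrite derive1n1; exact: hasD_derive1 (fD w wb2).
  have -> : d * (2 * eta) * 1`!%:R * (2 / (2 * eta)) ^+ 2 = 2 * d / eta.
    by rewrite (_ : (1`!)%:R = 1 :> R)//; field; rewrite gt_eqF.
  by [].
have [zb|zb] := ltP (normc (z - b)) eta; last first.
  have zb0 : 0 < normc (z - b) by exact: lt_le_trans zb.
  have e1 := congr1 (@normc R) (key z Wz); rewrite normcM in e1.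
  rewrite -(ler_pM2l zb0) -e1.
  have Hb' : normc (c - U.[b] / W.[b]) <= d by rewrite normcB.
  apply: (le_trans (normcBD c _ _)); apply: (le_trans (lerD Hz Hb')).
  apply: (@le_trans _ _ (eta * (4 * d / eta))).
    by have -> : eta * (4 * d / eta) = 4 * d; [field; rewrite gt_eqF|lra].
  by rewrite ler_wpM2r// divr_ge0 ?mulr_ge0 ?(ltW eta0).
have [->|zb0] := eqVneq z b.
  have -> : Ub.[b] / W.[b] = df b.
    rewrite /df /= !hornerE.
    have := congr1 (fun T : {poly C} => T^`().[b]) UbE.
    rewrite derivB derivZ derivM derivXsubC !hornerE subrr mul0r addr0 => <-.
    by field.
  apply: (le_trans (dfb b _)); first by rewrite subrr normc0.
  by rewrite ler_pM2r ?invr_gt0// ler_wpM2r//; lra.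
have n0 : 0 < normc (z - b) by rewrite normc_gt0 subr_eq0.
rewrite -(ler_pM2l n0) -normcM -key//.
rewrite (_ : _ - _ = f (b + (z - b)) - f b); last by rewrite /f (addrC b) subrK; ring.
rewrite mulrC; apply: (le_trans (@mean_value_segment _ f df b (z - b) (2 * d / eta) _ _)).
- move=> t t01; apply: fD; rewrite addrAC subrr add0r normcM normcR.
  move/andP: t01 => [t0 t1]; rewrite ger0_norm//.
  by rewrite (@le_trans _ _ (normc (z - b)))// ?ler_piMl ?normc_ge0//; lra.
- move=> t t01; apply: dfb; rewrite addrAC subrr add0r normcM normcR.
  move/andP: t01 => [t0 t1]; rewrite ger0_norm//.
  by apply: le_lt_trans zb; rewrite ler_piMl ?normc_ge0.
- rewrite ler_wpM2r ?normc_ge0// ler_pM2r ?invr_gt0// ler_wpM2r//; lra.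
Qed.

End PolynomialRoots.

Section RationalApproximation.
Variable R : realType.
Local Notation C := R[i].
Implicit Types (P Q U W : {poly C}) (S : set C) (z w b : C).

Lemma closed_normc_le (a : R) : closed [set z : C | normc z <= a].
Proof.
move=> z Hz; rewrite /= leNgt; apply/negP => za.
have e0 : 0 < normc z - a by rewrite subr_gt0.
have [w wa wz] := (closure_normcP _ _).1 Hz _ e0.
have wa' : normc w <= a := wa.
by have := normc_le_add w z; have := normcB w z; norm_lra.
Qed.

(** Closed, as [rational_indicator] requires; in exchange its points are only known to be within
    [2 * t] of [S]. *)
Definition nbhood (t : R) S : set C := closure [set z | exists2 y, S y & normc (z - y) < t].

Lemma nbhood_closed t S : closed (nbhood t S).
Proof. exact: closed_closure. Qed.

Lemma nbhood_in (t : R) S z y : S y -> normc (z - y) < t -> nbhood t S z.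
Proof. by move=> Sy zy; apply: subset_closure; exists y. Qed.

Lemma nbhood_out (t : R) S z : 0 < t -> nbhood t S z -> exists2 y, S y & normc (z - y) < 2 * t.
Proof.
move=> t0 /(closure_normcP _ _).1 /(_ t t0)[w [y Sy wy] wz]; exists y => //.
rewrite normcB in wz; apply: (le_lt_trans (normcBD w z y)).
by rewrite mulr_natl mulr2n ltrD.
Qed.

Lemma nbhood_compact (t : R) S : 0 < t -> compact S -> compact (nbhood t S).
Proof.
move=> t0 cS; have [M M0 HM] := compact_normc_bounded cS.
apply: (@bounded_closed_compactC _ _ (M + 2 * t)); first exact: nbhood_closed.
move=> w /(nbhood_out t0)[y /HM yM wy]; have := normc_le_add y w; norm_lra.
Qed.

Lemma hchord_scale (c a b p q : C) : c != 0 -> hchord (c * a) (c * b) p q = hchord a b p q.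
Proof.
move=> c0; have n0 : 0 < normc c by rewrite normc_gt0.
have -> : hchord (c * a) (c * b) p q = normc c * normc (a * q - p * b) / ((normc c * hnorm a b) * hnorm p q).
  rewrite /hchord -normcM; congr (normc _ / (_ * _)); first by ring.
  rewrite /hnorm !normcM !exprMn -mulrDr sqrtrM ?sqr_ge0// sqrtr_sqr ger0_norm// ltW//.
by rewrite -[normc c * hnorm a b * _]mulrA invfM mulrACA mulfV ?gt_eqF// mul1r.
Qed.

(** In affine terms the value [p / q] becomes [al * (p / q) + ta]; the bound is uniform in [p / q],
    poles included. *)
Lemma hchord_close (al ta p q : C) : (p != 0) || (q != 0) ->
  hchord (al * p + ta * q) q p q <= normc (al - 1) + normc ta.
Proof.
move=> pq; rewrite /hchord; have pq0 := hnorm_gt0 pq.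
have [->|q0] := eqVneq q 0; first by rewrite !mulr0 subrr normc0 mul0r addr_ge0 ?normc_ge0.
have nq : 0 < normc q by rewrite normc_gt0.
set X := hnorm _ q; have Xq : normc q <= X by exact: hnorm_ger.
have X0 : 0 < X by exact: lt_le_trans Xq.
rewrite ler_pdivrMr ?mulr_gt0// (_ : _ - _ = ((al - 1) * p + ta * q) * q); last by ring.
rewrite normcM [leRHS]mulrA (mulrC _ X) -mulrA mulrC; apply: ler_pM; rewrite ?normc_ge0//.
rewrite (le_trans (normcD _ _))// !normcM mulrDl lerD// ler_wpM2l ?normc_ge0//.
  exact: hnorm_gel.
exact: hnorm_ger.
Qed.

Lemma prod_diff_quot U W (V : C -> {poly C}) (s : seq C) (c : C) z : W.[z] != 0 ->
  (forall b, b \in s -> U - (U.[b] / W.[b]) *: W = ('X - b%:P) * V b) ->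
  (\prod_(b <- s) (c *: V b)).[z] * (\prod_(b <- s) ('X - b%:P)).[z]
  = (\prod_(b <- s) (c * (U.[z] / W.[z] - U.[b] / W.[b]))) * W.[z] ^+ size s.
Proof.
move=> Wz; elim: s => [|b s IH] H; first by rewrite !big_nil !hornerC mulr1.
rewrite !big_cons !hornerM mulrACA IH; last by move=> d ds; apply: H; rewrite inE ds orbT.
have := congr1 (horner^~ z) (H b (mem_head _ _)); rewrite hornerM hornerD hornerN hornerZ => e.
have {e} h : c * (V b).[z] * ('X - b%:P).[z] = c * (U.[z] / W.[z] - U.[b] / W.[b]) * W.[z].
  by rewrite -mulrA [(V b).[z] * _]mulrC -e -[RHS]mulrA [in RHS]mulrBl divfK.
by rewrite /= hornerZ h exprS mulrACA.
Qed.

Lemma prod_normc_le1 (s : seq C) (f : C -> C) :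
  (forall b, b \in s -> normc (f b) <= 1) -> normc (\prod_(b <- s) f b) <= 1.
Proof.
elim: s => [|b s IH] H; first by rewrite big_nil normc1.
rewrite big_cons normcM; apply: mulr_ile1; rewrite ?normc_ge0//; first exact: H (mem_head _ _).
by apply: IH => d ds; apply: H; rewrite inE ds orbT.
Qed.

Lemma horner_prod_div W (V : C -> {poly C}) (s : seq C) (c : C) z :
  (\prod_(b <- s) (c *: V b)).[z] / W.[z] ^+ size s = \prod_(b <- s) (c * ((V b).[z] / W.[z])).
Proof.
elim: s => [|b s IH]; first by rewrite !big_nil hornerC divr1.
by rewrite !big_cons hornerM hornerZ -IH /= exprS invfM -!mulrA; congr (_ * (_ * _)); rewrite mulrCA.
Qed.

(** The error on the side of [E]: there [U / W] is small and [x] near 1, while [A0 / w0 = x / q0]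
    has absorbed the roots of the denominator lying in [K]. *)
Lemma rational_approx_off (U W P0 A0 Q0a q0 P1 A1 Q1a w0 w1 x : C) :
  W != 0 -> Q0a != 0 -> q0 != 0 -> Q1a != 0 -> w0 != 0 -> w1 != 0 -> A0 * q0 = x * w0 ->
  ((W - U) * P0 * A0 * Q1a * w1 + U * P1 * A1 * Q0a * w0) / (W * Q0a * w0 * Q1a * w1) - P0 / (Q0a * q0)
  = P0 / (Q0a * q0) * ((1 - U / W) * x - 1) + U / W * (P1 / Q1a) * (A1 / w1).
Proof.
move=> W0 Q0a0 q00 Q1a0 w00 w10 /(canRL (mulfK q00)) ->; field.
by rewrite W0 Q0a0 q00 Q1a0 w00 w10.
Qed.

(** The side of [K] in homogeneous coordinates: up to the common factor [c], the pair has the form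
    treated by [hchord_close], with [Q1a * q1] the full denominator of the target. *)
Lemma rational_approx_on (U W P0 A0 Q0a P1 A1 Q1a q1 w0 w1 x : C)
  (c := W * Q0a * w0 * w1 / q1) :
  W != 0 -> Q0a != 0 -> q1 != 0 -> w0 != 0 -> w1 != 0 -> A1 * q1 = x * w1 ->
  (W - U) * P0 * A0 * Q1a * w1 + U * P1 * A1 * Q0a * w0
  = c * (U / W * x * P1 + (1 - U / W) * (P0 / Q0a) * (A0 / w0) * (Q1a * q1)) /\
  W * Q0a * w0 * Q1a * w1 = c * (Q1a * q1).
Proof.
move=> W0 Q0a0 q10 w00 w10 /(canRL (mulfK q10)) ->; rewrite /c; split; field.
- by rewrite W0 Q0a0 q10 w00.
- by rewrite q10.
Qed.

Lemma rational_approx_pair K E P0 Q0 P1 Q1 (N : nat) (eps : R) :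
  compact K -> closed E -> E !=set0 -> K `<=` ~` E ->
  Q0 != 0 -> (forall z, E z -> Q0.[z] != 0) ->
  Q1 != 0 -> (forall z, K z -> (P1.[z] != 0) || (Q1.[z] != 0)) -> 0 < eps ->
  exists P Q, [/\ forall z, E z -> Q.[z] != 0,
    forall l z, (l <= N)%N -> E z -> normc z <= N%:R ->
      normc ((quot_derivn P Q l).[z] / Q.[z] ^+ l.+1 -
             (quot_derivn P0 Q0 l).[z] / Q0.[z] ^+ l.+1) <= eps &
    forall z, K z -> ((P.[z] != 0) || (Q.[z] != 0)) /\ hchord P.[z] Q.[z] P1.[z] Q1.[z] <= eps].
Proof.
move=> cK cE [E1 EE1] KE Q00 Q0E Q10 PQ1 eps0.
have [r r0 Hr] := compact_dist_gt0 cK cE KE.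
have [t0 t00 Ht0] := root_free_near Q00 cE Q0E.
have [Q0a [s0 [Q0E' s0K Q0aK]]] := split_roots K Q00.
have [Q1a [s1 [Q1E' s1E Q1aE]]] := split_roots E Q10.
have Q1a0 : Q1a != 0 by apply: contraNneq Q10 => e; rewrite Q1E' e mul0r.
have Q0a0 : Q0a != 0 by apply: contraNneq Q00 => e; rewrite Q0E' e mul0r.
have [t1 t10 Ht1] := root_free_near Q1a0 cE Q1aE.
pose m := Num.min (Num.min 1 r) (Num.min t0 t1).
have m0 : 0 < m by rewrite !lt_min ltr01 r0 t00.
(* Points of [nbhood (3 * eta)] are within [6 * eta] of the set, so a twelfth of the gap keeps [nK]
   and [nE] disjoint; the width [3 * eta] leaves room for the discs of radius [2 * eta] in
   [diff_quot_le]. *)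
pose eta := m / 12.
have eta0 : 0 < eta by rewrite divr_gt0.
have [eta1 etar etat0 etat1] : [/\ 12 * eta <= 1, 12 * eta <= r, 12 * eta <= t0 & 12 * eta <= t1].
  by rewrite /eta mulrC divfK// /m !ge_min !lexx !orbT.
pose nE := nbhood (3 * eta) E; pose nK := nbhood (3 * eta) K.
have eta3 : 0 < 3 * eta by rewrite mulr_gt0.
have nKE : nK `<=` ~` nE.
  move=> z /(nbhood_out eta3)[k Kk zk] /(nbhood_out eta3)[e Ee ze].
  have h := Hr k e Kk Ee; have h1 := normcBD z e k; rewrite (normcB e z) in h1.
  by clear -zk ze h h1 eta0 etar; norm_lra.
have cnK : compact nK by exact: nbhood_compact.
have cnE : closed nE by exact: nbhood_closed.
(* Bounds for the two functions need compactness; the radius [N + 1] contains the discs of radius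
   [eta] around points of norm at most [N]. *)
pose EN := nE `&` [set z | normc z <= N%:R + 1].
have cEN : compact EN.
  apply: (@bounded_closed_compactC _ _ (N%:R + 1)); last by move=> w [].
  apply: closedI => //; exact: closed_normc_le.
have nEQ0 z : nE z -> Q0.[z] != 0.
  by move=> /(nbhood_out eta3)[e Ee ze]; apply: (Ht0 z e) => //; clear -ze eta0 etat0; norm_lra.
have nEQ1 z : nE z -> Q1a.[z] != 0.
  by move=> /(nbhood_out eta3)[e Ee ze]; apply: (Ht1 z e) => //; clear -ze eta0 etat1; norm_lra.
have nEQ0a z : nE z -> Q0a.[z] != 0.
  by move=> /nEQ0; rewrite Q0E' hornerM mulf_eq0 negb_or => /andP[].
have [Mf Mf0 HMf] := quot_bounded P0 cEN (fun z h => nEQ0 z h.1).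
have [Mh Mh0 HMh] := quot_bounded P1 cEN (fun z h => nEQ1 z h.1).
have [Mk Mk0 HMk] := quot_bounded P0 cK Q0aK.
pose cl l : R := eta * (l`!)%:R * (2 / eta) ^+ l.+1.
have cl0 l : 0 <= cl l.
  by rewrite /cl; apply: mulr_ge0; [apply: mulr_ge0; [exact: ltW|exact: ler0n]|apply/exprn_ge0/divr_ge0 => //; exact: ltW].
pose B := 1 + \sum_(l < N.+1) cl l.
have B0 : 0 < B by rewrite ltr_pwDl// sumr_ge0.
have clB l : (l <= N)%N -> cl l <= B.
  move=> lN; rewrite /B -ltnS in lN *.
  by rewrite (bigD1 (Ordinal lN))//= addrCA lerDl addr_ge0// sumr_ge0.
pose e1 := eps / B; have e10 : 0 < e1 by rewrite divr_gt0.
(* Tolerance for the products near 1: the first bound serves [E], the second [K], and [1 / 2] keeps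
   [ev z * x1 z] away from 0, which excludes common zeros on [K]. *)
pose rho := Num.min (e1 / 2 / Mf) (Num.min (eps / 2) (1 / 2)).
have rho0 : 0 < rho by rewrite !lt_min !divr_gt0.
have [d1 d10 Hd1] := prod_near1 (maxn (size s0) (size s1)).+1 rho0.
(* [d1 / 2] puts [ev y - ev z] within [d1] of 1 for [y] in [nK] and [z] in [nE], [eta / 4] bounds
   the difference quotients by 1, and the other two absorb [Mh] and [Mk]. *)
pose e0 := Num.min (Num.min (d1 / 2) (eta / 4)) (Num.min (e1 / 2 / Mh) (eps / 2 / Mk)).
have e00 : 0 < e0 by rewrite !lt_min !divr_gt0.
have [e0d e0eta e0h e0k] : [/\ e0 <= d1 / 2, e0 <= eta / 4, e0 <= e1 / 2 / Mh & e0 <= eps / 2 / Mk].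
  by rewrite /e0 !ge_min !lexx !orbT.
have [f [[U [W HUW]] HfK HfE]] := rational_indicator cnK cnE nKE e00.
have W0 z : nK z \/ nE z -> W.[z] != 0 by move=> h; have [] := HUW z h.
pose ev z : C := U.[z] / W.[z].
have evK z : nK z -> normc (ev z - 1) <= e0.
  by move=> h; have := HfK z h; have [_ ->] := HUW z (or_introl h).
have evE z : nE z -> normc (ev z) <= e0.
  by move=> h; have := HfE z h; have [_ ->] := HUW z (or_intror h).
have [V HV] : {V : C -> {poly C} & forall b, W.[b] != 0 -> U - ev b *: W = ('X - b%:P) * V b}.
  apply: (@choice _ _ (fun b Vb => W.[b] != 0 -> U - ev b *: W = ('X - b%:P) * Vb)) => b; have [Wb|Wb] := boolP (W.[b] == 0); first by exists 0.
  by have [Ub HUb] := diff_quot_poly U Wb; exists Ub.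
pose A0 := (\prod_(b <- s0) (-1 *: V b)).
pose A1 := (\prod_(b <- s1) (1 *: V b)).
pose p0 : {poly C} := \prod_(b <- s0) ('X - b%:P).
pose p1 : {poly C} := \prod_(b <- s1) ('X - b%:P).
pose w0 := W ^+ size s0; pose w1 := W ^+ size s1.
have KnK z : K z -> nK z by move=> Kz; apply: (nbhood_in Kz); rewrite subrr normc0.
have EnE z : E z -> nE z by move=> Ez; apply: (nbhood_in Ez); rewrite subrr normc0.
have WK z : K z -> W.[z] != 0 by move=> /KnK h; apply: W0; left.
have WE z : nE z -> W.[z] != 0 by move=> h; apply: W0; right.
have s0V b : b \in s0 -> U - ev b *: W = ('X - b%:P) * V b.
  by move=> /s0K[Kb _]; apply: HV; exact: WK.
have s1V b : b \in s1 -> U - ev b *: W = ('X - b%:P) * V b.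
  by move=> /s1E[Eb _]; apply: HV; apply: WE; exact: EnE.
have small y : normc y <= 4 * e0 / eta -> normc y <= 1.
  move=> h; apply: (le_trans h); rewrite ler_pdivrMr// mul1r; clear -e0eta; lra.
have k0 z b : K z -> b \in s0 -> normc (-1 * ((V b).[z] / W.[z])) <= 1.
  move=> Kz bs; rewrite normcM normcN normc1 mul1r; have [Kb _] := s0K b bs.
  apply: small; apply: (diff_quot_le eta0 (s0V b bs) _ (WK z Kz) (evK z (KnK z Kz))) => w wb.
  have h : nK w by apply: (nbhood_in Kb); apply: le_lt_trans wb _; rewrite ltr_pM2r// ltr_nat.
  by split; [apply: W0; left|exact: evK].
have k1 z b : nE z -> b \in s1 -> normc (1 * ((V b).[z] / W.[z])) <= 1.
  move=> Ez bs; rewrite mul1r; have [Eb _] := s1E b bs.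
  have c0 y : nE y -> normc (ev y - 0) <= e0 by rewrite subr0; exact: evE.
  apply: small; apply: (diff_quot_le eta0 (s1V b bs) _ (WE z Ez) (c0 z Ez)) => w wb.
  have h : nE w by apply: (nbhood_in Eb); apply: le_lt_trans wb _; rewrite ltr_pM2r// ltr_nat.
  by split; [exact: WE|exact: c0].
have close2 y z : nK y -> nE z -> normc (ev y - ev z - 1) <= d1.
  move=> /evK hy /evE hz; rewrite addrAC; apply: (le_trans (normcB_le _ _)).
  by apply: (le_trans (lerD hy hz)); clear -e0d; lra.
pose x0 z : C := \prod_(b <- s0) (-1 * (ev z - ev b)).
pose x1 z : C := \prod_(b <- s1) (1 * (ev z - ev b)).
have x0E z : nE z -> normc ((1 - ev z) * x0 z - 1) <= rho.
  move=> Ez; pose l := (1 - ev z) :: [seq -1 * (ev z - ev b) | b <- s0].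
  have -> : (1 - ev z) * x0 z = \prod_(y <- l) y by rewrite big_cons big_map.
  apply: Hd1; first by rewrite /= size_map ltnS leq_maxl.
  move=> y; rewrite inE => /orP[/eqP->|/mapP[b /s0K[Kb _] ->]].
    rewrite addrAC subrr add0r normcN; apply: (le_trans (evE z Ez)); clear -e0d d10; lra.
  have -> : -1 * (ev z - ev b) = ev b - ev z by rewrite mulN1r opprB.
  exact: close2 (KnK b Kb) Ez.
have x1K z : K z -> normc (ev z * x1 z - 1) <= rho.
  move=> Kz; pose l := ev z :: [seq 1 * (ev z - ev b) | b <- s1].
  have -> : ev z * x1 z = \prod_(y <- l) y by rewrite big_cons big_map.
  apply: Hd1; first by rewrite /= size_map ltnS leq_maxr.
  move=> y; rewrite inE => /orP[/eqP->|/mapP[b /s1E[Eb _] ->]].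
    by apply: (le_trans (evK z (KnK z Kz))); clear -e0d d10; lra.
  by rewrite mul1r; apply: close2 => //; [exact: KnK|exact: EnE].
have Ax0 z : W.[z] != 0 -> A0.[z] * p0.[z] = x0 z * w0.[z].
  by move=> Wz; rewrite /w0 horner_exp; exact: prod_diff_quot.
have Ax1 z : W.[z] != 0 -> A1.[z] * p1.[z] = x1 z * w1.[z].
  by move=> Wz; rewrite /w1 horner_exp; exact: prod_diff_quot.
have wz0 z : W.[z] != 0 -> w0.[z] != 0 by move=> h; rewrite horner_exp expf_neq0.
have wz1 z : W.[z] != 0 -> w1.[z] != 0 by move=> h; rewrite horner_exp expf_neq0.
(* With e = U / W, the quotient [P / Q] is (1 - e) * (P0 / Q0) * x0 + e * (P1 / Q1) * x1. As
   [A0 / w0 = x0 / p0] and [A1 / w1 = x1 / p1], the denominators [Q0] and [Q1] shrink to [Q0a] and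
   [Q1a]. *)
pose P := (W - U) * P0 * A0 * Q1a * w1 + U * P1 * A1 * Q0a * w0.
pose Q := W * Q0a * w0 * Q1a * w1.
have PE z : P.[z] = (W.[z] - U.[z]) * P0.[z] * A0.[z] * Q1a.[z] * w1.[z] + U.[z] * P1.[z] * A1.[z] * Q0a.[z] * w0.[z].
  by rewrite /P hornerD !hornerM hornerD hornerN.
have QE z : Q.[z] = W.[z] * Q0a.[z] * w0.[z] * Q1a.[z] * w1.[z] by rewrite /Q !hornerM.
have Q0z z : Q0.[z] = Q0a.[z] * p0.[z] by rewrite Q0E' hornerM.
have Q1z z : Q1.[z] = Q1a.[z] * p1.[z] by rewrite Q1E' hornerM.
have nEQ z : nE z -> Q.[z] != 0.
  move=> h; have Wz := WE z h; rewrite QE.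
  by rewrite !mulf_neq0 ?nEQ0a ?nEQ1 ?wz0 ?wz1.
have main1 z : EN z -> normc (P.[z] / Q.[z] - P0.[z] / Q0.[z]) <= e1.
  move=> ENz; have Ez := ENz.1; have Wz := WE z Ez.
  have p0z : p0.[z] != 0 by have := nEQ0 z Ez; rewrite Q0z mulf_eq0 negb_or => /andP[].
  rewrite PE QE Q0z (@rational_approx_off _ _ _ _ _ _ _ _ _ _ _ (x0 z)) ?wz0 ?wz1 ?nEQ0a ?nEQ1 ?Ax0 // -Q0z.
  have hA : normc (A1.[z] / w1.[z]) <= 1.
    by rewrite /w1 horner_exp horner_prod_div; apply: prod_normc_le1 => b bs; exact: k1.
  have h1 : normc (P0.[z] / Q0.[z] * ((1 - ev z) * x0 z - 1)) <= e1 / 2.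
    rewrite normcM; apply: (@le_trans _ _ (Mf * (e1 / 2 / Mf))); last by rewrite mulrC divfK ?gt_eqF.
    apply: ler_pM; rewrite ?normc_ge0 ?HMf//; apply: (le_trans (x0E z Ez)).
    by rewrite /rho ge_min lexx.
  have h2 : normc (ev z * (P1.[z] / Q1a.[z]) * (A1.[z] / w1.[z])) <= e1 / 2.
    rewrite normcM -[leRHS]mulr1; apply: ler_pM; rewrite ?normc_ge0// normcM.
    apply: (@le_trans _ _ (e1 / 2 / Mh * Mh)); last by rewrite divfK ?gt_eqF.
    apply: ler_pM; rewrite ?normc_ge0 ?HMh//; exact: le_trans (evE z Ez) _.
  by apply: (le_trans (normcD _ _)); apply: (le_trans (lerD h1 h2)); rewrite -splitr.
exists P, Q; split.
- by move=> z /EnE; exact: nEQ.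
- move=> l z lN Ez zN.
  have step w : normc (w - z) <= eta -> [/\ Q.[w] != 0, Q0.[w] != 0 &
      normc (P.[w] / Q.[w] - P0.[w] / Q0.[w]) <= e1].
    move=> wz.
    have nw : nE w by apply: (nbhood_in Ez); apply: le_lt_trans wz _; rewrite ltr_pMl// ltr1n.
    split; [exact: nEQ|exact: nEQ0|apply: main1; split=> //=].
    by apply: (le_trans (normc_le_add z w)); clear -wz zN eta1 eta0; norm_lra.
  apply: (le_trans (quot_diff_estimate l eta0 step)).
  have -> : e1 * eta * (l`!)%:R * (2 / eta) ^+ l.+1 = e1 * cl l by rewrite /cl !mulrA.
  apply: (@le_trans _ _ (e1 * B)); last by rewrite /e1 divfK ?gt_eqF.
  by rewrite ler_wpM2l ?(ltW e10)// clB.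
- move=> z Kz; have Wz := WK z Kz.
  have p1z : p1.[z] != 0.
    rewrite horner_prod prodf_seq_neq0; apply/allP => b /s1E[Eb _]; apply/implyP => _.
    by rewrite !hornerE subr_eq0; apply/eqP => zb; apply: (KE z Kz); rewrite zb.
  have [] := @rational_approx_on U.[z] W.[z] P0.[z] A0.[z] Q0a.[z] P1.[z] A1.[z] Q1a.[z] p1.[z]
    w0.[z] w1.[z] (x1 z) Wz (Q0aK z Kz) p1z (wz0 z Wz) (wz1 z Wz) (Ax1 z Wz).
  rewrite -PE -QE -Q1z; set c := _ / p1.[z] => Pz Qz.
  have c0 : c != 0 by rewrite /c !mulf_neq0 ?invr_eq0 ?Q0aK ?wz0 ?wz1.
  clearbody c.
  have := x1K z Kz; rewrite le_min le_min => /and3P[_ al1 al2].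
  have al0 : ev z * x1 z != 0.
    apply/eqP => e; move: al2; rewrite e sub0r normcN normc1 => al2; clear -al2; lra.
  have ta : normc ((1 - ev z) * (P0.[z] / Q0a.[z]) * (A0.[z] / w0.[z])) <= eps / 2.
    have hA : normc (A0.[z] / w0.[z]) <= 1.
      by rewrite /w0 horner_exp horner_prod_div; apply: prod_normc_le1 => b bs; exact: k0.
    rewrite normcM -[leRHS]mulr1; apply: ler_pM; rewrite ?normc_ge0// normcM.
    apply: (@le_trans _ _ (eps / 2 / Mk * Mk)); last by rewrite divfK ?gt_eqF.
    apply: ler_pM; rewrite ?normc_ge0 ?HMk// normcB; exact: le_trans (evK z (KnK z Kz)) _.
  split.
    have [q0|q0] := eqVneq Q1.[z] 0; last by apply/orP; right; rewrite Qz mulf_neq0.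
    have := PQ1 z Kz; rewrite q0 eqxx orbF => pz; apply/orP; left; rewrite Pz q0 mulr0 addr0.
    by apply: mulf_neq0 => //; apply: mulf_neq0 => //; exact: al0.
  rewrite Pz Qz hchord_scale//; apply: (le_trans (hchord_close _ _ (PQ1 z Kz))).
  by apply: (le_trans (lerD al1 ta)); rewrite -splitr.
Qed.

Lemma quot_derivn_reduce P Q G l z : (Q * G).[z] != 0 ->
  (quot_derivn P Q l).[z] / Q.[z] ^+ l.+1 = (quot_derivn (P * G) (Q * G) l).[z] / (Q * G).[z] ^+ l.+1.
Proof.
move=> h; have [r r0 Hr] := horner_neq0_near h.
pose f w : C := P.[w] / Q.[w].
transitivity (derive1n l f z : C); [symmetry|]; apply: (derive1n_quot l r0) => w /Hr Gw.
  by move: Gw; rewrite hornerM mulf_eq0 negb_or => /andP[].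
by split=> //; move: Gw; rewrite !hornerM mulf_eq0 negb_or => /andP[Qw Gw]; rewrite -mulf_div divff// mulr1.
Qed.

Lemma rational_approx K E P0 Q0 P1 Q1 (N : nat) (eps : R) :
  compact K -> closed E -> E !=set0 -> K `<=` ~` E ->
  Q0 != 0 -> (forall z, E z -> Q0.[z] != 0) ->
  Q1 != 0 -> (forall z, K z -> (P1.[z] != 0) || (Q1.[z] != 0)) -> 0 < eps ->
  exists P Q, [/\ coprimep P Q, forall z, E z -> Q.[z] != 0,
    forall l z, (l <= N)%N -> E z -> normc z <= N%:R ->
      normc ((quot_derivn P Q l).[z] / Q.[z] ^+ l.+1 -
             (quot_derivn P0 Q0 l).[z] / Q0.[z] ^+ l.+1) <= eps &
    forall z, K z -> hchord P.[z] Q.[z] P1.[z] Q1.[z] <= eps].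
Proof.
move=> cK cE En0 KE Q00 Q0E Q10 PQ1 eps0.
have [P [Q [QE der onK]]] := @rational_approx_pair K E P0 Q0 P1 Q1 N eps cK cE En0 KE Q00 Q0E Q10 PQ1 eps0.
have Qn0 : Q != 0 by have [y Ey] := En0; apply: contraNneq (QE y Ey) => ->; rewrite horner0.
have [Pg Qg] : P %/ gcdp P Q * gcdp P Q = P /\ Q %/ gcdp P Q * gcdp P Q = Q.
  by rewrite !divpK ?dvdp_gcdl ?dvdp_gcdr.
have cop : coprimep (P %/ gcdp P Q) (Q %/ gcdp P Q) by rewrite coprimep_div_gcd// Qn0 orbT.
move: (gcdp P Q) (P %/ gcdp P Q) (Q %/ gcdp P Q) Pg Qg cop => G P' Q' PG QG cop.
exists P', Q'; split=> // [z Ez|l z lN Ez zN|z Kz].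
- by have := QE z Ez; rewrite -QG hornerM mulf_eq0 negb_or => /andP[].
- by have := QE z Ez; rewrite -QG => h; rewrite (quot_derivn_reduce P' l h) QG PG; exact: der.
- have [pq] := onK z Kz; rewrite -PG -QG !hornerM ![_ * G.[z]]mulrC hchord_scale//.
  by apply: contraTneq pq => e; rewrite -PG -QG !hornerM e !mulr0 eqxx.
Qed.

End RationalApproximation.

(** * Density and openness *)

Section Density.
Variables (R : realType) (Omega : set R[i]).
Hypothesis oOmega : open Omega.
Variable zeta : R[i].
Hypothesis hzeta : closure Omega zeta.
Local Notation C := R[i].
Local Notation E := (closure Omega).
Local Notation ext := (ext_deriv Omega).
Local Notation near_upto := (near_upto Omega).
Local Notation fn f := (Xinf_fun f).
Implicit Types (P Q A B : {poly C}) (z w : C).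

(* [outer] and [inner] exhaust the complement and the closure of [Omega] by compact sets. *)
Definition outer (s : nat) : set C :=
  [set z | normc z <= s%:R /\ forall w, E w -> s.+1%:R^-1 <= normc (z - w)].
Definition inner (s : nat) : set C := E `&` [set z | normc z <= s%:R].

Lemma outer_out s : outer s `<=` ~` E.
Proof.
move=> z [_ Hz] /Hz; rewrite subrr normc0 leNgt => /negP; apply.
by rewrite invr_gt0 ltr0n.
Qed.

Lemma outer_compact s : compact (outer s).
Proof.
apply: (@bounded_closed_compactC _ _ s%:R) => [|w []//].
move=> z Hz; split.
  by apply: (closed_normc_le (a := s%:R)); apply: closure_subset Hz => w [].
move=> w Ew; rewrite leNgt; apply/negP => zw.
have e0 : 0 < s.+1%:R^-1 - normc (z - w) by rewrite subr_gt0.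
have [y [_ /(_ w Ew) yw] yz] := (closure_normcP _ _).1 Hz _ e0.
have := normcBD z y w; apply/negP; rewrite -ltNge; apply: lt_le_trans yw.
by rewrite -ltrBrDr.
Qed.

Lemma inner_compact s : compact (inner s).
Proof.
apply: (@bounded_closed_compactC _ _ s%:R) => [|w []//].
apply: closedI; [exact: closed_closure|exact: closed_normc_le].
Qed.

Definition pade_num (f : C -> C) (pq : nat * nat) := jacobi_num (taylor_coef Omega zeta f) zeta pq.1 pq.2.
Definition pade_den (f : C -> C) (pq : nat * nat) := jacobi_den (taylor_coef Omega zeta f) zeta pq.1 pq.2.

Definition approximates (s : nat) (h : {poly C} * {poly C}) (e : R) (f : C -> C) A B :=
  [/\ forall z, outer s z \/ inner s z -> (A.[z] != 0) || (B.[z] != 0),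
      forall z, outer s z -> hchord A.[z] B.[z] h.1.[z] h.2.[z] <= e,
      forall z, inner s z -> B.[z] != 0 &
      forall l z, (l <= s)%N -> inner s z ->
        normc ((quot_derivn A B l).[z] / B.[z] ^+ l.+1 - ext f l z) <= e].

Definition coprime_on (S : set C) (h : {poly C} * {poly C}) :=
  h.2 != 0 /\ forall z, S z -> (h.1.[z] != 0) || (h.2.[z] != 0).

(** A pair with a common zero on [outer s] is no point of the sphere there; for it the set is the
    whole space, still open and dense. The strict [e < s.+1%:R^-1] leaves the room needed for
    openness. *)
Definition approximable (F : set (nat * nat)) (s : nat) (h : {poly C} * {poly C}) : set (Xinf Omega) :=
  [set f | coprime_on (outer s) h -> exists (pq : nat * nat) (e : R),
    [/\ F pq, in_D Omega zeta pq.1 pq.2 (fn f), e < s.+1%:R^-1 &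
        approximates s h e (fn f) (pade_num (fn f) pq) (pade_den (fn f) pq)]].

Lemma quot_derivnD A A' B l (c : C) :
  quot_derivn (A + c *: A') B l = quot_derivn A B l + c *: quot_derivn A' B l.
Proof.
elim: l => [//|l IH]; rewrite [LHS]/= IH [in RHS]/= derivD derivZ.
move: (quot_derivn A B l) (quot_derivn A' B l) => X Y.
have key (x y x' y' b b' t u : {poly C}) :
  (x' + t * y') * b - u * ((x + t * y) * b') = x' * b - u * (x * b') + t * (y' * b - u * (y * b')).
  by ring.
by rewrite -!mul_polyC; exact: key.
Qed.

Lemma quot_derivn_scale A B l (c : C) z : c != 0 -> B.[z] != 0 ->
  (quot_derivn (c *: A) (c *: B) l).[z] / (c *: B).[z] ^+ l.+1 = (quot_derivn A B l).[z] / B.[z] ^+ l.+1.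
Proof.
move=> c0 Bz; have eA X : c *: X = X * c%:P by rewrite -mul_polyC mulrC.
have BG : (B * c%:P).[z] != 0 by rewrite hornerM hornerC mulf_neq0.
by rewrite (eA A) (eA B); exact/esym/(quot_derivn_reduce A l BG).
Qed.

Lemma near_quot (f g : C -> C) P Q P0 Q0 N (e : R) :
  (forall z, E z -> Q0.[z] != 0) -> (forall z, Omega z -> f z = P0.[z] / Q0.[z]) ->
  (forall z, E z -> Q.[z] != 0) -> (forall z, Omega z -> g z = P.[z] / Q.[z]) ->
  (forall l z, (l <= N)%N -> E z -> normc z <= N%:R ->
     normc ((quot_derivn P Q l).[z] / Q.[z] ^+ l.+1 - (quot_derivn P0 Q0 l).[z] / Q0.[z] ^+ l.+1) <= e) ->
  near_upto N e f g.
Proof.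
move=> Q0E fE QE gE H l z lN Ez zN.
by rewrite (ext_quot oOmega Q0E fE l Ez) (ext_quot oOmega QE gE l Ez); exact: H.
Qed.

Lemma coprimep_neq0 P Q z : coprimep P Q -> (P.[z] != 0) || (Q.[z] != 0).
Proof.
rewrite coprimep_sym => cop; have [Qz|_] := eqVneq Q.[z] 0; last by rewrite orbT.
by rewrite orbF; exact: (coprimep_root cop (introT rootP Qz)).
Qed.

(* Adding [d *: 'X^k] to [P / Q] makes the numerator have degree exactly [p], so that the
   quotient is its own Pade approximant. *)
Lemma perturb_numerator P Q p (N : nat) (K : set C) (e : R) :
  coprimep P Q -> Q != 0 -> (forall z, E z -> Q.[z] != 0) -> (forall z, K z -> normc z <= N%:R) ->
  (size P <= p)%N -> (size Q <= p)%N -> 0 < e ->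
  exists2 P' : {poly C}, [/\ size P' = p.+1, coprimep P' Q & forall z, K z -> hchord P'.[z] Q.[z] P.[z] Q.[z] <= e] &
    forall l z, (l <= N)%N -> E z -> normc z <= N%:R ->
      normc ((quot_derivn P' Q l).[z] / Q.[z] ^+ l.+1 - (quot_derivn P Q l).[z] / Q.[z] ^+ l.+1) <= e.
Proof.
move=> cop Q0 QE KN sP sQ e0.
have sQ0 : (0 < size Q)%N by rewrite size_poly_gt0.
(* Chosen so that [Q * 'X^k] has size [p.+1]; being a multiple of [Q], it preserves coprimality. *)
pose k := (p - (size Q).-1)%N.
have kE : (size Q + k = p.+1)%N.
  by rewrite /k -{1}(prednK sQ0) addSn subnKC// (leq_trans (leq_pred _)).
pose D := Q * 'X^k.
have [M HM] : {M : nat -> R & forall l, 0 < M l /\ forall z, inner N z ->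
    normc ((quot_derivn D Q l).[z] / Q.[z] ^+ l.+1) <= M l}.
  apply: (@choice _ _ (fun l M => 0 < M /\ forall z, inner N z ->
    normc ((quot_derivn D Q l).[z] / Q.[z] ^+ l.+1) <= M)) => l.
  have [|M M0 HM] := @quot_bounded R (quot_derivn D Q l) (Q ^+ l.+1) (inner N) (@inner_compact N).
    by move=> z [Ez _]; rewrite horner_exp expf_neq0// QE.
  by exists M; split=> // z /HM; rewrite horner_exp.
(* [N%:R ^+ k] controls the chordal change on [K], the [M l] the derivatives, and 1 makes [T]
   positive. *)
pose T := N%:R ^+ k + 1 + \sum_(l < N.+1) M l.
have S0 : 0 <= \sum_(l < N.+1) M l by apply: sumr_ge0 => l _; exact/ltW/(HM l).1.
have T0 : 0 < T by rewrite ltr_wpDr// ltr_wpDl// exprn_ge0.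
pose d : C := (e / T)%:C.
have d0 : d != 0 by rewrite fmorph_eq0 mulf_neq0 ?invr_eq0 ?gt_eqF.
have nd : normc d = e / T by rewrite normcR ger0_norm// divr_ge0 ?ltW.
have dT (x : R) : 0 <= x -> x <= T -> normc d * x <= e.
  by move=> x0 xT; rewrite nd -mulrA ler_piMr ?(ltW e0)// mulrC ler_pdivrMr// mul1r.
exists (P + d *: D); last first.
  move=> l z lN Ez zN; rewrite quot_derivnD hornerD hornerZ mulrDl [X in normc X]addrAC subrr add0r.
  rewrite -mulrA normcM.
  have lN' : (l < N.+1)%N by rewrite ltnS.
  apply: (@le_trans _ _ (normc d * M l)); first by rewrite ler_wpM2l ?normc_ge0// (HM l).2.
  apply: dT; first exact/ltW/(HM l).1.
  rewrite /T (bigD1 (Ordinal lN'))//= addrCA lerDl; apply: addr_ge0.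
    by apply: addr_ge0 => //; exact: exprn_ge0.
  by apply: sumr_ge0 => i _; exact/ltW/(HM i).1.
have cop' : coprimep (P + d *: D) Q.
  by rewrite /D scalerAr mulrC addrC coprimep_sym coprimep_addl_mul coprimep_sym.
split=> //.
  have sD : size (d *: D) = p.+1 by rewrite size_scale// size_mulXn// addnC.
  by rewrite addrC size_polyDl sD.
move=> z Kz; apply: (le_trans (hchord_sub (coprimep_neq0 z cop') (coprimep_neq0 z cop))).
have pq0 := hnorm_gt0 (coprimep_neq0 z cop).
rewrite subrr normc0 addr0 ler_pdivrMr// hornerD opprD addrA subrr add0r normcN.
rewrite hornerZ hornerM hornerXn !normcM normcX [normc Q.[z] * _]mulrC mulrA.
apply: ler_pM; rewrite ?normc_ge0 ?hnorm_ger ?mulr_ge0 ?exprn_ge0 ?normc_ge0//.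
apply: dT; first by rewrite exprn_ge0 ?normc_ge0.
rewrite /T -addrA; apply: (@le_trans _ _ (N%:R ^+ k)); last by rewrite lerDl addr_ge0.
by apply: lerXn2r; rewrite ?nnegrE ?normc_ge0// KN.
Qed.

Lemma approximates_scale s h e (f : C -> C) A B (k : C) : k != 0 ->
  approximates s h e f A B -> approximates s h e f (k *: A) (k *: B).
Proof.
move=> k0 [H1 H2 H3 H4]; split=> [z /H1|z Kz|z /H3|l z ls Lz].
- by rewrite !hornerZ !mulf_eq0 !negb_or k0.
- by rewrite !hornerZ hchord_scale// H2.
- by rewrite hornerZ mulf_eq0 negb_or k0.
- by rewrite (quot_derivn_scale A l k0 (H3 z Lz)); exact: H4.
Qed.

Lemma approximable_dense (F : set (nat * nat)) s h :
  (forall m, exists pq, [/\ F pq, (m <= pq.1)%N & (m <= pq.2)%N]) -> dense (approximable F s h).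
Proof.
move=> hF O [f0 Of0] oO.
have [cph|nh] := pselect (coprime_on (outer s) h); last by exists f0; split.
have [h20 h12] := cph.
have [N [e0 [e00 He0]]] := (open_XinfP oOmega O).1 oO f0 Of0.
(* Three errors separate [f0] from [g]: a rational function, its approximant, the perturbation. On
   [outer s] the last two must stay strictly below [s.+1%:R^-1]. *)
pose e := Num.min (e0 / 3) (s.+1%:R^-1 / 3).
have s0 : 0 < s.+1%:R^-1 :> R by rewrite invr_gt0 ltr0n.
have e0' : 0 < e by rewrite lt_min !divr_gt0.
have ee0 : e <= e0 / 3 by rewrite ge_min lexx.
have es : e + e < s.+1%:R^-1.
  have : e <= s.+1%:R^-1 / 3 by rewrite ge_min lexx orbT.
  by clear -s0; move: s0; move: (s.+1%:R^-1) (e) => x y; lra.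
pose M := maxn N s.
have [r rr fr] := (closure_rationalP oOmega (val f0)).1 (set_mem (valP f0)) M e e0'.
have [P0 [Q0 [Q00 Q0E rE]]] := rational_quot rr.
have E0 : E !=set0 by exists zeta.
have [P [Q [cop QE der onK]]] := @rational_approx R (outer s) E P0 Q0 h.1 h.2 M e (@outer_compact s) (@closed_closure _ Omega) E0 (@outer_out s)
  Q00 Q0E h20 h12 e0'.
have Q0' : Q != 0 by apply: contraNneq (QE zeta hzeta) => ->; rewrite horner0.
have [[p q] [Fpq /= mp mq]] := hF (size P + size Q)%N.
have sP : (size P <= p)%N by apply: leq_trans mp; rewrite leq_addr.
have sQ : (size Q <= p)%N by apply: leq_trans mp; rewrite leq_addl.
have sQ' : (size Q <= q.+1)%N by apply: leqW; apply: leq_trans mq; rewrite leq_addl.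
have KM z : outer s z -> normc z <= M%:R.
  by move=> [zs _]; rewrite (le_trans zs)// ler_nat leq_maxr.
have [P' [sP' cop' onK'] der'] := perturb_numerator cop Q0' QE KM sP sQ e0'.
have [ga gr gE] := Ainf_of_quot oOmega P' Q0' QE.
have [g gga] := Xinf_of_rational gr.
have fgE z : Omega z -> fn g z = P'.[z] / Q.[z] by rewrite /Xinf_fun gga; exact: gE.
have n2 : near_upto M (e + e) r (fn g).
  apply: (near_quot Q0E rE QE fgE) => l z lM Ez zM.
  apply: (le_trans (normcBD ((quot_derivn P Q l).[z] / Q.[z] ^+ l.+1) _ _)).
  by apply: lerD; [exact: der'|exact: der].
exists g; split.
  apply: He0; apply: near_uptoW (near_upto_trans fr n2); first exact: leq_maxl.
  by move: ee0; lra.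
move=> _; exists (p, q), (e + e).
(* [g] will be its own Pade approximant, so there is no error at all on [inner s]. *)
have coefE (n : nat) : taylor_coef Omega zeta (fn g) n = (quot_derivn P' Q n).[zeta] / Q.[zeta] ^+ n.+1 / (n`!)%:R.
  by rewrite /taylor_coef (ext_quot oOmega QE fgE n hzeta).
have [dD [k k0 [nE dE]]] := pade_exact (fun n => erefl) sP' sQ' (QE zeta hzeta) cop' coefE.
split=> //; first by right.
rewrite /pade_num /pade_den [jacobi_num _ _ _ _]nE [jacobi_den _ _ _ _]dE; apply: approximates_scale => //.
split=> [z _|z Kz|z [Ez _]|l z _ [Ez _]].
- exact: coprimep_neq0.
- apply: (le_trans (hchord_triangle (coprimep_neq0 z cop) (coprimep_neq0 z cop') (h12 z Kz))).
  by rewrite lerD ?onK ?onK'.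
- exact: QE.
- by rewrite (ext_quot oOmega QE fgE l Ez) subrr normc0 addr_ge0 ?ltW.
Qed.

End Density.

(** * Continuity of the Jacobi polynomials in the Taylor coefficients *)

Section CoefficientwiseLimits.
Variables (R : realType) (T : Type) (Fi : set_system T).
Context {FF : Filter Fi}.
Local Notation C := R[i].
Implicit Types (u v : T -> C) (l m : C) (F G : T -> {poly C}) (P Q : {poly C}).

Definition tendsto u l := forall e : R, 0 < e -> Fi [set g | normc (u g - l) < e].

Lemma tendsto_cst l : tendsto (fun=> l) l.
Proof. by move=> e e0; apply: nearW => g /=; rewrite subrr normc0. Qed.

Lemma tendstoD u v l m : tendsto u l -> tendsto v m -> tendsto (fun g => u g + v g) (l + m).
Proof.
move=> ul vm e e0; have e2 : 0 < e / 2 by rewrite divr_gt0.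
apply: filterS2 (ul _ e2) (vm _ e2) => g /= h1 h2.
rewrite opprD addrACA; apply: (le_lt_trans (normcD _ _)).
by rewrite [ltRHS]splitr ltrD.
Qed.

Lemma tendstoM u v l m : tendsto u l -> tendsto v m -> tendsto (fun g => u g * v g) (l * m).
Proof.
move=> ul vm e e0; pose S := 1 + normc l + normc m.
have S0 : 0 < S by rewrite /S -addrA ltr_pwDl// addr_ge0 ?normc_ge0.
pose d := Num.min 1 (e / S); have d0 : 0 < d by rewrite lt_min ltr01 divr_gt0.
apply: filterS2 (ul _ d0) (vm _ d0) => g /= h1 h2.
have -> : u g * v g - l * m = (u g - l) * (v g - m) + ((u g - l) * m + l * (v g - m)) by ring.
have d1 : d <= 1 by rewrite ge_min lexx.
have dS : d * S <= e by rewrite -ler_pdivlMr// ge_min lexx orbT.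
apply: lt_le_trans dS; apply: (le_lt_trans (normcD _ _)).
have a1 : normc ((u g - l) * (v g - m)) < d * 1.
  rewrite normcM; apply: (le_lt_trans (y := normc (u g - l) * 1)); last by rewrite ltr_pM2r.
  by rewrite ler_wpM2l ?normc_ge0// ltW// (lt_le_trans h2).
have a2 : normc ((u g - l) * m + l * (v g - m)) <= d * (normc l + normc m).
  apply: (le_trans (normcD _ _)); rewrite !normcM mulrDr addrC mulrC.
  by apply: lerD; rewrite ler_wpM2r ?normc_ge0// ltW.
rewrite (_ : d * S = d * 1 + d * (normc l + normc m)); first exact: ltr_leD a1 a2.
by rewrite /S -addrA mulrDr.
Qed.

Lemma tendsto_sum (I : Type) (r : seq I) (u : I -> T -> C) (l : I -> C) :
  (forall i, tendsto (u i) (l i)) -> tendsto (fun g => \sum_(i <- r) u i g) (\sum_(i <- r) l i).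
Proof.
move=> H; elim: r => [|i r IH].
  by rewrite big_nil; under eq_fun do rewrite big_nil; exact: tendsto_cst.
by rewrite big_cons; under eq_fun do rewrite big_cons; exact: tendstoD.
Qed.

(** The common bound on the degrees turns coefficientwise convergence into uniform convergence on
    bounded sets. *)
Definition polyto F P := (exists d : nat, forall g, (size (F g) <= d)%N) /\
  forall i, tendsto (fun g => (F g)`_i) P`_i.

Lemma polyto_cst P : polyto (fun=> P) P.
Proof. by split=> [|i]; [exists (size P)|exact: tendsto_cst]. Qed.

Lemma polytoC u l : tendsto u l -> polyto (fun g => (u g)%:P) l%:P.
Proof.
move=> ul; split=> [|i]; first by exists 1%N => g; exact: size_polyC_leq1.
rewrite coefC; under eq_fun do rewrite coefC.
by case: eqP => _ //; exact: tendsto_cst.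
Qed.

Lemma polytoD F G P Q : polyto F P -> polyto G Q -> polyto (fun g => F g + G g) (P + Q).
Proof.
move=> [[m Hm] FP] [[n Hn] GQ]; split=> [|i].
  exists (maxn m n) => g; apply: (leq_trans (size_polyD _ _)).
  by rewrite geq_max !leq_max Hm Hn orbT.
by rewrite coefD; under eq_fun do rewrite coefD; exact: tendstoD.
Qed.

Lemma polytoM F G P Q : polyto F P -> polyto G Q -> polyto (fun g => F g * G g) (P * Q).
Proof.
move=> [[m Hm] FP] [[n Hn] GQ]; split=> [|i].
  exists (m + n)%N => g; apply: (leq_trans (size_polyMleq _ _)).
  by apply: (leq_trans (leq_pred _)); rewrite leq_add.
rewrite coefM; under eq_fun do rewrite coefM.
by apply: tendsto_sum => j; exact: tendstoM.
Qed.

Lemma polyto_sum (I : Type) (r : seq I) (F : I -> T -> {poly C}) (P : I -> {poly C}) :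
  (forall i, polyto (F i) (P i)) -> polyto (fun g => \sum_(i <- r) F i g) (\sum_(i <- r) P i).
Proof.
move=> H; elim: r => [|i r IH].
  by rewrite big_nil; under eq_fun do rewrite big_nil; exact: polyto_cst.
by rewrite big_cons; under eq_fun do rewrite big_cons; exact: polytoD.
Qed.

Lemma polyto_prod (I : Type) (r : seq I) (F : I -> T -> {poly C}) (P : I -> {poly C}) :
  (forall i, polyto (F i) (P i)) -> polyto (fun g => \prod_(i <- r) F i g) (\prod_(i <- r) P i).
Proof.
move=> H; elim: r => [|i r IH].
  by rewrite big_nil; under eq_fun do rewrite big_nil; exact: polyto_cst.
by rewrite big_cons; under eq_fun do rewrite big_cons; exact: polytoM.
Qed.

Lemma polytoZ F P (c : C) : polyto F P -> polyto (fun g => c *: F g) (c *: P).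
Proof.
move=> FP; rewrite -mul_polyC; under eq_fun do rewrite -mul_polyC.
by apply: polytoM => //; exact: polyto_cst.
Qed.

Lemma polyto_deriv F P : polyto F P -> polyto (fun g => (F g)^`()) P^`().
Proof.
move=> [[m Hm] FP]; split=> [|i].
  by exists m => g; apply: leq_trans (Hm g); rewrite (leq_trans (size_poly _ _))// leq_pred.
rewrite coef_deriv -mulr_natl; under eq_fun do rewrite coef_deriv -mulr_natl.
by apply: tendstoM => //; exact: tendsto_cst.
Qed.

Lemma polyto_quot_derivn F G P Q (l : nat) : polyto F P -> polyto G Q ->
  polyto (fun g => quot_derivn (F g) (G g) l) (quot_derivn P Q l).
Proof.
move=> FP GQ; elim: l => [//|l IH] /=; rewrite -[- _]scaleN1r.
under eq_fun do rewrite -[- _]scaleN1r.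
apply: polytoD; first by apply: polytoM => //; exact: polyto_deriv.
by do 2!apply: polytoZ; apply: polytoM => //; exact: polyto_deriv.
Qed.

Lemma polyto_det n (A : T -> 'M[{poly C}]_n) (A0 : 'M[{poly C}]_n) :
  (forall i j, polyto (fun g => A g i j) (A0 i j)) -> polyto (fun g => \det (A g)) (\det A0).
Proof.
move=> H; apply: polyto_sum => s; apply: polytoM; first exact: polyto_cst.
by apply: polyto_prod => i; exact: H.
Qed.

Lemma polyto_horner F P (M e : R) : polyto F P -> 0 < e ->
  Fi [set g | forall z, normc z <= M -> normc ((F g).[z] - P.[z]) <= e].
Proof.
move=> [[m Hm] FP] e0; pose n := maxn m (size P).
pose S := 1 + \sum_(i < n) `|M| ^+ i.
have S1 : 0 <= \sum_(i < n) `|M| ^+ i by apply: sumr_ge0 => i _; exact: exprn_ge0.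
have S0 : 0 < S by rewrite ltr_pwDl.
have eS : 0 < e / S by rewrite divr_gt0.
have : Fi [set g | forall i : 'I_n, normc ((F g)`_i - P`_i) < e / S].
  by apply: filter_forall => i; exact: FP.
apply: filterS => g /= Hg z zM.
rewrite (@horner_coef_wide _ n (F g)) ?leq_max ?Hm// (@horner_coef_wide _ n P) ?leq_max ?leqnn ?orbT//.
rewrite -sumrB; under eq_bigr do rewrite -mulrBl.
apply: (le_trans (normc_sum _ _ _)); apply: (@le_trans _ _ (\sum_(i < n) (e / S) * `|M| ^+ i)).
  apply: ler_sum => i _; rewrite normcM normcX; apply: ler_pM; rewrite ?exprn_ge0 ?normc_ge0//; first exact/ltW.
  by apply: lerXn2r; rewrite ?nnegrE ?normc_ge0// (le_trans zM)// ler_norm.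
rewrite -mulr_sumr mulrAC ler_pdivrMr// ler_wpM2l ?(ltW e0)//.
by rewrite /S lerDr.
Qed.

Section JacobiPolynomials.
Variables (a : T -> int -> C) (a0 : int -> C).
Hypothesis a_a0 : forall n, tendsto (fun g => a g n) (a0 n).

Lemma polyto_jacobi_mx p q (row : T -> nat -> {poly C}) (row0 : nat -> {poly C}) :
  (forall j, polyto (fun g => row g j) (row0 j)) ->
  polyto (fun g => \det (jacobi_mx (a g) p q (row g))) (\det (jacobi_mx a0 p q row0)).
Proof.
move=> H; apply: polyto_det => i j; rewrite mxE; under eq_fun do rewrite mxE.
by case: eqP => _ //; exact: polytoC.
Qed.

Lemma polyto_jacobi_den zeta p q : polyto (fun g => jacobi_den (a g) zeta p q) (jacobi_den a0 zeta p q).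
Proof. by apply: polyto_jacobi_mx => j; exact: polyto_cst. Qed.

Lemma polyto_jacobi_num zeta p q : polyto (fun g => jacobi_num (a g) zeta p q) (jacobi_num a0 zeta p q).
Proof.
apply: polyto_jacobi_mx => j; apply: polytoM; first exact: polyto_cst.
case: (p%:Z - q%:Z + j%:Z) => [n|n]; last exact: polyto_cst.
apply: polyto_sum => i; rewrite -mul_polyC; under eq_fun do rewrite -mul_polyC.
by apply: polytoM; [exact: polytoC|exact: polyto_cst].
Qed.

End JacobiPolynomials.

Lemma polyto_quot F G P Q (L : set C) (e : R) : compact L -> (forall z, L z -> Q.[z] != 0) ->
  polyto F P -> polyto G Q -> 0 < e ->
  Fi [set g | forall z, L z -> (G g).[z] != 0 /\ normc ((F g).[z] / (G g).[z] - P.[z] / Q.[z]) <= e].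
Proof.
move=> cL QL FP GQ e0.
have [Mz Mz0 HMz] := compact_normc_bounded cL.
have [M1 M10 HM1] := quot_bounded 1 cL QL.
have [M2 M20 HM2] := quot_bounded P cL QL.
(* [M1] bounds [1 / Q] and [M2] bounds [P / Q] on [L]. Changing [Q] by at most [(2 * M1)^-1] leaves
   it at least that large, and the quotient then changes by at most [S] times the change of the
   polynomials. *)
pose S := 2 * M1 * (1 + M2); have S0 : 0 < S by rewrite !mulr_gt0// addr_gt0.
pose d := Num.min (2 * M1)^-1 (e / S).
have d0 : 0 < d by rewrite lt_min invr_gt0 mulr_gt0 ?divr_gt0.
have d1 : d <= (2 * M1)^-1 by rewrite ge_min lexx.
have dS : d * S <= e by rewrite -ler_pdivlMr// ge_min lexx orbT.
apply: filterS2 (polyto_horner Mz FP d0) (polyto_horner Mz GQ d0) => g /= hF hG z Lz.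
have {}hF := hF z (HMz z Lz); have {}hG := hG z (HMz z Lz).
have Qz := QL z Lz; have nQ : 0 < normc Q.[z] by rewrite normc_gt0.
have Qlow : M1^-1 <= normc Q.[z].
  have := HM1 z Lz; rewrite hornerC mul1r normcV => h.
  by rewrite -[leRHS]invrK lef_pV2// posrE ?invr_gt0.
have Glow : (2 * M1)^-1 <= normc (G g).[z].
  have h := normc_le_add (G g).[z] Q.[z]; rewrite normcB in h.
  have e1 : M1^-1 = (2 * M1)^-1 + (2 * M1)^-1 by field; rewrite gt_eqF.
  rewrite e1 in Qlow; have := le_trans Qlow (le_trans h (lerD (le_trans hG d1) (lexx _))).
  by rewrite lerD2l.
have nG : 0 < normc (G g).[z] by apply: lt_le_trans Glow; rewrite invr_gt0 mulr_gt0.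
have Gz : (G g).[z] != 0 by rewrite -normc_eq0 gt_eqF.
split=> //.
have -> : (F g).[z] / (G g).[z] - P.[z] / Q.[z]
    = (((F g).[z] - P.[z]) - P.[z] / Q.[z] * ((G g).[z] - Q.[z])) / (G g).[z].
  by field; rewrite Gz.
rewrite normcM normcV ler_pdivrMr//.
have h : normc ((F g).[z] - P.[z] - P.[z] / Q.[z] * ((G g).[z] - Q.[z])) <= d + M2 * d.
  apply: (le_trans (normcB_le _ _)); apply: lerD => //.
  by rewrite normcM; apply: ler_pM; rewrite ?normc_ge0// HM2.
apply: (le_trans h); apply: (@le_trans _ _ (e * (2 * M1)^-1)); last by rewrite ler_wpM2l ?(ltW e0).
by rewrite ler_pdivlMr ?mulr_gt0// (_ : _ * _ = d * S)// /S; ring.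
Qed.

End CoefficientwiseLimits.

(** * Openness of the approximation conditions *)

Section Openness.
Variables (R : realType) (Omega : set R[i]).
Hypothesis oOmega : open Omega.
Variable zeta : R[i].
Hypothesis hzeta : closure Omega zeta.
Local Notation C := R[i].
Local Notation E := (closure Omega).
Local Notation ext := (ext_deriv Omega).
Local Notation near_upto := (near_upto Omega).
Local Notation fn f := (Xinf_fun f).
Local Notation outer := (outer Omega).
Local Notation inner := (inner Omega).
Implicit Types (P Q A B : {poly C}) (z w : C).

Lemma hnorm_lower (K : set C) A B : compact K -> (forall z, K z -> (A.[z] != 0) || (B.[z] != 0)) ->
  exists2 d : R, 0 < d & forall z, K z -> d <= hnorm A.[z] B.[z].
Proof.
move=> cK KAB; apply: compact_uniform cK _ => x /KAB ab.
have key P (a b : C -> C) : P.[x] != 0 -> exists2 r : R, 0 < r & forall w (d : R), normc (w - x) < r ->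
    0 < d < r -> d <= normc P.[w].
  move=> Px; have n0 : 0 < normc P.[x] / 2 by rewrite divr_gt0 ?normc_gt0.
  have [r r0 Hr] := hasD_continuous (hasD_horner P x) n0.
  exists (Num.min r (normc P.[x] / 2)); first by rewrite lt_min r0.
  move=> w d; rewrite lt_min => /andP[wr _] /andP[d0]; rewrite lt_min => /andP[_ dP].
  have h := Hr w wr; have h' := normc_le_add P.[w] P.[x]; rewrite normcB in h'.
  have h2 := lt_le_trans dP (lexx _); move: n0 h h' h2; clear.
  by move: (normc P.[x]) (normc (_ - _)) (normc _) => a b c; lra.
case/orP: ab => h; [have [r r0 Hr] := key A id id h|have [r r0 Hr] := key B id id h];
  exists r => // w d wr dr _; apply: (le_trans (Hr w d wr dr)).
- exact: hnorm_gel.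
- exact: hnorm_ger.
Qed.

(** Two errors of at most [d / 4] cannot bring a vector of norm at least [d] to 0; [hchord_sub] is
    used in the direction that divides by the unperturbed norm. *)
Lemma hchord_near (a b a' b' : C) (d t e : R) : 0 < d -> d <= hnorm a b ->
  normc (a' - a) <= t -> normc (b' - b) <= t -> t <= 1 / 4 * d -> t <= e / 2 * d ->
  ((a' != 0) || (b' != 0)) /\ hchord a' b' a b <= e.
Proof.
move=> d0 dab a't b't td te.
have ab : (a != 0) || (b != 0).
  apply: contraTT dab; rewrite negb_or !negbK -ltNge => /andP[/eqP-> /eqP->].
  by rewrite (le_lt_trans (hnorm_le _ _))// normc0 addr0.
have ab' : (a' != 0) || (b' != 0).
  rewrite -negb_and; apply/negP => /andP[/eqP a0 /eqP b0].
  move: a't b't; rewrite a0 b0 !sub0r !normcN => h1 h2.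
  have := le_trans (le_trans dab (hnorm_le _ _)) (lerD h1 h2).
  by clear -td d0; lra.
split=> //; apply: (le_trans (hchord_sub ab' ab)); rewrite ler_pdivrMr ?hnorm_gt0//.
rewrite (normcB a) (normcB b); apply: (le_trans (lerD a't b't)).
apply: (le_trans (lerD te te)); rewrite -mulrDl -splitr.
have e0 : 0 <= e.
  have := le_trans (normc_ge0 _) (le_trans a't te); rewrite pmulr_lge0//.
  by rewrite pmulr_lge0// invr_gt0.
by rewrite ler_wpM2l.
Qed.

(** The basic neighbourhoods as a filter: limits along it give back an order and a radius, the form
    of openness in [open_XinfP]. *)
Definition near_filter (f : Xinf Omega) : set_system (Xinf Omega) :=
  [set S | exists (N : nat) (e : R), 0 < e /\ forall g, near_upto N e (fn f) (fn g) -> S g].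

Instance near_filter_filter f : Filter (near_filter f).
Proof.
split=> [|S S' [N [e [e0 H]]] [N' [e' [e'0 H']]]|S S' SS' [N [e [e0 H]]]].
- by exists 0%N, 1.
- exists (maxn N N'), (Num.min e e'); rewrite lt_min e0; split=> // g fg; split.
    by apply: H; apply: near_uptoW fg; rewrite ?leq_maxl// ge_min lexx.
  by apply: H'; apply: near_uptoW fg; rewrite ?leq_maxr// ge_min lexx orbT.
- by exists N, e; split=> // g /H/SS'.
Qed.

Lemma near_filter_ext f l z : E z ->
  tendsto (near_filter f) (fun g => ext (fn g) l z) (ext (fn f) l z).
Proof.
move=> Ez e e0; pose N := maxn l (Num.truncn (normc z)).+1.
exists N, (e / 2); split; first by rewrite divr_gt0.
move=> g fg /=; apply: (@le_lt_trans _ _ (e / 2)); last by rewrite ltr_pdivrMr// mulr_natr mulr2n ltrDl.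
apply: fg => //; first exact: leq_maxl.
apply: (@le_trans _ _ (Num.truncn (normc z)).+1%:R); last by rewrite ler_nat leq_maxr.
by apply/ltW/Num.Theory.truncnS_gt.
Qed.

Lemma near_filter_taylor f n : 
  tendsto (near_filter f) (fun g => taylor_coef Omega zeta (fn g) n) (taylor_coef Omega zeta (fn f) n).
Proof.
case: n => [n|n] /=; last exact: tendsto_cst.
by apply: tendstoM; [exact: near_filter_ext|exact: tendsto_cst].
Qed.

Lemma polyto_exp (T : Type) (Fi : set_system T) (FF : Filter Fi) (F : T -> {poly C}) P n :
  polyto Fi F P -> polyto Fi (fun g => F g ^+ n) (P ^+ n).
Proof.
move=> FP; elim: n => [|n IH]; first by rewrite expr0; under eq_fun do rewrite expr0; exact: polyto_cst.
by rewrite exprS; under eq_fun do rewrite exprS; exact: polytoM.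
Qed.

Lemma approximates_near s h (e e' : R) f A B (A' B' : Xinf Omega -> {poly C}) :
  coprime_on (outer s) h -> approximates Omega s h e (fn f) A B -> e < e' ->
  polyto (near_filter f) A' A -> polyto (near_filter f) B' B ->
  near_filter f [set g | approximates Omega s h e' (fn g) (A' g) (B' g)].
Proof.
move=> [_ hc] [H1 H2 H3 H4] ee A'A B'B; have FF := near_filter_filter f.
pose K := outer s `|` inner s.
have cK : compact K by apply: compactU; [exact: outer_compact|exact: inner_compact].
have [d d0 Hd] := hnorm_lower cK H1.
have t0 : 0 < (e' - e) / 4 by rewrite divr_gt0// subr_gt0.
(* [hchord_near] is applied with half of the slack [e' - e], whence the quarter. On [inner s] one
   half of the slack goes to the quotient and one to [f] itself. *)
pose t := Num.min (1 / 4) ((e' - e) / 4) * d.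
have tt0 : 0 < t by rewrite mulr_gt0// lt_min t0 divr_gt0.
have KM z : K z -> normc z <= s%:R by move=> [[]|[]].
have near1 := @polyto_horner _ _ _ FF _ _ s%:R _ A'A tt0.
have near2 := @polyto_horner _ _ _ FF _ _ s%:R _ B'B tt0.
have e20 : 0 < (e' - e) / 2 by rewrite divr_gt0// subr_gt0.
have near3 : near_filter f [set g | forall l z, (l <= s)%N -> inner s z ->
    normc (ext (fn g) l z - ext (fn f) l z) <= (e' - e) / 2].
  by exists s, ((e' - e) / 2); split=> // g fg l z ls [Ez zs]; exact: fg.
have near4 : near_filter f [set g | forall (l : 'I_s.+1) z, inner s z -> (B' g ^+ l.+1).[z] != 0 /\
    normc ((quot_derivn (A' g) (B' g) l).[z] / (B' g ^+ l.+1).[z] -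
           (quot_derivn A B l).[z] / (B ^+ l.+1).[z]) <= (e' - e) / 2].
  apply: (filter_forall (near_filter_filter f)) => l; apply: polyto_quot => //.
  - exact: inner_compact.
  - by move=> z /H3 Bz; rewrite horner_exp expf_neq0.
  - exact: polyto_quot_derivn.
  - exact: polyto_exp.
have := @filterI _ _ FF _ _ (@filterI _ _ FF _ _ near1 near2) (@filterI _ _ FF _ _ near3 near4).
apply: (@filterS _ _ FF) => g [[g1 g2] [g3 g4]].
have AB z : K z -> (((A' g).[z] != 0) || ((B' g).[z] != 0)) /\
    hchord (A' g).[z] (B' g).[z] A.[z] B.[z] <= (e' - e) / 2.
  move=> Kz; apply: (hchord_near d0 (Hd z Kz) (g1 z (KM z Kz)) (g2 z (KM z Kz))).
    by rewrite ler_pM2r// ge_min lexx.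
  by rewrite ler_pM2r// ge_min; apply/orP; right; clear -ee; lra.
split=> [z /AB[]//|z Oz|z Iz|l z ls Iz].
- have Kz : K z by left.
  have [ab hh] := AB z Kz; apply: (le_trans (hchord_triangle (H1 z Kz) ab (hc z Oz))).
  apply: (le_trans (lerD hh (H2 z Oz))); clear -ee; lra.
- by have [] := g4 ord0 z Iz; rewrite expr1.
- have ls' : (l < s.+1)%N by rewrite ltnS.
  have [_] := g4 (Ordinal ls') z Iz; rewrite /= !horner_exp => h1.
  have h2 := g3 l z ls Iz; have h3 := H4 l z ls Iz; rewrite normcB in h2.
  apply: (le_trans (normcBD (ext (fn f) l z) _ _)).
  apply: (@le_trans _ _ (((e' - e) / 2 + e) + (e' - e) / 2)); last by clear -ee; lra.
  apply: lerD => //; apply: (le_trans (normcBD _ _ _)); exact: lerD h1 h3.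
Qed.

Lemma approximable_open (F : set (nat * nat)) s h : open (@approximable R Omega zeta F s h).
Proof.
apply/(open_XinfP oOmega) => f Vf.
have [cph|nh] := pselect (coprime_on (outer s) h); last by exists 0%N, 1; split=> // g _ /nh.
have [[p q] [e [Fpq dD es ap]]] := Vf cph; rewrite /= in dD.
have FF := near_filter_filter f.
pose e' := (e + s.+1%:R^-1) / 2.
have ee' : e < e' by rewrite /e' ltr_pdivlMr// mulr_natr mulr2n ltrD2l.
have e's : e' < s.+1%:R^-1 by rewrite /e' ltr_pdivrMr// mulr_natr mulr2n ltrD2r.
have at_ := near_filter_taylor f.
have pA := @polyto_jacobi_num _ _ _ FF _ _ at_ zeta p q.
have pB := @polyto_jacobi_den _ _ _ FF _ _ at_ zeta p q.
have n1 := approximates_near cph ap ee' pA pB.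
(* Up to sign the Hankel determinant is the value of the denominator at [zeta], so its nonvanishing
   persists by [polyto_quot] on the compact set reduced to [zeta]. *)
have n2 : near_filter f [set g | in_D Omega zeta p q (fn g)].
  case: dD => [q0|dD]; first by exists 0%N, 1; split=> // g _; left.
  have c1 : compact [set zeta] by exact: compact_set1.
  have B0 z : [set zeta] z -> (jacobi_den (taylor_coef Omega zeta (fn f)) zeta p q).[z] != 0.
    by move=> ->; rewrite jacobi_den_eval// mulf_neq0// signr_eq0.
  have := @polyto_quot _ _ _ FF _ _ _ _ _ _ c1 B0 pB pB ltr01.
  apply: (@filterS _ _ FF) => g /(_ zeta erefl)[hz _]; right.
  by move: hz; rewrite jacobi_den_eval// mulf_eq0 negb_or => /andP[].
have [N [d [d0 Hd]]] := @filterI _ _ FF _ _ n1 n2.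
exists N, d; split=> // g /Hd[g1 g2] _.
by exists (p, q), e'.
Qed.

End Openness.

(** * Universal functions *)

Section CountableApproximation.
Variables (R : realType).
Local Notation C := R[i].
Implicit Types (P Q A B : {poly C}) (z w c : C).

Definition rat_complex (x : rat * rat) : C := ratr x.1 +i* ratr x.2.

Lemma rat_complex_dense c (d : R) : 0 < d -> exists x, normc (rat_complex x - c) <= d.
Proof.
move=> d0; have d2 : 0 < d / 2 by rewrite divr_gt0.
have key (t : R) : exists x : rat, `|ratr x - t| <= d / 2.
  have [|x] := @rat_in_itvoo R (t - d / 2) (t + d / 2); first by rewrite ltrD2l gtrN.
  rewrite in_itv /= => /andP[h1 h2]; exists x; rewrite ler_distl; apply/andP; split; apply: ltW => //.
case: c => a b; have [x hx] := key a; have [y hy] := key b; exists (x, y).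
by apply: (le_trans (normc_leReIm _)); rewrite [leRHS]splitr; exact: lerD.
Qed.

Definition rat_poly (s : seq (rat * rat)) : {poly C} := foldr (fun x P => P * 'X + (rat_complex x)%:P) 0 s.

Lemma rat_poly_dense P (M d : R) : 0 <= M -> 0 < d ->
  exists s, forall z, normc z <= M -> normc ((rat_poly s).[z] - P.[z]) <= d.
Proof.
move=> M0; elim/poly_ind: P d => [|P c IH] d d0.
  by exists [::] => z _; rewrite subrr normc0 ltW.
have d2 : 0 < d / 2 by rewrite divr_gt0.
have M1 : 0 < M + 1 by rewrite ltr_wpDl.
have [s Hs] := IH (d / 2 / (M + 1)) (divr_gt0 d2 M1).
have [x Hx] := rat_complex_dense c d2.
exists (x :: s) => z zM; rewrite /= !hornerMXaddC.
have -> : (rat_poly s).[z] * z + rat_complex x - (P.[z] * z + c)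
    = ((rat_poly s).[z] - P.[z]) * z + (rat_complex x - c) by ring.
apply: (le_trans (normcD _ _)); rewrite [leRHS]splitr; apply: lerD => //.
rewrite normcM; apply: (@le_trans _ _ (d / 2 / (M + 1) * (M + 1))); last by rewrite divfK ?gt_eqF.
by apply: ler_pM; rewrite ?normc_ge0 ?Hs// (le_trans zM)// lerDl.
Qed.

Lemma rat_pair_dense (K : set C) P Q (e : R) : compact K -> Q != 0 -> 0 < e ->
  (forall z, K z -> (P.[z] != 0) || (Q.[z] != 0)) ->
  exists s t, coprime_on K (rat_poly s, rat_poly t) /\
    forall z, K z -> hchord (rat_poly s).[z] (rat_poly t).[z] P.[z] Q.[z] <= e.
Proof.
move=> cK Q0 e0 PQ; have [z0 z0Q] := closed_nonrootP _ Q0.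
have {}z0Q : Q.[z0] != 0 by rewrite rootE in z0Q.
have n0 : 0 < normc Q.[z0] by rewrite normc_gt0.
have [d d0 Hd] := hnorm_lower cK PQ.
have [M M0 HM] := compact_normc_bounded cK.
(* The first bound keeps the new denominator nonzero at [z0], hence nonzero as a polynomial, which
   closeness on [K] alone would not ensure. *)
pose t := Num.min (normc Q.[z0] / 2) (Num.min (1 / 4 * d) (e / 2 * d)).
have t0 : 0 < t by rewrite !lt_min !mulr_gt0 ?invr_gt0.
have [tQ td te] : [/\ t <= normc Q.[z0] / 2, t <= 1 / 4 * d & t <= e / 2 * d].
  by rewrite /t !ge_min !lexx !orbT.
have M'0 : 0 <= M + normc z0 by rewrite addr_ge0 ?normc_ge0 ?ltW.
have [a Ha] := rat_poly_dense P M'0 t0; have [b Hb] := rat_poly_dense Q M'0 t0.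
have KM z : K z -> normc z <= M + normc z0.
  by move=> /HM h; rewrite (le_trans h)// lerDl normc_ge0.
have near z (Kz : K z) := hchord_near d0 (Hd z Kz) (Ha z (KM z Kz)) (Hb z (KM z Kz)) td te.
exists a, b; split; last by move=> z /near[].
split=> [/=|z /near[]//].
have z0M : normc z0 <= M + normc z0 by rewrite lerDr ltW.
apply/eqP => e1; have := Hb z0 z0M; rewrite e1 horner0 sub0r normcN => h.
by have := le_trans h tQ; rewrite leNgt ltr_pdivrMr// mulr_natr mulr2n ltrDl n0.
Qed.

End CountableApproximation.

Section Ereal.
Variable R : realType.
Local Notation C := R[i].

Lemma sup_on_ge0 (K : set C) (u : C -> \bar R) : (0%E <= sup_on K u)%E.
Proof. by apply: ereal_sup_ubound; left. Qed.

Lemma cvg0_ereal (u : nat -> \bar R) : (forall n, (0%E <= u n)%E) ->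
  (u n @[n --> \oo] --> 0%E) <->
  (forall e : R, 0 < e -> exists N, forall n, (N <= n)%N -> (u n <= e%:E)%E).
Proof.
move=> u0; split=> [H e e0|H].
  have : nbhs (0%:E : \bar R) [set x | (x <= e%:E)%E].
    apply/nbhs_EFin; apply/nbhs_ballP; exists e => // x.
    rewrite /ball /= sub0r normrN lee_fin => xe; exact: le_trans (ler_norm _) (ltW xe).
  by move=> /H [N _ HN]; exists N => n Nn; exact: HN.
move=> P /nbhs_EFin/nbhs_ballP[e /= e0 He].
have e2 : 0 < e / 2 by rewrite divr_gt0.
have [N HN] := H _ e2; exists N => // n /= Nn.
have := HN n Nn; have := u0 n; case: (u n) => [x| |]//; rewrite !lee_fin => x0 xe.
apply: He; rewrite /ball /= sub0r normrN ger0_norm//; apply: (le_lt_trans xe).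
by rewrite ltr_pdivrMr// mulr_natr mulr2n ltrDl.
Qed.

End Ereal.

Section Universality.
Variables (R : realType) (Omega : set R[i]).
Hypothesis oOmega : open Omega.
Variable zeta : R[i].
Hypothesis hzeta : closure Omega zeta.
Variable F : set (nat * nat).
Local Notation C := R[i].
Local Notation E := (closure Omega).
Local Notation ext := (ext_deriv Omega).
Local Notation fn f := (Xinf_fun f).
Local Notation outer := (outer Omega).
Local Notation inner := (inner Omega).
Local Notation pade_num := (pade_num Omega zeta).
Local Notation pade_den := (pade_den Omega zeta).
Local Notation approximable := (@approximable R Omega zeta F).
Implicit Types (P Q A B : {poly C}) (z w : C).

Lemma den_neq0 (f : C -> C) pq : in_D Omega zeta pq.1 pq.2 f -> pade_den f pq != 0.
Proof.
case: pq => p q /= H; have : (pade_den f (p, q)).[zeta] != 0; last first.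
  by apply: contraNneq => ->; rewrite horner0.
rewrite jacobi_den_eval//= mulf_neq0 ?signr_eq0//.
by case: H => [->|//]; rewrite det_mx00 oner_eq0.
Qed.

Lemma rat_deriv_frac A B l z : B != 0 -> B.[z] != 0 ->
  rat_deriv (tofrac A / tofrac B) l z = Some ((quot_derivn A B l).[z] / B.[z] ^+ l.+1).
Proof.
move=> B0 Bz; have ev w : B.[w] != 0 -> rat_eval (tofrac A / tofrac B) w = Some (A.[w] / B.[w]).
  by move=> Bw; rewrite rat_eval_frac ?Bw ?orbT// /sphere_point (negPf Bw).
rewrite /rat_deriv ev//; congr Some.
have [r r0 Hr] := horner_neq0_near Bz.
by apply: (derive1n_quot l r0) => w /Hr Bw; split=> //; rewrite ev.
Qed.

Lemma rat_deriv_pole A B l z : B != 0 -> A.[z] != 0 -> B.[z] = 0 ->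
  rat_deriv (tofrac A / tofrac B) l z = None.
Proof. by move=> B0 Az Bz; rewrite /rat_deriv rat_eval_frac ?Az// /sphere_point Bz eqxx. Qed.

Lemma universal_approximable f h s : pade_universal Omega zeta F (fn f) -> approximable s h f.
Proof.
move=> Uf [h20 h12].
have [pq [FP DP KP LP]] := Uf (tofrac h.1 / tofrac h.2) _ (@outer_compact R Omega s) (@outer_out R Omega s).
have iE : inner s `<=` E by move=> z [].
have [[nL HnL] derP] := LP _ (@inner_compact R Omega s) iE.
pose e : R := s.+1%:R^-1 / 2.
have s0 : 0 < s.+1%:R^-1 :> R by rewrite invr_gt0 ltr0n.
have e0 : 0 < e by rewrite divr_gt0.
have es : e < s.+1%:R^-1 by rewrite ltr_pdivrMr// mulr_natr mulr2n ltrDl.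
have [nK HnK] := (cvg0_ereal (fun n => sup_on_ge0 _ _)).1 KP e e0.
have [nd Hnd] := @choice _ _ (fun l N => forall n, (N <= n)%N -> (sup_on (inner s)
    (fun z => euclid (rat_deriv (pade_approx Omega zeta (fn f) (pq n)) l z) (ext (fn f) l z)) <= e%:E)%E)
  (fun l => (cvg0_ereal (fun n => sup_on_ge0 _ _)).1 (derP l) e e0).
pose n := maxn nL (maxn nK (\max_(l < s.+1) nd l)).
have nnL : (nL <= n)%N by rewrite leq_maxl.
have nnK : (nK <= n)%N by rewrite /n maxnCA leq_maxl.
have nnd l : (l <= s)%N -> (nd l <= n)%N.
  rewrite -ltnS => ls; apply: (@leq_trans (\max_(i < s.+1) nd i)); last by rewrite /n maxnA leq_maxr.
  exact: (leq_bigmax (F := fun i : 'I_s.+1 => nd i) (Ordinal ls)).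
have B0 := den_neq0 (DP n).
have AB z : outer s z \/ inner s z -> ((pade_num (fn f) (pq n)).[z] != 0) || ((pade_den (fn f) (pq n)).[z] != 0).
  move=> Kz; rewrite -negb_and; apply/negP => /andP[Az Bz]; apply: (HnL n nnL).
  by exists z.
have derz l z : (l <= s)%N -> inner s z -> (euclid (rat_deriv (pade_approx Omega zeta (fn f) (pq n)) l z) (ext (fn f) l z) <= e%:E)%E.
  move=> ls Iz; apply: le_trans (Hnd l n (nnd l ls)); apply: ereal_sup_ubound; right; by exists z.
(* A zero of the denominator would be a pole, where [euclid] is infinite already at order 0. *)
have Bz z : inner s z -> (pade_den (fn f) (pq n)).[z] != 0.
  move=> Iz; have Az := AB z (or_intror Iz); have := derz 0%N z (leq0n s) Iz.
  apply: contraTneq => Bz; rewrite Bz eqxx orbF in Az.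
  by rewrite [rat_deriv _ _ _](rat_deriv_pole 0 B0 Az Bz).
exists (pq n), e; split=> //; split=> // [z Oz|l z ls Iz].
- rewrite -chordal_sphere_point ?AB ?h12//; last by left.
  have : ((chordal (rat_eval (pade_approx Omega zeta (fn f) (pq n)) z) (rat_eval (tofrac h.1 / tofrac h.2) z))%:E <= e%:E)%E.
    by apply: le_trans (HnK n nnK); apply: ereal_sup_ubound; right; exists z.
  by rewrite lee_fin (rat_eval_frac h20 (h12 z Oz)) [rat_eval _ _](rat_eval_frac B0 (AB z (or_introl Oz))).
- by have := derz l z ls Iz; rewrite [rat_deriv _ _ _](rat_deriv_frac _ l B0 (Bz z Iz)) /= lee_fin.
Qed.

Lemma outer_absorbs (K : set C) : compact K -> K `<=` ~` E ->
  exists s0, forall s, (s0 <= s)%N -> K `<=` outer s.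
Proof.
move=> cK KE; have [r r0 Hr] := compact_dist_gt0 cK (@closed_closure _ Omega) KE.
have [M M0 HM] := compact_normc_bounded cK.
exists (maxn (Num.truncn M).+1 (Num.truncn r^-1).+1) => s; rewrite geq_max => /andP[sM sr] z Kz.
split=> [|w Ew].
  apply: (le_trans (HM z Kz)); apply: (@le_trans _ _ (Num.truncn M).+1%:R); last by rewrite ler_nat.
  exact/ltW/truncnS_gt.
rewrite normcB; apply: le_trans (Hr z w Kz Ew).
rewrite -[leRHS]invrK lef_pV2 ?posrE ?invr_gt0 ?ltr0n//.
apply: (@le_trans _ _ (Num.truncn r^-1).+1%:R); first exact/ltW/truncnS_gt.
by rewrite ler_nat leqW.
Qed.

Lemma inner_absorbs (L : set C) : compact L -> L `<=` E ->
  exists s0, forall s, (s0 <= s)%N -> L `<=` inner s.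
Proof.
move=> cL LE; have [M M0 HM] := compact_normc_bounded cL.
exists (Num.truncn M).+1 => s sM z Lz; split; first exact: LE.
apply: (le_trans (HM z Lz)); apply: (@le_trans _ _ (Num.truncn M).+1%:R); last by rewrite ler_nat.
exact/ltW/truncnS_gt.
Qed.

Lemma small_inverse (e : R) : 0 < e -> exists N, forall n, (N <= n)%N -> n.+1%:R^-1 <= e.
Proof.
move=> e0; exists (Num.truncn e^-1) => n Nn.
rewrite -[leRHS]invrK lef_pV2 ?posrE ?invr_gt0 ?ltr0n//.
apply: (@le_trans _ _ (Num.truncn e^-1).+1%:R); first exact/ltW/truncnS_gt.
by rewrite ler_nat ltnS.
Qed.

Lemma approximable_universal (f : Xinf Omega) :
  (forall s a b, approximable s (rat_poly R a, rat_poly R b) f) ->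
  pade_universal Omega zeta F (fn f).
Proof.
move=> Vf h K cK KE.
have [s0 Hs0] := outer_absorbs cK KE.
have h0 : rat_den h != 0 by have [] := rat_numdenP h.
(* The stage [s0 + n] depends on [K] but on no [L], so one sequence serves every [L]. The factor 2
   adds the error of the Gaussian-rational pair to that of the approximant. *)
pose good n (pq : nat * nat) := F pq /\ in_D Omega zeta pq.1 pq.2 (fn f) /\
  let A := pade_num (fn f) pq in let B := pade_den (fn f) pq in let s := (s0 + n)%N in
  [/\ forall z, outer s z \/ inner s z -> (A.[z] != 0) || (B.[z] != 0),
      forall z, outer s z -> hchord A.[z] B.[z] (rat_num h).[z] (rat_den h).[z] <= 2 * s.+1%:R^-1,
      forall z, inner s z -> B.[z] != 0 &
      forall l z, (l <= s)%N -> inner s z ->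
        normc ((quot_derivn A B l).[z] / B.[z] ^+ l.+1 - ext (fn f) l z) <= s.+1%:R^-1].
have [pq Hpq] : {pq : nat -> nat * nat & forall n, good n (pq n)}.
  apply: (@choice _ _ good) => n; pose s := (s0 + n)%N.
  have i0 : 0 < s.+1%:R^-1 :> R by rewrite invr_gt0 ltr0n.
  have [a [b [cab hab]]] := rat_pair_dense (@outer_compact R Omega s) h0 i0 (fun z _ => rat_num_den_neq0 h z).
  have [pq [e [Fpq dD es [H1 H2 H3 H4]]]] := Vf s a b cab.
  exists pq; split=> //; split=> //; split=> // [z Oz|l z ls Iz].
    apply: (le_trans (hchord_triangle (cab.2 z Oz) (H1 z (or_introl Oz)) (rat_num_den_neq0 h z))).
    rewrite mulr_natl mulr2n; apply: lerD; last exact: hab.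
    by apply: (le_trans (H2 z Oz)); exact: ltW.
  by apply: (le_trans (H4 l z ls Iz)); exact: ltW.
exists pq; split.
- by move=> n; have [] := Hpq n.
- by move=> n; have [_ []] := Hpq n.
- apply/cvg0_ereal => [n|e e0]; first exact: sup_on_ge0.
  have e2 : 0 < e / 2 by rewrite divr_gt0.
  have [N HN] := small_inverse e2; exists N => n Nn.
  apply: sup_on_le => [|z Kz]; first exact: ltW.
  have [_ [dD [H1 H2 _ _]]] := Hpq n.
  have Oz : outer (s0 + n) z by apply: Hs0 Kz; exact: leq_addr.
  have B0 := den_neq0 dD.
  have -> : rat_eval (pade_approx Omega zeta (fn f) (pq n)) z = sphere_point (pade_num (fn f) (pq n)).[z] (pade_den (fn f) (pq n)).[z].
    exact: (rat_eval_frac B0 (H1 z (or_introl Oz))).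
  rewrite rat_evalE chordal_sphere_point ?rat_num_den_neq0 ?H1//; last by left.
  apply: (le_trans (H2 z Oz)); rewrite mulrC -ler_pdivlMr//; apply: HN.
  by apply: leq_trans Nn _; rewrite leq_addl.
- move=> L cL LE; have [s1 Hs1] := inner_absorbs cL LE; split.
    exists s1 => n s1n [z KLz [Az Bz]]; have [_ [_ [H1 _ _ _]]] := Hpq n.
    have : outer (s0 + n) z \/ inner (s0 + n) z.
      case: KLz => [Kz|Lz]; [left|right].
        by apply: Hs0 Kz; exact: leq_addr.
      by apply: Hs1 Lz; apply: leq_trans s1n _; rewrite leq_addl.
    by move=> /H1; rewrite -negb_and => /negP; apply; apply/andP; split.
  move=> l; apply/cvg0_ereal => [n|e e0]; first exact: sup_on_ge0.
  have [N HN] := small_inverse e0; exists (maxn N (maxn s1 l)) => n.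
  rewrite !geq_max => /and3P[Nn s1n ln].
  have [_ [dD [_ _ H3 H4]]] := Hpq n; have B0 := den_neq0 dD.
  apply: ge_ereal_sup => _ [->|[z Lz <-]]; first by rewrite lee_fin ltW.
  have Iz : inner (s0 + n) z by apply: Hs1 Lz; apply: leq_trans s1n _; rewrite leq_addl.
  have -> : rat_deriv (pade_approx Omega zeta (fn f) (pq n)) l z =
      Some ((quot_derivn (pade_num (fn f) (pq n)) (pade_den (fn f) (pq n)) l).[z] / (pade_den (fn f) (pq n)).[z] ^+ l.+1).
    exact: (rat_deriv_frac _ l B0 (H3 z Iz)).
  rewrite lee_fin; apply: (le_trans (H4 l z _ Iz)); first by apply: leq_trans ln _; rewrite leq_addl.
  by apply: HN; apply: leq_trans Nn _; rewrite leq_addl.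
Qed.

End Universality.

Theorem theorem3p2 (R : realType) (F : set (nat * nat)%type)
  (hF : exists p q : nat -> nat,
     [/\ forall n, F (p n, q n),
         p n @[n --> \oo] --> \oo
       & q n @[n --> \oo] --> \oo])
  (Omega : set R[i]) (hOmega : open Omega)
  (zeta : R[i]) (hzeta : closure Omega zeta) :
  (exists f : Xinf Omega, pade_universal Omega zeta F (Xinf_fun f)) /\
  dense [set f : Xinf Omega | pade_universal Omega zeta F (Xinf_fun f)] /\
  Gdelta [set f : Xinf Omega | pade_universal Omega zeta F (Xinf_fun f)].
Proof.
have hF' m : exists pq, [/\ F pq, (m <= pq.1)%N & (m <= pq.2)%N].
  have [p [q [Fpq /cvgnyPge/(_ m) hp /cvgnyPge/(_ m) hq]]] := hF.
  have [n [pn qn]] := filter_ex (filterI hp hq).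
  by exists (p n, q n).
(* Codes of no triple contribute the whole space. *)
pose G (k : nat) : set (Xinf Omega) :=
  if @unpickle (nat * (seq (rat * rat) * seq (rat * rat)))%type k is Some (s, (a, b))
  then approximable zeta F s (rat_poly R a, rat_poly R b) else setT.
have Go k : open (G k).
  by rewrite /G; case: unpickle => [[s [a b]]|]; [exact: approximable_open|exact: openT].
have Gd k : dense (G k).
  rewrite /G; case: unpickle => [[s [a b]]|]; first exact: approximable_dense.
  by move=> O O0 _; rewrite setIT.
have UG : [set f : Xinf Omega | pade_universal Omega zeta F (Xinf_fun f)] = \bigcap_k G k.
  apply/seteqP; split=> [f Uf k _|f Gf].
    by rewrite /G; case: unpickle => [[s [a b]]|//]; exact: universal_approximable.
  apply: approximable_universal => // s a b.
  by have := Gf (pickle (s, (a, b))) I; rewrite /G pickleK.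
have Ud : dense [set f : Xinf Omega | pade_universal Omega zeta F (Xinf_fun f)].
  by rewrite UG; apply: Xinf_Baire.
split; last by split=> //; exists G.
(* Density gives existence only in an inhabited space; the zero function, as the quotient 0 / 1, is
   an element. *)
have one0 z : closure Omega z -> (1 : {poly R[i]}).[z] != 0 by rewrite hornerC oner_eq0.
have [f0 rf0 _] := Ainf_of_quot hOmega 0 (oner_neq0 _) one0.
have [g0 _] := Xinf_of_rational rf0.
have [|f [_ Uf]] := Ud setT _ openT; first by exists g0.
by exists f.
Qed.
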